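(* Let $L$ be a Laplacian on $[n]$, let $\mathcal I\subset[n]$ be nonempty, and let $t>0$. With $P(t)=e^{-Lt}$, the projective compression $P_{\mathcal I}(t)$, the structure-preserving compression $P^{\mathrm{sp}}_{\mathcal I}(t)$, the Nyström errors $\varepsilon_2(\mathcal I),\varepsilon_*(\mathcal I)$ and the obliqueness norms $\psi_2(\mathcal I),\psi_*(\mathcal I)$ defined in the context, the following hold for each of the two norms, i.e. with $\bullet=2$ and with $\bullet=*$ : $$\|P^{\mathrm{sp}}_{\mathcal I}(t)-P_{\mathcal I}(t)\|_{\bullet}\le\frac{2}{\pi}\,\frac{\psi_{\bullet}(\mathcal I)}{t},$$ $$\|P^{\mathrm{sp}}_{\mathcal I}(t)-P(t)\|_{\bullet}\le\frac1t\Big(\frac{3\sqrt3}{2\pi}\,\varepsilon_{\bullet}(\mathcal I)+\frac2\pi\,\psi_{\bullet}(\mathcal I)\Big).$$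
   Context: Let $[n]=\{1,\dots,n\}$. Let $R\in\mathbb{R}^{n\times n}$ be the rate matrix of an irreducible reversible continuous-time Markov chain $(X_t)_{t\ge0}$ on $[n]$: $R_{i,j}\ge 0$ for $i\ne j$, $R\mathbf 1=\mathbf 0$, $R$ irreducible, with unique (entrywise positive) stationary distribution $\pi$, $\mathbf 1^\top\pi=1$, $R^\top\pi=\mathbf 0$, and $\mathrm{diag}(\pi)R=R^\top\mathrm{diag}(\pi)$. Put $h:=\pi^{1/2}$ (entrywise) and $L:=-\mathrm{diag}(h)\,R\,\mathrm{diag}(h)^{-1}$. A ''Laplacian'' is any matrix $L$ arising this way; it is symmetric positive semidefinite with null space spanned by $h$. $\|\cdot\|_2$ is the spectral norm and $\|\cdot\|_*$ the nuclear norm. Committor: with $\tau_{\mathcal I}:=\min\{t\ge0:X_t\in\mathcal I\}$, let $\tilde C_{i,j}:=\mathbb P(X_{\tau_{\mathcal I}}=j\mid X_0=i)$ ($i\in[n],j\in\mathcal I$), $\hat\pi:=\tilde C^\top\pi$, $\hat h:=\hat\pi^{1/2}$, $C:=\mathrm{diag}(h)\tilde C\,\mathrm{diag}(\hat h)^{-1}$, $\hat L:=C^\top LC$, and $P^{\mathrm{sp}}_{\mathcal I}(t):=Ce^{-\hat Lt}C^\top$. Killed quantities: for $\gamma>0$ let $L_\gamma:=L+\gamma\mathbf I$, $K_\gamma:=L_\gamma^{-1}$, $V_\gamma:=\mathrm{orth}((K_\gamma)_{:,\mathcal I})$ with $\mathrm{orth}(A):=A(A^\top A)^{-1/2}$,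 and $$P_{\mathcal I}(t):=\lim_{\gamma\to0^+}V_\gamma\exp(-V_\gamma^\top L_\gamma V_\gamma t)V_\gamma^\top,$$ $$\varepsilon_{\bullet}(\mathcal I):=\lim_{\gamma\to0^+}\big\|K_\gamma-(K_\gamma)_{:,\mathcal I}(K_\gamma)_{\mathcal I,\mathcal I}^{-1}(K_\gamma)_{\mathcal I,:}\big\|_{\bullet},\quad \bullet\in\{2,*\}.$$ Further let $\tilde C_\gamma:=\mathrm{diag}(h)^{-1}(K_\gamma)_{:,\mathcal I}(K_\gamma)_{\mathcal I,\mathcal I}^{-1}\mathrm{diag}(h_{\mathcal I})$, $\hat\pi_\gamma:=\tilde C_\gamma^\top\pi$, $\hat h_\gamma:=\hat\pi_\gamma^{1/2}$, $C_\gamma:=\mathrm{diag}(h)\tilde C_\gamma\,\mathrm{diag}(\hat h_\gamma)^{-1}$, $\hat L_\gamma:=C_\gamma^\top L_\gamma C_\gamma$, and $$\Psi_\gamma:=\hat L_\gamma^{-1/2}(\mathbf I-C_\gamma^\top C_\gamma)\hat L_\gamma^{-1/2},\qquad \psi_{\bullet}(\mathcal I):=\lim_{\gamma\to0^+}\|\Psi_\gamma\|_{\bullet},\quad \bullet\in\{2,*\}.$$ All these limits exist. *)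

(* Defs.v *)
From mathcomp Require Import all_boot all_order all_algebra.
From mathcomp Require Import all_classical all_reals all_analysis.

Set Implicit Arguments.
Unset Strict Implicit.
Unset Printing Implicit Defensive.

Import Order.TTheory GRing.Theory Num.Theory.
Import numFieldNormedType.Exports.

Local Open Scope classical_set_scope.
Local Open Scope ring_scope.

Definition expmx (R : realType) (n : nat) (A : 'M[R]_n) : 'M[R]_n :=
  limn (series (fun k => k`!%:R^-1 *: A ^+ k)).

Definition psdmx (R : realType) (n : nat) (A : 'M[R]_n) : Prop :=
  A^T = A /\ forall x : 'cV[R]_n, 0 <= (x^T *m A *m x) 0 0.

(* The principal square root: the unique positive semidefinite B with
   B^2 = A when A is positive semidefinite, and 0 otherwise. *)
Definition sqrtmx (R : realType) (n : nat) (A : 'M[R]_n) : 'M[R]_n :=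
  xget 0 [set B | psdmx B /\ B *m B = A].

(* A^{-1/2} *)
Definition isqrtmx (R : realType) (n : nat) (A : 'M[R]_n) : 'M[R]_n :=
  invmx (sqrtmx A).

Definition orthmx (R : realType) (m n : nat) (A : 'M[R]_(m, n)) :
    'M[R]_(m, n) :=
  A *m isqrtmx (A^T *m A).

Definition norm2 (R : realType) (n : nat) (x : 'cV[R]_n) : R :=
  Num.sqrt (\sum_i x i 0 ^+ 2).

Definition spectral_norm (R : realType) (m n : nat) (A : 'M[R]_(m, n)) : R :=
  sup [set norm2 (A *m x) | x in [set x : 'cV[R]_n | norm2 x <= 1]].

Definition nuclear_norm (R : realType) (m n : nat) (A : 'M[R]_(m, n)) : R :=
  \tr (sqrtmx (A^T *m A)).

(* The index "bullet" in {2, *}. *)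
Variant norm_index := Spectral | Nuclear.

Definition mxnorm (b : norm_index) (R : realType) (m n : nat)
    (A : 'M[R]_(m, n)) : R :=
  match b with
  | Spectral => spectral_norm A
  | Nuclear => nuclear_norm A
  end.

Definition diagc (R : realType) (n : nat) (v : 'cV[R]_n) : 'M[R]_n :=
  diag_mx v^T.

(* A_{:,I}, A_{I,:}, A_{I,I} and v_I; the elements of I are listed by
   enum_val, so that index k : 'I_#|I| stands for the state enum_val k. *)
Definition cols (R : realType) (m n : nat) (I : {set 'I_n})
    (A : 'M[R]_(m, n)) : 'M[R]_(m, #|I|) :=
  colsub (fun k : 'I_#|I| => enum_val k) A.

Definition rows (R : realType) (m n : nat) (I : {set 'I_m})
    (A : 'M[R]_(m, n)) : 'M[R]_(#|I|, n) :=
  rowsub (fun k : 'I_#|I| => enum_val k) A.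

Definition block (R : realType) (n : nat) (I : {set 'I_n})
    (A : 'M[R]_n) : 'M[R]_#|I| :=
  rows I (cols I A).

(* Q is the rate matrix of an irreducible reversible continuous-time Markov
   chain with stationary distribution p. *)
Record reversible_rate_matrix (R : realType) (n : nat)
    (Q : 'M[R]_n) (p : 'cV[R]_n) : Prop := ReversibleRateMatrix {
  rate_ge0 : forall i j, i != j -> 0 <= Q i j ;
  rate_row_sum : Q *m const_mx 1 = 0 :> 'cV[R]_n ;
  rate_irreducible : forall i j, connect [rel x y | 0 < Q x y] i j ;
  stat_gt0 : forall i, 0 < p i 0 ;
  stat_sum : \sum_i p i 0 = 1 ;
  stat_invariant : Q^T *m p = 0 ;
  stat_reversible : diagc p *m Q = Q^T *m diagc p
}.

(* X is a continuous-time Markov chain on 'I_n with rate matrix Q and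
   right-continuous (step function) paths; Pr i is the conditional
   probability given X_0 = i. Only times t >= 0 matter. The last field is the
   Markov property with transition matrices exp(s Q), s >= 0. *)
Record is_ctmc (R : realType) (n : nat) (Q : 'M[R]_n)
    (d : measure_display) (T : measurableType d)
    (Pr : 'I_n -> probability T R) (X : R -> T -> 'I_n) : Prop := IsCTMC {
  ctmc_measurable : forall t i, 0 <= t -> measurable (X t @^-1` [set i]) ;
  ctmc_right_continuous : forall w t, 0 <= t ->
    \forall s \near t^'+, X s w = X t w ;
  ctmc_initial : forall i, Pr i (X 0 @^-1` [set i]) = 1%E ;
  ctmc_markov : forall (i : 'I_n) (k : nat) (t : nat -> R) (x : nat -> 'I_n),
    0 <= t 0%N -> (forall l, t l <= t l.+1) ->
    Pr i [set w | forall l, (l <= k.+1)%N -> X (t l) w = x l] =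
    (Pr i [set w | forall l, (l <= k)%N -> X (t l) w = x l] *
     (expmx ((t k.+1 - t k) *: Q) (x k) (x k.+1))%:E)%E
}.

(* t = min {s >= 0 | X_s w \in I} *)
Definition is_hitting_time (R : realType) (n : nat) (T : Type)
    (X : R -> T -> 'I_n) (I : {set 'I_n}) (w : T) (t : R) : Prop :=
  [/\ 0 <= t, X t w \in I & forall s, 0 <= s -> s < t -> X s w \notin I].

Definition committor (R : realType) (n : nat)
    (d : measure_display) (T : measurableType d)
    (Pr : 'I_n -> probability T R) (X : R -> T -> 'I_n) (I : {set 'I_n}) :
    'M[R]_(n, #|I|) :=
  \matrix_(i < n, k < #|I|)
    fine (Pr i [set w | exists2 t, is_hitting_time X I w t
                                 & X t w = enum_val k]).

Definition sqrtv (R : realType) (n : nat) (p : 'cV[R]_n) : 'cV[R]_n :=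
  map_mx Num.sqrt p.

Definition laplacian (R : realType) (n : nat) (Q : 'M[R]_n) (p : 'cV[R]_n) :
    'M[R]_n :=
  - (diagc (sqrtv p) *m Q *m invmx (diagc (sqrtv p))).

(* diag(h) Ct diag(hhat)^{-1}, with hhat = (Ct^T p)^{1/2}: the common shape of
   C (for Ct the committor) and C_gamma (for Ct = C~_gamma). *)
Definition symmetrize (R : realType) (n m : nat) (p : 'cV[R]_n)
    (Ct : 'M[R]_(n, m)) : 'M[R]_(n, m) :=
  diagc (sqrtv p) *m Ct *m invmx (diagc (sqrtv (Ct^T *m p))).

(* P^sp_I(t) in terms of L and C *)
Definition sp_compression (R : realType) (n m : nat) (L : 'M[R]_n)
    (C : 'M[R]_(n, m)) (t : R) : 'M[R]_n :=
  C *m expmx (- (t *: (C^T *m L *m C))) *m C^T.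

(* L_gamma and K_gamma *)
Definition killed (R : realType) (n : nat) (L : 'M[R]_n) (g : R) : 'M[R]_n :=
  L + g%:M.

Definition killed_inv (R : realType) (n : nat) (L : 'M[R]_n) (g : R) :
    'M[R]_n :=
  invmx (killed L g).

Definition proj_compression_at (R : realType) (n : nat) (L : 'M[R]_n)
    (I : {set 'I_n}) (t g : R) : 'M[R]_n :=
  let V := orthmx (cols I (killed_inv L g)) in
  V *m expmx (- (t *: (V^T *m killed L g *m V))) *m V^T.

(* P_I(t) *)
Definition proj_compression (R : realType) (n : nat) (L : 'M[R]_n)
    (I : {set 'I_n}) (t : R) : 'M[R]_n :=
  lim (proj_compression_at L I t g @[g --> 0^'+]).

Definition nystrom_residual (R : realType) (n : nat) (I : {set 'I_n})
    (K : 'M[R]_n) : 'M[R]_n :=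
  K - cols I K *m invmx (block I K) *m rows I K.

(* epsilon_b(I) *)
Definition nystrom_error (b : norm_index) (R : realType) (n : nat)
    (L : 'M[R]_n) (I : {set 'I_n}) : R :=
  lim (mxnorm b (nystrom_residual I (killed_inv L g)) @[g --> 0^'+]).

(* C~_gamma *)
Definition killed_committor (R : realType) (n : nat) (L : 'M[R]_n)
    (p : 'cV[R]_n) (I : {set 'I_n}) (g : R) : 'M[R]_(n, #|I|) :=
  let K := killed_inv L g in
  invmx (diagc (sqrtv p)) *m (cols I K *m invmx (block I K))
    *m diagc (rows I (sqrtv p)).

(* Psi_gamma *)
Definition obliqueness_at (R : realType) (n : nat) (L : 'M[R]_n)
    (p : 'cV[R]_n) (I : {set 'I_n}) (g : R) : 'M[R]_#|I| :=
  let C := symmetrize p (killed_committor L p I g) in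
  let S := isqrtmx (C^T *m killed L g *m C) in
  S *m (1%:M - C^T *m C) *m S.

(* psi_b(I) *)
Definition obliqueness_norm (b : norm_index) (R : realType) (n : nat)
    (L : 'M[R]_n) (p : 'cV[R]_n) (I : {set 'I_n}) : R :=
  lim (mxnorm b (obliqueness_at L p I g) @[g --> 0^'+]).

(* Main.v *)
Require Import Defs.
From mathcomp Require Import all_boot all_order all_algebra.
From mathcomp Require Import all_classical all_reals all_analysis.
From mathcomp Require Import ring lra.

Set Implicit Arguments.
Unset Strict Implicit.
Unset Printing Implicit Defensive.

Import Order.TTheory GRing.Theory Num.Theory.
Import numFieldNormedType.Exports.

Local Open Scope classical_set_scope.
Local Open Scope ring_scope.

(* For a matrix W in the unit ball of the dual norm, tr (W^T (f(A) Z - Z f(B)))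
   is, in eigenbases of A and B, a sum of W_ij Z_ij (f(x_i) - f(y_j)), while the
   matrix whose norm is the right-hand side has entries Z_ij (x_i - y_j) there.
   So both bounds say that the divided differences of f act as Schur
   multipliers: with x, y the inverse eigenvalues and f(x) = e^(-t / x) for the
   projective error, and, after the substitution phi = 1 / (1 + t lambda), with
   f(phi) = (1 / phi - 1) e^(1 - 1 / phi) for the obliqueness. The mean value theorem
   reduces this to the kernels h(s x_i + (1 - s) y_j) with h = f'. Such a kernel
   factors as an integral of p(s x_i + w) q((1 - s) y_j - w) with q(v) = e^(-a v)
   on v > 0 and p = h' + a h, and AM-GM gives an explicit constant depending on
   the supremum of the primitive of p^2. The constants 35/48 and 47/80 so obtained are
   below 3 sqrt 3 / (2 pi) and 2 / pi.

   At fixed gamma > 0 the two bounds hold for the killed matrices; every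
   ingredient is continuous at gamma = 0 once (K_gamma)_{:,I} (K_gamma)_{I,I}^-1
   is written as the solution of a Dirichlet problem off I, which remains
   uniquely solvable at gamma = 0. The committor solves the same problem: for the
   chain sampled at the multiples of 1 / (m + 1) this is the first-step equation,
   and right-continuity of the paths lets m tend to infinity. *)

(** * Scalar kernels *)

(** The operators compared have different eigenbases, so a functional calculus alone does not
    suffice and entrywise multipliers are needed. In the projective case the residual is already a
    difference of inverses L^-1 - K'. In the oblique case the entries of Psi are lambda_i^(-1/2) (1
    / lambda_i - 1 / mu_j) Y_ij mu_j^(1/2). The substitution phi = 1 / (1 + t lambda) is made so
    that the rank one factor sqrt(t lambda_i) / (1 + t lambda_i) * sqrt(t mu_j) / (1 + t mu_j) turns
    them into (phi(lambda_i) - phi(mu_j)) Y_ij / lambda_i. By AM-GM this factor contributes 1/4, so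
    the kernel constant 47/20 becomes 47/80. The substitution also confines the points to [0, 1],
    where the primitive of p^2 is smaller.

    The obstacle in the limit is that L is singular: K_gamma, and the inverse square root inside
    Psi_gamma, blow up along the stationary direction. Convergence has to come from cancellations,
    not from the separate factors. *)

Lemma derD (R : realType) (f g : R -> R) (x a b : R) :
  is_derive x 1 f a -> is_derive x 1 g b ->
  is_derive x 1 (fun v => f v + g v) (a + b).
Proof. by move=> ? ?; exact: is_deriveD. Qed.

Lemma derB (R : realType) (f g : R -> R) (x a b : R) :
  is_derive x 1 f a -> is_derive x 1 g b ->
  is_derive x 1 (fun v => f v - g v) (a - b).
Proof. by move=> ? ?; exact: is_deriveB. Qed.

Lemma derZ (R : realType) (k : R) (f : R -> R) (x a : R) :
  is_derive x 1 f a -> is_derive x 1 (fun v => k * f v) (k * a).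
Proof. by move=> ?; exact: is_deriveZ. Qed.

Lemma derM (R : realType) (f g : R -> R) (x a b : R) :
  is_derive x 1 f a -> is_derive x 1 g b ->
  is_derive x 1 (fun v => f v * g v) (f x * b + g x * a).
Proof. by move=> ? ?; exact: is_deriveM. Qed.

Lemma der_comp (R : realType) (f g : R -> R) (x a b : R) :
  is_derive (g x) 1 f a -> is_derive x 1 g b ->
  is_derive x 1 (fun v => f (g v)) (a * b).
Proof. by move=> ? ?; exact: is_derive1_comp. Qed.

Lemma der_eq (R : realType) (f : R -> R) (x a b : R) :
  is_derive x 1 f a -> a = b -> is_derive x 1 f b.
Proof. by move=> ? <-. Qed.

Lemma der_sum (R : realType) n (f : 'I_n -> R -> R) (x : R)
    (a : 'I_n -> R) :
  (forall i, is_derive x 1 (f i) (a i)) ->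
  is_derive x 1 (fun v => \sum_i f i v) (\sum_i a i).
Proof.
move=> fa; have -> : (fun v => \sum_i f i v) = \sum_i f i.
  by apply/funext => v; rewrite fct_sumE.
exact: is_derive_sum.
Qed.

Lemma der_affine (R : realType) (k c x : R) :
  is_derive x 1 (fun v : R => c + k * v) k.
Proof.
have d : is_derive x 1 (fun v : R => c + k * v) (0 + k * 1) by exact: derD.
by apply: (der_eq d); rewrite add0r mulr1.
Qed.

Lemma der_exp_affine (R : realType) (k c x : R) :
  is_derive x 1 (fun v : R => expR (c + k * v)) (k * expR (c + k * x)).
Proof.
apply: (@der_eq _ _ _ (expR (c + k * x) * k)); last by rewrite mulrC.
exact: (@der_comp _ expR (fun v => c + k * v) _ _ _ (is_derive_expR _)
  (der_affine _ _ _)).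
Qed.

Lemma der_continuous (R : realType) (f df : R -> R) :
  (forall x : R, is_derive x 1 f (df x)) -> continuous f.
Proof.
move=> fd x; apply: differentiable_continuous.
by apply/derivable1_diffP; have [] := fd x.
Qed.

Lemma mean_value (R : realType) (f df : R -> R) (a b : R) :
  a <= b -> (forall x : R, is_derive x 1 f (df x)) ->
  exists2 c, a <= c <= b & f b - f a = df c * (b - a).
Proof.
move=> ab fd; have [|c cab E] := @MVT_segment R f df a b ab (fun x _ => fd x).
  by apply: continuous_subspaceT; exact: der_continuous fd.
by exists c => //; move: cab; rewrite in_itv.
Qed.

Lemma nondecreasing_of_der (R : realType) (f df : R -> R) (a b : R) :
  a <= b -> (forall x : R, is_derive x 1 f (df x)) ->
  (forall x, a <= x <= b -> 0 <= df x) -> f a <= f b.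
Proof.
move=> ab fd df0; have [c cab E] := mean_value ab fd.
by rewrite -subr_ge0 E mulr_ge0 ?subr_ge0 ?df0.
Qed.

(* The open interval suffices: this is what allows one-sided formulas at kinks. *)
Lemma nondecreasing_of_der_oo (R : realType) (f df : R -> R) (a b : R) :
  a <= b -> (forall x : R, is_derive x 1 f (df x)) ->
  (forall x, a < x < b -> 0 <= df x) -> f a <= f b.
Proof.
rewrite le_eqVlt => /orP[/eqP -> //|ab] fd df0.
have [|c cab E] := @MVT R f df a b ab (fun x _ => fd x).
  by apply: continuous_subspaceT; exact: der_continuous fd.
rewrite -subr_ge0 E mulr_ge0 ?subr_ge0 ?(ltW ab)// df0//.
Qed.

(** Serves at the junction point of functions glued to zero: the quadratic bound forces both the
    value at [x] and the difference quotients there to vanish. *)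
Lemma der_flat (R : realType) (f : R -> R) (x C : R) :
  (forall y, `|f y| <= C * (y - x) ^+ 2) -> is_derive x 1 f 0.
Proof.
move=> fC.
have fx0 : f x = 0.
  by apply/eqP; rewrite -normr_le0 (le_trans (fC x))// subrr expr0n /= mulr0.
have C0 : 0 <= C.
  have := fC (x + 1); rewrite addrC addrK expr1n mulr1.
  exact: le_trans.
have cv : h^-1 *: ((f \o shift x) (h *: (1:R)) - f x) @[h --> (0:R)^'] --> (0:R).
  apply/cvgr0Pnorm_le => e e0; near=> h.
  have h0 : h != 0 by near: h; apply: nbhs_dnbhs_neq.
  rewrite /= fx0 subr0 normrZ normfV scaler1.
  rewrite ler_pdivrMl ?normr_gt0//.
  apply: (le_trans (fC _)); rewrite addrK -normr_id -[X in X <= _]ger0_norm; last first.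
    by rewrite mulr_ge0 ?sqr_ge0.
  rewrite normrM normrX (ger0_norm C0) mulrC expr2 -mulrA normr_id.
  rewrite ler_wpM2l//.
  have hC : `|h| < e / (C + 1).
    near: h; apply: dnbhs0_lt; rewrite divr_gt0// ltr_wpDl//.
  move: hC; rewrite ltr_pdivlMr ?ltr_wpDl// => /ltW; apply: le_trans.
  by rewrite ler_wpM2l// lerDl.
apply: DeriveDef; first by apply/cvg_ex; exists 0.
by apply: cvg_lim => //.
Unshelve. all: by end_near.
Qed.

(* x^-k e^(-tau / x), extended smoothly by zero to x <= 0 *)
Definition hexp (R : realType) (tau : R) (k : nat) (x : R) : R :=
  if 0 < x then x^-1 ^+ k * expR (- tau * x^-1) else 0.

Lemma hexp_le0 (R : realType) (tau : R) (k : nat) (x : R) :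
  x <= 0 -> hexp tau k x = 0.
Proof. by rewrite /hexp leNgt => /negPf ->. Qed.

Lemma hexpE (R : realType) (tau : R) (k : nat) (x : R) :
  0 < x -> hexp tau k x = x^-1 ^+ k * expR (- tau * x^-1).
Proof. by rewrite /hexp => ->. Qed.

(** The Taylor term of order k + 2 of the exponential gives e^(-tau / x) <= (k + 2)! (x / tau)^(k +
    2), and two powers of x survive the division by x^k. *)
Lemma hexp_bound (R : realType) (tau : R) (k : nat) : 0 < tau ->
  exists C, forall x, `|hexp tau k x| <= C * (x - 0) ^+ 2.
Proof.
move=> t0; exists ((k.+2)`!%:R * tau^-1 ^+ k.+2) => x; rewrite subr0.
have C0 : 0 <= (k.+2)`!%:R * tau^-1 ^+ k.+2 :> R.
  by rewrite mulr_ge0 ?exprn_ge0 ?invr_ge0 ?ltW.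
have [x0|x0] := ltP 0 x; last first.
  by rewrite hexp_le0// normr0 mulr_ge0 ?sqr_ge0.
rewrite hexpE// ger0_norm; last first.
  by rewrite mulr_ge0 ?expR_ge0 ?exprn_ge0 ?invr_ge0 ?ltW.
have u0 : 0 < x^-1 by rewrite invr_gt0.
rewrite mulNr expRN ler_pdivrMr ?expR_gt0//.
have := @expR_ge1Dxn _ (tau * x^-1) k.+1 (ltW (mulr_gt0 t0 u0)).
move=> /(le_trans _) le.
have : (tau * x^-1) ^+ k.+2 / (k.+2)`!%:R <= expR (tau * x^-1).
  by apply: le; rewrite lerDr.
rewrite ler_pdivrMr ?ltr0n ?fact_gt0// => H.
have -> : x^-1 ^+ k = tau^-1 ^+ k.+2 * x ^+ 2 * (tau * x^-1) ^+ k.+2.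
  rewrite exprMn mulrACA -exprMn mulVf ?gt_eqF// expr1n mul1r.
  have -> : x^-1 ^+ k.+2 = x^-1 ^+ 2 * x^-1 ^+ k by rewrite -exprD add2n.
  by rewrite mulrA -exprMn mulfV ?gt_eqF// expr1n mul1r.
have -> : (k.+2)`!%:R * tau^-1 ^+ k.+2 * x ^+ 2 * expR (tau * x^-1) =
  (tau^-1 ^+ k.+2 * x ^+ 2) * (expR (tau * x^-1) * (k.+2)`!%:R) by ring.
by rewrite ler_wpM2l// mulr_ge0 ?sqr_ge0 ?exprn_ge0 ?invr_ge0 ?ltW.
Qed.

Lemma der_near_eq (R : realType) (f g : R -> R) (x a : R) :
  (\near x, f x = g x) -> is_derive x 1 f a -> is_derive x 1 g a.
Proof. exact: near_eq_is_derive. Qed.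

(** Differentiation stays inside the family, so each derivative of a kernel or primitive below
    becomes a polynomial identity in 1 / x times an exponential. *)
Lemma der_hexp (R : realType) (tau : R) (k : nat) (x : R) : 0 < tau ->
  is_derive x 1 (hexp tau k) (tau * hexp tau k.+2 x - k%:R * hexp tau k.+1 x).
Proof.
move=> t0; have [x0|x0|->] := ltgtP x 0.
- rewrite !hexp_le0 ?ltW// !mulr0 subrr.
  apply: (@der_near_eq _ (cst 0)).
  near=> y; rewrite hexp_le0//.
  by apply/ltW; near: y; exact: lt_nbhsl.
- have xn0 : x != 0 by rewrite gt_eqF.
  have dV : is_derive x 1 (fun y : R => y^-1) (- x^-1 ^+ 2).
    apply: (@der_eq _ _ _ (- x ^- 2 *: 1)); last by rewrite scaler1 exprVn.
    exact: (@is_deriveV _ id).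
  have d1 : is_derive x 1 (fun y : R => expR (- tau * y^-1))
      (expR (- tau * x^-1) * (- tau * - x^-1 ^+ 2)).
    exact: (@der_comp _ expR _ _ _ _ (is_derive_expR _) (derZ _ dV)).
  have d2 : is_derive x 1 (fun y : R => y^-1 ^+ k) (- k%:R * x^-1 ^+ k.+1).
    have E : (fun y : R => y^-1 ^+ k) = (fun y : R => y^-1) ^+ k.
      by apply/funext => y; rewrite exprfctE.
    rewrite E; apply: (der_eq (@is_deriveX _ _ (fun y : R => y^-1) k x 1 _ dV)).
    case: k {E} => [|k]; first by rewrite mul0r scale0r oppr0 mul0r.
    by rewrite /GRing.scale /= !exprS; ring.
  apply: (@der_near_eq _ (fun y => y^-1 ^+ k * expR (- tau * y^-1))).
    near=> y; rewrite hexpE//.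
    by near: y; exact: lt_nbhsr.
  apply: (der_eq (derM d2 d1)); rewrite !hexpE// !exprS; ring.
rewrite !hexp_le0// !mulr0 subrr.
have [C HC] := @hexp_bound _ tau k t0.
exact: der_flat HC.
Unshelve. all: by end_near.
Qed.

(* A certificate, stable under Schur multiplication by rank one kernels, from
   which bounds on sums of M_ij against positive definite kernels follow. *)
Definition dominated (R : realType) m n (M : 'I_m -> 'I_n -> R) (c : R) :
    Prop :=
  exists r : 'I_m -> R, exists s : 'I_n -> R,
  [/\ forall i, 0 <= r i, forall j, 0 <= s j,
      \sum_i r i <= c, \sum_j s j <= c &
      forall (u : 'I_m -> R) (v : 'I_n -> R),
        \sum_i \sum_j M i j * u i * v j <=
        (\sum_i r i * u i ^+ 2 + \sum_j s j * v j ^+ 2) / 2].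

(** [Phi v] is the excess, integrated up to [v], of the weighted squares over the bilinear form,
    with each exponential cut off at its node [y j] by [Num.min]. On an interval with no node
    inside, every minimum resolves and [Phi] is differentiable; the certificate, applied to [th * p]
    and the active exponentials and divided by [th], says that the derivative is nonnegative. *)
Lemma dominated_convolution_step (R : realType) m n
    (M : 'I_m -> 'I_n -> R) (r : 'I_m -> R) (s : 'I_n -> R)
    (x : 'I_m -> R) (y : 'I_n -> R) (h h1 P : R -> R) (a th w w' : R) :
  0 < a -> 0 < th ->
  (forall v : R, is_derive v 1 h (h1 v)) ->
  (forall v : R, is_derive v 1 P ((h1 v + a * h v) ^+ 2)) ->
  (forall (u : 'I_m -> R) (v : 'I_n -> R),
    \sum_i \sum_j M i j * u i * v j <=
    (\sum_i r i * u i ^+ 2 + \sum_j s j * v j ^+ 2) / 2) ->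
  w <= w' -> (forall j, y j <= w \/ w' <= y j) ->
  forall Phi : R -> R, (forall v, Phi v = th / 2 * (\sum_i r i * P (x i + v))
     + th^-1 / 2 * (\sum_j s j * (expR (a * (Num.min v (y j) - y j)) ^+ 2 / (2 * a)))
     - \sum_i \sum_j M i j * (expR (a * (Num.min v (y j) - y j))
                              * h (x i + Num.min v (y j)))) ->
  Phi w <= Phi w'.
Proof.
move=> a0 th0 hd Pd dom ww' yw Phi PhiE.
(* Nodes from [w'] on are still ahead and contribute functions of [v]; the others have been passed
   and contribute constants. *)
pose act j := w' <= y j.
pose e j v := expR (- (a * y j) + a * v).
have eE j v : expR (a * (v - y j)) = e j v by rewrite /e mulrBr addrC.
have ed j (v : R) : is_derive v 1 (e j) (a * e j v) by exact: der_exp_affine.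
pose F v := th / 2 * (\sum_i r i * P (x i + v))
     + th^-1 / 2 * (\sum_j s j * (if act j then e j v * e j v / (2 * a)
                                 else (1 / (2 * a))))
     - \sum_i \sum_j M i j * (if act j then e j v * h (x i + v)
                              else h (x i + y j)).
have FE v : w <= v <= w' -> Phi v = F v.
  move=> /andP[wv vw']; rewrite PhiE /F; congr (_ + _ * _ - _).
    apply: eq_bigr => j _; rewrite eE /act; case: ifPn => [h0|].
      by rewrite min_l ?(le_trans vw')// expr2.
    rewrite -ltNge => /[dup] ylt _; have [ywj|] := yw j; last by rewrite leNgt ylt.
    by rewrite min_r ?(le_trans ywj)// /e addrC subrr expR0 expr1n.
  apply: eq_bigr => i _; apply: eq_bigr => j _; rewrite eE /act; case: ifPn => [h0|].
    by rewrite min_l ?(le_trans vw').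
  rewrite -ltNge => /[dup] ylt _; have [ywj|] := yw j; last by rewrite leNgt ylt.
  by rewrite min_r ?(le_trans ywj)// /e addrC subrr expR0 mul1r.
rewrite !FE ?lexx ?andbT//.
pose p v := h1 v + a * h v.
pose b j v := if act j then e j v else 0.
have shiftd (f : R -> R) (df c v : R) : is_derive (c + v) 1 f df ->
    is_derive v 1 (fun z => f (c + z)) df.
  move=> fd; have d1 : is_derive v 1 (fun z : R => c + 1 * z) 1 by exact: der_affine.
  have E : (fun z => f (c + z)) = (fun z => f (c + 1 * z)).
    by apply/funext => z; rewrite mul1r.
  rewrite E -[df]mulr1; apply: (@der_comp _ f (fun z => c + 1 * z) v df 1) => //.
  by rewrite mul1r.
apply: (@nondecreasing_of_der_oo _ F (fun v =>
   th / 2 * (\sum_i r i * p (x i + v) ^+ 2)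
     + th^-1 / 2 * (\sum_j s j * b j v ^+ 2)
     - \sum_i \sum_j M i j * (p (x i + v) * b j v))) => //.
  move=> v; apply: derB; first apply: derD.
  - apply: derZ; apply: der_sum => i; apply: derZ.
  - apply: derZ; apply: der_sum => j; apply: derZ.
    rewrite /b; case: (act j); last by rewrite expr0n /=; exact: is_derive_cst.
    have -> : (fun z => e j z * e j z / (2 * a)) =
              (fun z => (2 * a)^-1 * (e j z * e j z)).
      by apply/funext => z; rewrite mulrC.
    apply: (der_eq (derZ _ (derM (ed j v) (ed j v)))).
    by field; rewrite gt_eqF.
  - apply: der_sum => i; apply: der_sum => j; apply: derZ.
    rewrite /b; case: (act j); last by rewrite mulr0; exact: is_derive_cst.
    apply: (der_eq (derM (ed j v) (shiftd h _ _ _ (hd _)))).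
    by rewrite /p; ring.
move=> v _; rewrite subr_ge0.
have := dom (fun i => th * p (x i + v)) (b ^~ v).
have -> : \sum_i \sum_j M i j * (th * p (x i + v)) * b j v =
   th * \sum_i \sum_j M i j * (p (x i + v) * b j v).
  rewrite mulr_sumr; apply: eq_bigr => i _; rewrite mulr_sumr.
  by apply: eq_bigr => j _; ring.
have -> : \sum_i r i * (th * p (x i + v)) ^+ 2 =
   th ^+ 2 * \sum_i r i * p (x i + v) ^+ 2.
  by rewrite mulr_sumr; apply: eq_bigr => i _; ring.
set A := \sum_i r i * _; set B := \sum_j s j * _; set C := \sum_i \sum_j _.
move=> H; rewrite -(ler_pM2l th0).
by apply: (le_trans H); rewrite le_eqVlt; apply/orP; left; apply/eqP; field; rewrite gt_eqF.
Qed.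

(* Writing h = p * q with p = h' + a h and q = exp(-a .) on [0, oo[, the kernel
   h(x + y) is the inner product of p(x + .) and q(y - .); the integral is
   replaced by the monotonicity of its primitive. *)
Lemma dominated_convolution (R : realType) m n
    (M : 'I_m -> 'I_n -> R) (c : R)
    (x : 'I_m -> R) (y : 'I_n -> R) (h h1 P : R -> R) (a th B X Y : R) :
  0 < a -> 0 < th -> dominated M c ->
  (forall v : R, is_derive v 1 h (h1 v)) ->
  (forall v : R, is_derive v 1 P ((h1 v + a * h v) ^+ 2)) ->
  (forall v : R, v <= 0 -> h v = 0) -> (forall v : R, v <= 0 -> P v = 0) ->
  0 <= B -> (forall v : R, v <= X + Y -> P v <= B) ->
  (forall i, 0 <= x i <= X) -> (forall j, 0 <= y j <= Y) -> 0 <= Y -> 0 <= X ->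
  \sum_i \sum_j M i j * h (x i + y j) <= (th * B + th^-1 / (2 * a)) / 2 * c.
Proof.
move=> a0 th0 [r [s [r0 s0 rc sc dom]]] hd Pd h0 P0 B0 PB xX yY Y0 X0.
have [Phi PhiE] : exists Phi : R -> R, forall v, Phi v =
     th / 2 * (\sum_i r i * P (x i + v))
     + th^-1 / 2 * (\sum_j s j * (expR (a * (Num.min v (y j) - y j)) ^+ 2 / (2 * a)))
     - \sum_i \sum_j M i j * (expR (a * (Num.min v (y j) - y j))
                              * h (x i + Num.min v (y j))) by eexists => v; reflexivity.
(* Induction on the number of nodes strictly inside the interval: splitting at one of them removes
   it from both halves. *)
have mono (k : nat) : forall w w' : R, w <= w' -> (#|[pred j | (w < y j < w')%R]| <= k)%N ->
    Phi w <= Phi w'.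
  elim: k => [|k IH] w w' ww' cnt.
    apply: (dominated_convolution_step a0 th0 hd Pd dom ww' _ PhiE) => j.
    move: cnt; rewrite leqn0 => /eqP/card0_eq /(_ j); rewrite inE => /negbT.
    by rewrite negb_and -!leNgt => /orP[]; [left|right].
  have [/existsP[j jin]|/existsPn nj] := boolP [exists j, w < y j < w']; last first.
    apply: IH => //; rewrite (@eq_card0 _ [pred j | w < y j < w'])//.
    by move=> j; rewrite inE; exact/negbTE.
  have /andP[wj jw'] := jin.
  have subI z z' : w <= z -> z' <= w' -> ~~ (z < y j < z') ->
      (#|[pred l | (z < y l < z')%R]| <= k)%N.
    move=> wz z'w' jout; rewrite -ltnS; apply: leq_trans cnt.
    apply: proper_card; apply/properP; split.
      apply/fintype.subsetP => l; rewrite !inE => /andP[zl lz'].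
      by rewrite (le_lt_trans wz zl) (lt_le_trans lz' z'w').
    by exists j; rewrite !inE// (negbTE jout).
  apply: (@le_trans _ _ (Phi (y j))); apply: IH; rewrite ?(ltW wj) ?(ltW jw')//.
    by apply: subI; rewrite ?lexx ?(ltW jw')// ltxx andbF.
  by apply: subI; rewrite ?lexx ?(ltW wj)// ltxx.
(* At [- X] all arguments of [h] and [P] are nonpositive, so only the squares of the exponentials
   remain. At [Y] every node has been passed, and the bilinear part is the full kernel sum. *)
have Th_init : 0 <= Phi (- X).
  rewrite PhiE (_ : \sum_i r i * _ = 0) ?mulr0 ?add0r; last first.
    rewrite big1// => i _; rewrite P0 ?mulr0//.
    by rewrite subr_le0; case/andP: (xX i).
  rewrite [X in _ - X]big1 ?subr0; last first.
    move=> i _; rewrite big1// => j _.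
    rewrite h0 ?mulr0//; have /andP[_ xi] := xX i; have /andP[yj _] := yY j.
    have : Num.min (- X) (y j) <= - X by rewrite ge_min lexx.
    by lra.
  apply: mulr_ge0; first by rewrite divr_ge0 ?invr_ge0 ?ltW.
  apply: sumr_ge0 => j _.
  by rewrite mulr_ge0// divr_ge0 ?sqr_ge0// mulr_ge0// ltW.
have Th0 : 0 <= Phi Y.
  apply: (le_trans Th_init); apply: (mono n).
    by rewrite (le_trans _ Y0)// oppr_le0.
  by rewrite -[X in (_ <= X)%N](card_ord n) max_card.
move: Th0; rewrite PhiE.
rewrite (_ : \sum_j s j * _ = (\sum_j s j) / (2 * a)); last first.
  rewrite mulr_suml; apply: eq_bigr => j _.
  have /andP[_ yj] := yY j.
  by rewrite min_r// subrr mulr0 expR0 expr1n mul1r.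
rewrite (_ : \sum_i \sum_j _ = \sum_i \sum_j M i j * h (x i + y j)); last first.
  apply: eq_bigr => i _; apply: eq_bigr => j _; have /andP[_ yj] := yY j.
  by rewrite min_r// subrr mulr0 expR0 mul1r.
rewrite subr_ge0 => /le_trans; apply.
have H1 : \sum_i r i * P (x i + Y) <= B * c.
  apply: (@le_trans _ _ (\sum_i r i * B)).
    apply: ler_sum => i _; apply: ler_wpM2l => //; apply: PB.
    by rewrite lerD2r; case/andP: (xX i).
  by rewrite -mulr_suml mulrC ler_wpM2l.
have H2 : (\sum_j s j) / (2 * a) <= c / (2 * a).
  by rewrite ler_wpM2r// invr_ge0 mulr_ge0// ltW.
have -> : (th * B + th^-1 / (2 * a)) / 2 * c =
   th / 2 * (B * c) + th^-1 / 2 * (c / (2 * a)) by ring.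
by apply: lerD; apply: ler_wpM2l => //; rewrite divr_ge0 ?invr_ge0 ?ltW.
Qed.

(** The mean value theorem is applied to the whole double sum as a function of [s], not entry by
    entry: one [s] then serves all pairs, and the argument of [h] is a function of [i] plus a
    function of [j], as the convolution bound requires. *)
Lemma dominated_lipschitz (R : realType) m n
    (N : 'I_m -> 'I_n -> R) (c : R)
    (x : 'I_m -> R) (y : 'I_n -> R) (G h h1 P : R -> R) (a th B X : R) :
  0 < a -> 0 < th -> dominated (fun i j => N i j * (x i - y j)) c ->
  (forall v : R, is_derive v 1 G (h v)) ->
  (forall v : R, is_derive v 1 h (h1 v)) ->
  (forall v : R, is_derive v 1 P ((h1 v + a * h v) ^+ 2)) ->
  (forall v : R, v <= 0 -> h v = 0) -> (forall v : R, v <= 0 -> P v = 0) ->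
  0 <= B -> (forall v : R, v <= X -> P v <= B) ->
  (forall i, 0 <= x i <= X) -> (forall j, 0 <= y j <= X) -> 0 <= X ->
  \sum_i \sum_j N i j * (G (x i) - G (y j)) <=
    (th * B + th^-1 / (2 * a)) / 2 * c.
Proof.
move=> a0 th0 dom Gd hd Pd h0 P0 B0 PB xX yX X0.
pose F s := \sum_i \sum_j N i j * G (y j + (x i - y j) * s).
have Fd (s : R) : is_derive s 1 F
    (\sum_i \sum_j N i j * (h (y j + (x i - y j) * s) * (x i - y j))).
  apply: der_sum => i; apply: der_sum => j; apply: derZ.
  exact: (@der_comp _ G (fun s => y j + (x i - y j) * s) _ _ _ (Gd _)
    (der_affine _ _ _)).
have [s /andP[s0 s1]] := mean_value (@ler01 R) Fd.
rewrite subr0 mulr1 => E.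
have -> : \sum_i \sum_j N i j * (G (x i) - G (y j)) = F 1 - F 0.
  rewrite /F -sumrB; apply: eq_bigr => i _; rewrite -sumrB.
  apply: eq_bigr => j _; rewrite mulr1 mulr0 addr0 -mulrBr.
  by congr (_ * (G _ - _)); ring.
rewrite E.
rewrite (_ : \sum_i \sum_j _ = \sum_i \sum_j
   (N i j * (x i - y j)) * h (s * x i + (1 - s) * y j)); last first.
  apply: eq_bigr => i _; apply: eq_bigr => j _.
  rewrite (_ : y j + (x i - y j) * s = s * x i + (1 - s) * y j); last by ring.
  by ring.
have s10 : 0 <= 1 - s by rewrite subr_ge0.
apply: (@dominated_convolution _ _ _ _ _ (fun i => s * x i)
   (fun j => (1 - s) * y j) _ h1 P _ _ _ (s * X) ((1 - s) * X)) => //.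
- by move=> v vX; apply: PB; rewrite (le_trans vX)// -mulrDl addrC subrK mul1r.
- by move=> i; have /andP[x0 xi] := xX i; rewrite mulr_ge0//= ler_wpM2l.
- by move=> i; have /andP[x0 xi] := yX i; rewrite mulr_ge0//= ler_wpM2l.
- by rewrite mulr_ge0.
- by rewrite mulr_ge0.
Qed.

Lemma dominated_exp_inv (R : realType) m n
    (N : 'I_m -> 'I_n -> R) (c : R) (x : 'I_m -> R) (y : 'I_n -> R) :
  dominated (fun i j => N i j * (x i - y j)) c ->
  (forall i, 0 <= x i) -> (forall j, 0 <= y j) ->
  \sum_i \sum_j N i j * (hexp 1 0 (x i) - hexp 1 0 (y j)) <= 35 / 48 * c.
Proof.
move=> dom x0 y0.
pose h : R -> R := hexp 1 2.
pose h1 : R -> R := fun v => hexp 1 4 v - 2 * hexp 1 3 v.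
(* P is the primitive of (h' + a h)^2 with a = 2; th = 1/3 below. *)
pose D (u : R) : R := u ^+ 6 / 2 - u ^+ 5 / 2 + 11 / 4 * u ^+ 4 + 3 / 2 * u ^+ 3
  + 17 / 4 * u ^+ 2 + 17 / 4 * u + 17 / 8.
pose P : R -> R := fun v => 2^-1 * hexp 2 6 v - 2^-1 * hexp 2 5 v
  + 11 / 4 * hexp 2 4 v + 3 / 2 * hexp 2 3 v + 17 / 4 * hexp 2 2 v
  + 17 / 4 * hexp 2 1 v + 17 / 8 * hexp 2 0 v.
have two0 : 0 < 2 :> R by [].
have PE v : P v = (if 0 < v then D v^-1 * expR (- 2 * v^-1) else 0).
  have [v0|v0] := ltP 0 v; last by rewrite /P !hexp_le0// !mulr0 !(addr0, subr0).
  by rewrite /P /D !hexpE//; ring.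
(* The supremum of [P] is its limit at infinity, [D 0]. In the variable u = 1 / v the function
   decreases, its derivative being minus (h' + 2 h)^2 / u^2, that is minus u^2 (u^2 - 2 u + 2)^2
   e^(-2 u). *)
have Db u : 0 <= u -> D u * expR (- 2 * u) <= 17 / 8.
  move=> u0; rewrite -lerN2.
  have -> : - (17 / 8) = - (D 0 * expR (0 + - 2 * 0)).
    by rewrite mulr0 addr0 expR0 mulr1 /D !expr0n /=; ring.
  have -> : - (D u * expR (- 2 * u)) = - (D u * expR (0 + - 2 * u)) by rewrite add0r.
  pose q : {poly R} := 2^-1 *: 'X^6 - 2^-1 *: 'X^5 + (11 / 4) *: 'X^4
    + (3 / 2) *: 'X^3 + (17 / 4) *: 'X^2 + (17 / 4) *: 'X + (17 / 8)%:P.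
  have qE z : q.[z] = D z.
    by rewrite /q !(hornerD, hornerN, hornerZ, hornerXn, hornerX, hornerC) /D; field.
  have Dd (z : R) : is_derive z 1 D (q^`().[z]).
    rewrite (_ : D = horner q); first exact: is_derive_poly.
    by apply/funext => w; rewrite qE.
  have qd z : q^`().[z] = 3 * z ^+ 5 - 5 / 2 * z ^+ 4 + 11 * z ^+ 3
     + 9 / 2 * z ^+ 2 + 17 / 2 * z + 17 / 4.
    rewrite /q !(derivD, derivB, derivZ, derivXn, derivX, derivN, derivC) alg_polyC.
    by rewrite /= !(hornerD, hornerN, hornerZ, hornerMn, hornerXn, hornerX, hornerC); field.
  apply: (@nondecreasing_of_der _ (fun z => - (D z * expR (0 + - 2 * z)))
    (fun z => z ^+ 2 * (z ^+ 2 - 2 * z + 2) ^+ 2 * expR (0 + - 2 * z))) => //.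
    move=> z.
    have -> : (fun z => - (D z * expR (0 + - 2 * z)))
       = (fun z => -1 * (D z * expR (0 + - 2 * z))).
      by apply/funext => w; rewrite mulN1r.
    apply: (der_eq (derZ _ (derM (Dd z) (der_exp_affine (- 2) 0 z)))).
    by rewrite qd /D; field.
  by move=> z _; apply: mulr_ge0; rewrite ?expR_ge0// mulr_ge0// sqr_ge0.
(* Any common upper bound of the points will do, since the bound on [P] is uniform. *)
pose X := \sum_i x i + \sum_j y j.
have sx : 0 <= \sum_i x i by apply: sumr_ge0 => i _.
have sy : 0 <= \sum_j y j by apply: sumr_ge0 => j _.
(* Here B = 17/8, and th = 1/3 is close to the minimiser 1 / sqrt(2 a B) of th B + 1 / (2 a th). *)
have -> : 35 / 48 * c = (3^-1 * (17 / 8) + 3^-1^-1 / (2 * 2)) / 2 * c by field.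
apply: (@dominated_lipschitz R m n N c x y (hexp 1 0) h h1 P 2 3^-1 (17 / 8) X) => //.
- move=> v; apply: (der_eq (der_hexp _ _ _)); first by [].
  by rewrite mul1r mul0r subr0.
- move=> v; apply: (der_eq (der_hexp _ _ _)); first by [].
  by rewrite mul1r.
- move=> v; have hd k := @der_hexp R 2 k v two0.
  apply: (der_eq (derD (derD (derD (derD (derD (derB (derZ 2^-1 (hd 6%N))
    (derZ 2^-1 (hd 5%N))) (derZ (11 / 4) (hd 4%N))) (derZ (3 / 2) (hd 3%N)))
    (derZ (17 / 4) (hd 2%N))) (derZ (17 / 4) (hd 1%N))) (derZ (17 / 8) (hd 0%N)))).
  rewrite /h1 /h.
  have [v0|v0] := ltP 0 v; last by rewrite !hexp_le0// !mulr0; ring.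
  rewrite !hexpE// (_ : expR (- 2 * v^-1) = expR (- 1 * v^-1) ^+ 2); last first.
    by rewrite -expRM_natl; congr expR; ring.
  by move: (v^-1) (expR _) => u ex; field.
- by move=> v v0; rewrite /h hexp_le0.
- by move=> v v0; rewrite PE ltNge v0.
- move=> v _; rewrite PE; case: ifPn => // v0; apply: Db.
  by rewrite invr_ge0 ltW.
- move=> i; rewrite x0/= /X -[X in X <= _]addr0 lerD//.
  by rewrite (bigD1 i)//= lerDl sumr_ge0.
- move=> i; rewrite y0/= /X -[X in X <= _]add0r lerD//.
  by rewrite (bigD1 i)//= lerDl sumr_ge0.
- exact: addr_ge0.
Qed.

Lemma dominated_mul_exp (R : realType) m n
    (N : 'I_m -> 'I_n -> R) (c : R) (x : 'I_m -> R) (y : 'I_n -> R) :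
  dominated (fun i j => N i j * (x i - y j)) c ->
  (forall i, 0 <= x i <= 1) -> (forall j, 0 <= y j <= 1) ->
  \sum_i \sum_j N i j * (expR 1 * (hexp 1 1 (x i) - hexp 1 0 (x i))
    - expR 1 * (hexp 1 1 (y j) - hexp 1 0 (y j))) <= 47 / 20 * c.
Proof.
move=> dom x01 y01.
pose G v : R := expR 1 * (hexp 1 1 v - hexp 1 0 v).
pose h : R -> R := fun v => expR 1 * (hexp 1 3 v - 2 * hexp 1 2 v).
pose h1 : R -> R := fun v =>
  expR 1 * (hexp 1 5 v - 5 * hexp 1 4 v + 4 * hexp 1 3 v).
(* P is the primitive of (h' + a h)^2 with a = 13/2; th = 1/30 below. *)
pose P : R -> R := fun v => expR 1 ^+ 2 *
  (2^-1 * hexp 2 8 v - 3 * hexp 2 7 v + 25 / 2 * hexp 2 6 v - 28 * hexp 2 5 v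
   + 401 / 8 * hexp 2 4 v - 145 / 4 * hexp 2 3 v + 241 / 8 * hexp 2 2 v
   + 241 / 8 * hexp 2 1 v + 241 / 16 * hexp 2 0 v).
have two0 : 0 < 2 :> R by [].
have one0 : 0 < 1 :> R by [].
have Pd (v : R) : is_derive v 1 P ((h1 v + 13 / 2 * h v) ^+ 2).
  have hd k := @der_hexp R 2 k v two0.
  apply: (der_eq (derZ (expR 1 ^+ 2) (derD (derD (derD (derB (derD (derB (derD
    (derB (derZ 2^-1 (hd 8%N)) (derZ 3 (hd 7%N))) (derZ (25 / 2) (hd 6%N)))
    (derZ 28 (hd 5%N))) (derZ (401 / 8) (hd 4%N))) (derZ (145 / 4) (hd 3%N)))
    (derZ (241 / 8) (hd 2%N))) (derZ (241 / 8) (hd 1%N)))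
    (derZ (241 / 16) (hd 0%N))))).
  rewrite /h1 /h.
  have [v0|v0] := ltP 0 v; last by rewrite !hexp_le0// !mulr0; ring.
  rewrite !hexpE// (_ : expR (- 2 * v^-1) = expR (- 1 * v^-1) ^+ 2); last first.
    by rewrite -expRM_natl; congr expR; ring.
  by move: (v^-1) (expR _) => u ex; field.
have c0 : 0 <= c.
  by have [r [s [r0 _ rc _ _]]] := dom; rewrite (le_trans _ rc)// sumr_ge0.
(* The constant on the left is about 2.3403, just below 47/20; th = 1/30 is close to the minimiser 1
   / sqrt(2 a B) with B = 1139/16. *)
apply: (@le_trans _ _ ((30^-1 * (1139 / 16) + 30^-1^-1 / (2 * (13 / 2))) / 2 * c)).
  2: by rewrite ler_wpM2r//; lra.
have Gd (v : R) : is_derive v 1 G (h v).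
  have hd k := @der_hexp R 1 k v one0.
  apply: (der_eq (derZ (expR 1) (derB (hd 1%N) (hd 0%N)))).
  by rewrite /h; ring.
have hd1 (v : R) : is_derive v 1 h (h1 v).
  have hd k := @der_hexp R 1 k v one0.
  apply: (der_eq (derZ (expR 1) (derB (hd 3%N) (derZ 2 (hd 2%N))))).
  by rewrite /h1; ring.
have h0 v : v <= 0 -> h v = 0.
  by move=> v0; rewrite /h !hexp_le0// mulr0 subrr mulr0.
have P0 v : v <= 0 -> P v = 0.
  by move=> v0; rewrite /P !hexp_le0// !mulr0 !(addr0, subr0) mulr0.
(* [P] is nondecreasing, its derivative being a square, so on points of [0, 1] only its value at 1
   matters; there the factor e^2 cancels the exponentials. *)
have PB v : v <= 1 -> P v <= 1139 / 16.
  move=> v1; have -> : 1139 / 16 = P 1.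
    rewrite /P !hexpE// !invr1 !expr1n !mul1r !mulr1 expRN.
    have -> : expR 2 = expR 1 ^+ 2 :> R by rewrite -expRM_natl mulr1.
    by field; rewrite gt_eqF// expR_gt0.
  apply: (nondecreasing_of_der v1 Pd) => z _; exact: sqr_ge0.
have B0 : 0 <= 1139 / 16 :> R by lra.
have a0 : 0 < 13 / 2 :> R by lra.
have t0 : 0 < 30^-1 :> R by lra.
exact: (@dominated_lipschitz R m n N c x y G h h1 P (13 / 2) 30^-1 (1139 / 16) 1
  a0 t0 dom Gd hd1 Pd h0 P0 B0 PB x01 y01 ler01).
Qed.

(** * An upper bound on pi *)

Lemma cos_le_taylor4 (R : realType) (x : R) : 0 <= x ->
  cos x <= 1 - x ^+ 2 / 2 + x ^+ 4 / 24.
Proof.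
move=> x0.
have dX k (v : R) : is_derive v 1 (fun y : R => y ^+ k.+1) (k.+1%:R * v ^+ k).
  have E : (fun y : R => y ^+ k.+1) = id ^+ k.+1.
    by apply/funext => y; rewrite exprfctE.
  rewrite E; apply: (der_eq (@is_deriveX _ _ id k.+1 v 1 _ (is_derive_id v 1))).
  by rewrite /= /GRing.scale /= mulr1.
have did (z : R) : is_derive z 1 (fun v : R => v) 1 by exact: is_derive_id.
have dcst (z : R) : is_derive z 1 (fun _ : R => 1 : R) 0 by exact: is_derive_cst.
(* Each of the four bounds below is obtained by integrating the preceding one from 0, starting with
   1 - cos >= 0. *)
have from0 (f df : R -> R) : (forall v : R, is_derive v 1 f (df v)) ->
    (forall v : R, 0 <= v -> 0 <= df v) -> f 0 = 0 -> forall v : R, 0 <= v -> 0 <= f v.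
  move=> fd df0 f0 v v0; rewrite -f0; apply: (nondecreasing_of_der v0 fd).
  by move=> z /andP[z0 _]; exact: df0.
have d1 (z : R) : is_derive z 1 (fun v => v - sin v) (1 - cos z).
  exact: (derB (did z) (is_derive_sin z)).
have d2 (z : R) : is_derive z 1 (fun v => cos v + (2^-1 * v ^+ 2 - 1)) (z - sin z).
  apply: (der_eq (derD (is_derive_cos z) (derB (derZ 2^-1 (dX 1%N z)) (dcst z)))).
  by field.
have d3 (z : R) : is_derive z 1 (fun v => sin v + (6^-1 * v ^+ 3 - v))
    (cos z + (2^-1 * z ^+ 2 - 1)).
  apply: (der_eq (derD (is_derive_sin z) (derB (derZ 6^-1 (dX 2%N z)) (did z)))).
  by field.
have d4 (z : R) : is_derive z 1
    (fun v => 24^-1 * v ^+ 4 - 2^-1 * v ^+ 2 + (1 - cos v))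
    (sin z + (6^-1 * z ^+ 3 - z)).
  apply: (der_eq (derD (derB (derZ 24^-1 (dX 3%N z)) (derZ 2^-1 (dX 1%N z)))
    (derB (dcst z) (is_derive_cos z)))).
  by field.
have s1 (v : R) : 0 <= v -> 0 <= v - sin v.
  apply: (from0 _ _ d1); first by move=> z _; rewrite subr_ge0 cos_le1.
  by rewrite sin0 subrr.
have s2 : forall v : R, 0 <= v -> 0 <= cos v + (2^-1 * v ^+ 2 - 1).
  by apply: (from0 _ _ d2 s1); rewrite cos0 expr0n /=; ring.
have s3 : forall v : R, 0 <= v -> 0 <= sin v + (6^-1 * v ^+ 3 - v).
  by apply: (from0 _ _ d3 s2); rewrite sin0 expr0n /=; ring.
have s4 : forall v : R, 0 <= v ->
    0 <= 24^-1 * v ^+ 4 - 2^-1 * v ^+ 2 + (1 - cos v).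
  by apply: (from0 _ _ d4 s3); rewrite cos0 !expr0n /=; ring.
by have := s4 _ x0; lra.
Qed.

(** The Taylor bound is negative at 17/10, so 17/10 cannot lie below pi / 2. The value 17/5 is just
    under 160/47, which is what the comparison of 47/80 with 2 / pi demands. *)
Lemma pi_le_34 (R : realType) : pi <= 17 / 5 :> R.
Proof.
rewrite leNgt; apply/negP => pi_gt.
have /cos_gt0_pihalf : - (pi / 2) < (17 / 10 : R) < pi / 2 by lra.
have /cos_le_taylor4 : 0 <= 17 / 10 :> R by lra.
by lra.
Qed.

(** * Entrywise convergence of matrices *)

(** Entrywise convergence reduces products, determinants and inverses to the scalar limit rules;
    [mxcvg_cvg] leads back to the topology in which [lim] is taken. *)
Definition mxcvg (R : realType) (T : Type) m n (F : set_system T)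
    (A : T -> 'M[R]_(m, n)) (A0 : 'M[R]_(m, n)) : Prop :=
  forall i j, A g i j @[g --> F] --> A0 i j.

Lemma mxcvg_cvg (R : realType) (T : Type) m n (F : set_system T)
    (FF : Filter F) (A : T -> 'M[R]_(m, n)) (A0 : 'M[R]_(m, n)) :
  mxcvg F A A0 -> A g @[g --> F] --> A0.
Proof.
move=> cA; apply/cvg_ballP => e e0.
have h : \forall g \near F, forall i, forall j, ball (A0 i j) e (A g i j).
  apply: filter_forall => i; apply: filter_forall => j.
  by have /cvg_ballP := cA i j; apply.
by near=> g; split => //; near: g.
Unshelve. all: by end_near. Qed.

Lemma mxcvg_lim (R : realType) (T : Type) m n (F : set_system T)
    (FF : ProperFilter F) (A : T -> 'M[R]_(m, n)) (A0 : 'M[R]_(m, n)) :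
  mxcvg F A A0 -> lim (A g @[g --> F]) = A0.
Proof.
move=> /mxcvg_cvg h; apply: cvg_lim => //; exact: norm_hausdorff.
Qed.

Lemma mxcvg_cst (R : realType) (T : Type) m n (F : set_system T)
    (FF : Filter F) (A0 : 'M[R]_(m, n)) : mxcvg F (fun _ => A0) A0.
Proof. by move=> i j; exact: cvg_cst. Qed.

Arguments mxcvg_cst {R T m n F} FF A0.

Lemma mxcvgD (R : realType) (T : Type) m n (F : set_system T)
    (FF : Filter F) (A B : T -> 'M[R]_(m, n)) A0 B0 :
  mxcvg F A A0 -> mxcvg F B B0 -> mxcvg F (fun g => A g + B g) (A0 + B0).
Proof.
by move=> cA cB i j; under eq_fun do rewrite mxE; rewrite mxE; apply: cvgD.
Qed.

Lemma mxcvgN (R : realType) (T : Type) m n (F : set_system T)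
    (FF : Filter F) (A : T -> 'M[R]_(m, n)) A0 :
  mxcvg F A A0 -> mxcvg F (fun g => - A g) (- A0).
Proof.
by move=> cA i j; under eq_fun do rewrite mxE; rewrite mxE; apply: cvgN.
Qed.

Lemma mxcvgB (R : realType) (T : Type) m n (F : set_system T)
    (FF : Filter F) (A B : T -> 'M[R]_(m, n)) A0 B0 :
  mxcvg F A A0 -> mxcvg F B B0 -> mxcvg F (fun g => A g - B g) (A0 - B0).
Proof. by move=> cA cB; apply: mxcvgD => //; exact: mxcvgN. Qed.

Lemma mxcvgZ (R : realType) (T : Type) m n (F : set_system T)
    (FF : Filter F) (k : T -> R) (k0 : R) (A : T -> 'M[R]_(m, n)) A0 :
  k g @[g --> F] --> k0 -> mxcvg F A A0 -> mxcvg F (fun g => k g *: A g) (k0 *: A0).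
Proof.
by move=> ck cA i j; under eq_fun do rewrite mxE; rewrite mxE; apply: cvgM.
Qed.

Lemma cvg_bigsum (R : realType) (T : Type) (F : set_system T) (FF : Filter F)
    (I : Type) (r : seq I) (P : pred I) (f : I -> T -> R) (a : I -> R) :
  (forall i, P i -> f i g @[g --> F] --> a i) ->
  \sum_(i <- r | P i) f i g @[g --> F] --> \sum_(i <- r | P i) a i.
Proof. by move=> h; apply: cvg_big => //; exact: add_continuous. Qed.

Lemma cvg_bigprod (R : realType) (T : Type) (F : set_system T) (FF : Filter F)
    (I : Type) (r : seq I) (P : pred I) (f : I -> T -> R) (a : I -> R) :
  (forall i, P i -> f i g @[g --> F] --> a i) ->
  \prod_(i <- r | P i) f i g @[g --> F] --> \prod_(i <- r | P i) a i.
Proof. by move=> h; apply: cvg_big => //; exact: mul_continuous. Qed.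

Lemma mxcvgM (R : realType) (T : Type) m n p (F : set_system T)
    (FF : Filter F) (A : T -> 'M[R]_(m, n)) (B : T -> 'M[R]_(n, p)) A0 B0 :
  mxcvg F A A0 -> mxcvg F B B0 -> mxcvg F (fun g => A g *m B g) (A0 *m B0).
Proof.
move=> cA cB i j; under eq_fun do rewrite mxE; rewrite mxE.
by apply: cvg_bigsum => k _; apply: cvgM.
Qed.

Lemma mxcvgT (R : realType) (T : Type) m n (F : set_system T)
    (A : T -> 'M[R]_(m, n)) A0 :
  mxcvg F A A0 -> mxcvg F (fun g => (A g)^T) A0^T.
Proof. by move=> cA i j; under eq_fun do rewrite mxE; rewrite mxE; apply: cA. Qed.

Lemma mxcvg_tr (R : realType) (T : Type) n (F : set_system T)
    (FF : Filter F) (A : T -> 'M[R]_n) A0 :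
  mxcvg F A A0 -> \tr (A g) @[g --> F] --> \tr A0.
Proof. by move=> cA; apply: cvg_bigsum => i _; apply: cA. Qed.

Lemma mxcvg_det (R : realType) (T : Type) n (F : set_system T)
    (FF : Filter F) (A : T -> 'M[R]_n) A0 :
  mxcvg F A A0 -> \det (A g) @[g --> F] --> \det A0.
Proof.
move=> cA; apply: cvg_bigsum => s _; apply: cvgM; first exact: cvg_cst.
by apply: cvg_bigprod => i _; apply: cA.
Qed.

Lemma cvg_near (R : realType) (T : Type) (F : set_system T) (FF : Filter F)
    (f g : T -> R) (l : R) :
  (\forall x \near F, f x = g x) -> f x @[x --> F] --> l -> g x @[x --> F] --> l.
Proof. by move=> fg; apply: cvg_trans; exact: near_eq_cvg. Qed.

Lemma mxcvg_near (R : realType) (T : Type) m n (F : set_system T)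
    (FF : Filter F) (A B : T -> 'M[R]_(m, n)) A0 :
  (\forall g \near F, A g = B g) -> mxcvg F A A0 -> mxcvg F B A0.
Proof.
by move=> AB cA i j; apply: (cvg_near FF) (cA i j); apply: filterS AB => g ->.
Qed.

Lemma mxcvg_unit (R : realType) (T : Type) n (F : set_system T)
    (FF : Filter F) (A : T -> 'M[R]_n) A0 :
  A0 \in unitmx -> mxcvg F A A0 -> \forall g \near F, A g \in unitmx.
Proof.
move=> A0u cA; have d0 : \det A0 != 0 by move: A0u; rewrite unitmxE unitfE.
near=> g; rewrite unitmxE unitfE; near: g.
exact: (@cvgr_neq0 R R^o T F FF _ _ (mxcvg_det FF cA) d0).
Unshelve. all: by end_near. Qed.

(** By Cramer's rule the inverse is the adjugate, polynomial in the entries, divided by a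
    determinant that stays away from zero. *)
Lemma mxcvg_inv (R : realType) (T : Type) n (F : set_system T)
    (FF : Filter F) (A : T -> 'M[R]_n) A0 :
  A0 \in unitmx -> mxcvg F A A0 -> mxcvg F (fun g => invmx (A g)) (invmx A0).
Proof.
move=> A0u cA; have Au := mxcvg_unit FF A0u cA.
apply: (mxcvg_near FF (A := fun g => (\det (A g))^-1 *: \adj (A g))).
  by apply: filterS Au => g; rewrite /invmx => ->.
rewrite /invmx A0u; apply: (mxcvgZ FF).
  apply: cvgV; first by move: A0u; rewrite unitmxE unitfE.
  exact: mxcvg_det.
move=> i j; under eq_fun do rewrite !mxE; rewrite !mxE.
apply: cvgM; first exact: cvg_cst.
by apply: mxcvg_det => k l; under eq_fun do rewrite !mxE; rewrite !mxE; apply: cA.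
Qed.

(** * Spectral theorem, square roots and norms *)

Definition dotv (R : realType) n (x y : 'cV[R]_n) : R := (x^T *m y) 0 0.

Lemma dotvE (R : realType) n (x y : 'cV[R]_n) :
  dotv x y = \sum_i x i 0 * y i 0.
Proof. by rewrite /dotv mxE; apply: eq_bigr => i _; rewrite mxE. Qed.

Lemma dotvC (R : realType) n (x y : 'cV[R]_n) : dotv x y = dotv y x.
Proof. by rewrite !dotvE; apply: eq_bigr => i _; rewrite mulrC. Qed.

Lemma dotvDr (R : realType) n (x y z : 'cV[R]_n) :
  dotv x (y + z) = dotv x y + dotv x z.
Proof. by rewrite /dotv mulmxDr mxE. Qed.

Lemma dotvDl (R : realType) n (x y z : 'cV[R]_n) :
  dotv (y + z) x = dotv y x + dotv z x.
Proof. by rewrite dotvC dotvDr !(dotvC x). Qed.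

Lemma dotvZr (R : realType) n (k : R) (x y : 'cV[R]_n) :
  dotv x (k *: y) = k * dotv x y.
Proof. by rewrite /dotv -scalemxAr mxE. Qed.

Lemma dotvZl (R : realType) n (k : R) (x y : 'cV[R]_n) :
  dotv (k *: x) y = k * dotv x y.
Proof. by rewrite dotvC dotvZr dotvC. Qed.

Lemma dotvNr (R : realType) n (x y : 'cV[R]_n) :
  dotv x (- y) = - dotv x y.
Proof. by rewrite -scaleN1r dotvZr mulN1r. Qed.

Lemma dotvNl (R : realType) n (x y : 'cV[R]_n) :
  dotv (- x) y = - dotv x y.
Proof. by rewrite -scaleN1r dotvZl mulN1r. Qed.

Lemma dotv0 (R : realType) n (x : 'cV[R]_n) : dotv x 0 = 0.
Proof. by rewrite /dotv mulmx0 mxE. Qed.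

Lemma dotv_mulmx (R : realType) m n (A : 'M[R]_(m, n)) x y :
  dotv x (A *m y) = dotv (A^T *m x) y.
Proof. by rewrite /dotv trmx_mul trmxK mulmxA. Qed.

Lemma dotv_ge0 (R : realType) n (x : 'cV[R]_n) : 0 <= dotv x x.
Proof. by rewrite dotvE sumr_ge0// => i _; rewrite -expr2 sqr_ge0. Qed.

Lemma dotv_eq0 (R : realType) n (x : 'cV[R]_n) : dotv x x = 0 -> x = 0.
Proof.
rewrite dotvE => /eqP; rewrite psumr_eq0; last by move=> i _; rewrite -expr2 sqr_ge0.
move=> /allP x0; apply/matrixP => i j; rewrite ord1 mxE.
by have := x0 i (mem_index_enum _); rewrite /= -expr2 sqrf_eq0 => /eqP.
Qed.

Lemma dotv_gt0 (R : realType) n (x : 'cV[R]_n) : x != 0 -> 0 < dotv x x.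
Proof.
move=> x0; rewrite lt_neqAle dotv_ge0 andbT eq_sym.
by apply: contraNneq x0 => /dotv_eq0 ->.
Qed.

Lemma dotv_delta (R : realType) n (x : 'cV[R]_n) i :
  dotv (delta_mx i 0) x = x i 0.
Proof.
rewrite dotvE (bigD1 i)//= big1 ?addr0.
  by rewrite mxE !eqxx mul1r.
by move=> k ki; rewrite mxE (negbTE ki) mul0r.
Qed.

Lemma psd_cauchy_schwarz (R : realType) n (A : 'M[R]_n) (x y : 'cV[R]_n) :
  A^T = A -> (forall z, 0 <= dotv z (A *m z)) ->
  dotv x (A *m y) ^+ 2 <= dotv x (A *m x) * dotv y (A *m y).
Proof.
move=> sA pA; set a := dotv x _; set b := dotv x _; set c := dotv y _.
have bE : dotv y (A *m x) = a by rewrite dotv_mulmx sA dotvC.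
have quad (s t : R) : 0 <= s ^+ 2 * b + 2 * (s * t * a) + t ^+ 2 * c.
  have := pA (s *: x + t *: y).
  rewrite mulmxDr -!scalemxAr dotvDl !dotvDr !dotvZl !dotvZr bE -/a -/b -/c.
  by congr (0 <= _); ring.
have b0 : 0 <= b by exact: pA.
have c0 : 0 <= c by exact: pA.
have [c00|cn0] := eqVneq c 0.
  have [->|an0] := eqVneq a 0; first by rewrite expr0n mulr_ge0.
  (* With c = 0 the quadratic is affine in [t], and this choice of [t] makes it equal to -1. *)
  have := quad 1 (- (b + 1) / (2 * a)); rewrite c00 mulr0 addr0.
  by rewrite (_ : _ + _ = -1) ?oppr_ge0 ?ler10//; field.
have cp : 0 < c by rewrite lt_neqAle eq_sym cn0.
have := quad c (- a).
have -> : c ^+ 2 * b + 2 * (c * - a * a) + (- a) ^+ 2 * c = c * (b * c - a ^+ 2) by ring.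
by rewrite pmulr_rge0// subr_ge0.
Qed.

Lemma cauchy_schwarz (R : realType) n (x y : 'cV[R]_n) :
  dotv x y ^+ 2 <= dotv x x * dotv y y.
Proof.
have := @psd_cauchy_schwarz R n 1%:M x y (trmx1 _ _).
by rewrite !mul1mx; apply => z; rewrite mul1mx dotv_ge0.
Qed.

Lemma dotv_mulmx_bounded (R : realType) n (A : 'M[R]_n) :
  exists2 K : R, 0 < K & forall x, dotv x (A *m x) <= K * dotv x x.
Proof.
exists (1 + \sum_i \sum_j `|A i j|).
  by rewrite ltr_wpDr// sumr_ge0// => i _; rewrite sumr_ge0.
move=> x; rewrite mulrDl mul1r.
apply: (@le_trans _ _ ((\sum_i \sum_j `|A i j|) * dotv x x)); last first.
  by rewrite lerDr dotv_ge0.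
rewrite [X in X <= _]dotvE mulr_suml; apply: ler_sum => i _.
rewrite mxE mulr_sumr mulr_suml; apply: ler_sum => j _.
have sq k : x k 0 ^+ 2 <= dotv x x.
  rewrite dotvE (bigD1 k)//= expr2 lerDl sumr_ge0// => l _.
  by rewrite -expr2 sqr_ge0.
apply: (le_trans (ler_norm _)); rewrite mulrCA normrM ler_wpM2l//.
have := sq i; have := sq j; have := sqr_ge0 (`|x i 0| - `|x j 0|).
rewrite normrM sqrrB !real_normK ?num_real//.
move: (`|x i 0| * `|x j 0|) => z; lra.
Qed.

(* The least c with A <= c I makes c I - A singular: a nonsingular positive
   semidefinite matrix is bounded below by a positive multiple of I. *)
Lemma symmetric_eigenvector (R : realType) n (A : 'M[R]_n.+1) :
  A^T = A -> exists (c : R) (v : 'cV[R]_n.+1), A *m v = c *: v /\ dotv v v = 1.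
Proof.
move=> sA.
pose S := [set c : R | forall x, dotv x (A *m x) <= c * dotv x x].
have [K K0 KS] := dotv_mulmx_bounded A.
have [K' K'0 K'S] := dotv_mulmx_bounded (- A).
have lbS : lbound S (- K').
  move=> c; pose x := delta_mx 0 0 : 'cV[R]_n.+1; move=> /(_ x).
  have x1 : dotv x x = 1 by rewrite dotv_delta mxE !eqxx.
  have := K'S x; rewrite mulNmx dotvNr x1; lra.
have infS : has_inf S by split; [exists K | exists (- K')].
pose c := inf S.
have cS x : dotv x (A *m x) <= c * dotv x x.
  apply/ler_addgt0Pr => e e0.
  have q0 : 0 < dotv x x + 1 by rewrite ltr_wpDl ?dotv_ge0.
  have [s Ss sc] := inf_adherent (divr_gt0 e0 q0) infS.
  apply: (le_trans (Ss x)).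
  apply: (@le_trans _ _ ((c + e / (dotv x x + 1)) * dotv x x)).
    by rewrite ler_wpM2r ?dotv_ge0// ltW.
  rewrite mulrDl lerD2l mulrAC ler_pdivrMr// ler_wpM2l ?(ltW e0)//.
  by rewrite lerDl.
pose B := c%:M - A.
have sB : B^T = B by rewrite linearB /= tr_scalar_mx sA.
have BE x : B *m x = c *: x - A *m x by rewrite mulmxBl mul_scalar_mx.
have pB x : 0 <= dotv x (B *m x).
  by rewrite BE dotvDr dotvNr dotvZr subr_ge0.
have [Bu|] := boolP (B \in unitmx); last first.
  rewrite unitmxE unitfE negbK => /det0P[v vn0 vB].
  have w0 : v^T != 0 by rewrite -(inj_eq trmx_inj) trmxK trmx0.
  have Aw : A *m v^T = c *: v^T.
    apply/eqP; rewrite eq_sym -subr_eq0 -BE.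
    by rewrite -[B]sB -trmx_mul vB trmx0.
  have d0 := dotv_gt0 w0.
  exists c, ((Num.sqrt (dotv v^T v^T))^-1 *: v^T); split.
    by rewrite -scalemxAr Aw scalerA mulrC -scalerA.
  rewrite dotvZl dotvZr mulrA -invfM -expr2 sqr_sqrtr ?ltW// mulVf// gt_eqF//.
exfalso.
have [M M0 MS] := dotv_mulmx_bounded (invmx B).
(* Cauchy-Schwarz for the form of [B], applied to x and B^-1 x, bounds |x|^4 by the product of the
   forms of B and of B^-1 at x. The resulting lower bound would make c - 1 / M admissible, against
   the choice of [c]. *)
have low x : M^-1 * dotv x x <= dotv x (B *m x).
  have [->|xn0] := eqVneq x 0; first by rewrite mulmx0 !dotv0 mulr0.
  have d0 := dotv_gt0 xn0.
  have := psd_cauchy_schwarz x (invmx B *m x) sB pB.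
  rewrite mulKVmx// [dotv (invmx B *m x) x]dotvC expr2 => h.
  have h2 : dotv x x * dotv x x <= dotv x (B *m x) * (M * dotv x x).
    by apply: (le_trans h); rewrite ler_wpM2l.
  rewrite ler_pdivrMl// mulrC -(ler_pM2r d0); apply: (le_trans h2).
  by rewrite mulrA.
have : S (c - M^-1).
  move=> x; have := low x; rewrite BE dotvDr dotvNr dotvZr; lra.
move=> /(ge_inf infS.2); rewrite -/c => h.
by move: h; rewrite lerBrDl gerDr leNgt invr_gt0 M0.
Qed.

(* A Householder reflection exchanging e_0 and v. *)
Lemma orthogonal_extension (R : realType) n (v : 'cV[R]_n.+1) :
  dotv v v = 1 ->
  exists2 H : 'M[R]_n.+1, H^T = H /\ H *m H = 1%:M & H *m delta_mx 0 0 = v.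
Proof.
move=> v1; pose e := delta_mx 0 0 : 'cV[R]_n.+1.
have e1 : dotv e e = 1 by rewrite dotv_delta mxE !eqxx.
have [ve|ve] := eqVneq v e.
  by exists 1%:M; rewrite ?trmx1 ?mul1mx.
pose w := v - e; have wn0 : w != 0 by rewrite subr_eq0.
have ww := dotv_gt0 wn0.
have sc1 (x y : 'cV[R]_n.+1) : x^T *m y = (dotv x y)%:M by rewrite [LHS]mx11_scalar.
pose k := 2 / dotv w w.
pose H := 1%:M - k *: (w *m w^T).
have wwE : dotv w w = 2 - 2 * dotv v e.
  by rewrite /w dotvDr !dotvDl !dotvNl !dotvNr v1 e1 (dotvC e v); ring.
exists H; first split.
- by rewrite /H linearB /= trmx1 linearZ /= trmx_mul trmxK.
- have PP : (w *m w^T) *m (w *m w^T) = dotv w w *: (w *m w^T).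
    by rewrite mulmxA -(mulmxA w) sc1 mul_mx_scalar -scalemxAl.
  rewrite /H mulmxBl mul1mx mulmxBr mulmx1 -scalemxAl -scalemxAr PP !scalerA.
  have -> : k * k * dotv w w = k + k by rewrite /k; field; rewrite gt_eqF.
  rewrite scalerDl; move: (k *: _) => Q.
  by apply/matrixP => i j; rewrite !mxE; ring.
- rewrite /H mulmxBl mul1mx -scalemxAl -mulmxA sc1 mul_mx_scalar scalerA.
  have -> : k * dotv w e = -1.
    have we : dotv w e = dotv v e - 1 by rewrite /w dotvDl dotvNl e1.
    rewrite /k we wwE; field.
    by rewrite -wwE gt_eqF.
  by rewrite scaleN1r opprK /w addrC subrK.
Qed.

(** Deflation: a reflection carries a unit eigenvector to e_0, symmetry makes the conjugated matrix
    block diagonal, and the induction hypothesis treats the lower block. *)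
Theorem symmetric_spectral (R : realType) n (A : 'M[R]_n) : A^T = A ->
  exists (U : 'M[R]_n) (d : 'rV[R]_n),
    U^T *m U = 1%:M /\ A = U *m diag_mx d *m U^T.
Proof.
elim: n A => [|n IH] A sA.
  by exists 0, 0; split; apply/matrixP; case.
have [c [v [Av v1]]] := symmetric_eigenvector sA.
have [H [sH HH] He] := orthogonal_extension v1.
have [B [sB Be ->]] : exists B : 'M[R]_n.+1, [/\ B^T = B,
    B *m delta_mx 0 0 = c *: (delta_mx 0 0 : 'cV[R]_n.+1) & A = H *m B *m H].
  exists (H *m A *m H); split.
  - by rewrite !trmx_mul sH sA mulmxA.
  - by rewrite -!mulmxA He Av -scalemxAr -[v]He mulmxA HH mul1mx.
  - by rewrite !mulmxA HH mul1mx -mulmxA HH mulmx1.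
have Bi0 i : B i 0 = c * (i == 0)%:R.
  have := congr1 (fun M : 'cV[R]_n.+1 => M i 0) Be.
  by rewrite -colE !mxE eqxx andbT.
have l0 : lshift n (0 : 'I_1) = (0 : 'I_n.+1) by exact: val_inj.
pose B' : 'M[R]_n := @drsubmx R 1 n 1 n B.
have sB' : B'^T = B' by rewrite /B' trmx_drsub sB.
have [U [d [UU B'E]]] := IH _ sB'.
have BE : B = @block_mx R 1 n 1 n c%:M 0 0 B'.
  rewrite -[LHS](@submxK R 1 n 1 n) /B'.
  congr (@block_mx R 1 n 1 n _ _ _ _).
  - by apply/matrixP => i j; rewrite !ord1 !mxE l0 Bi0 !eqxx mulr1.
  - by apply/matrixP => i j; rewrite !ord1 -sB !mxE l0 Bi0 mulr0.
  - by apply/matrixP => i j; rewrite !ord1 !mxE l0 Bi0 mulr0.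
pose V := @block_mx R 1 n 1 n 1%:M 0 0 U.
have VV : V^T *m V = 1%:M.
  rewrite /V tr_block_mx mulmx_block !trmx0 !trmx1 !mul0mx !mulmx0 !addr0 add0r mul1mx UU.
  by rewrite -scalar_mx_block.
exists (H *m V), (@row_mx R 1 1 n c%:M d); split.
  by rewrite trmx_mul sH mulmxA -(mulmxA V^T) HH mulmx1.
have key : V *m diag_mx (@row_mx R 1 1 n c%:M d) *m V^T = @block_mx R 1 n 1 n c%:M 0 0 B'.
  rewrite /V tr_block_mx !trmx0 trmx1 diag_mx_row !mulmx_block.
  rewrite !(mul0mx, mulmx0, mul1mx, mulmx1, addr0, add0r) B'E.
  by congr block_mx; apply/matrixP => i j; rewrite !ord1 !mxE eqxx.
by rewrite trmx_mul sH BE -key !mulmxA.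
Qed.

(** In the eigenbases the intertwining relation reads (d_i - e_j) W_ij = 0, so [W] links equal
    eigenvalues only. Replacing the eigenvalues on both sides consistently therefore preserves the
    relation; this plays the part of a functional calculus. *)
Lemma diag_intertwine (R : realType) m n (U Ui : 'M[R]_m) (V Vi : 'M[R]_n)
    (d d' : 'rV[R]_m) (e e' : 'rV[R]_n) (Z : 'M[R]_(m, n)) :
  Ui *m U = 1%:M -> Vi *m V = 1%:M ->
  (U *m diag_mx d *m Ui) *m Z = Z *m (V *m diag_mx e *m Vi) ->
  (forall i j, d 0 i = e 0 j -> d' 0 i = e' 0 j) ->
  (U *m diag_mx d' *m Ui) *m Z = Z *m (V *m diag_mx e' *m Vi).
Proof.
move=> UU VV E h; have UU' := mulmx1C UU; have VV' := mulmx1C VV.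
have [W WE ZE] : exists2 W, diag_mx d *m W = W *m diag_mx e & Z = U *m W *m Vi.
  exists (Ui *m Z *m V).
    have := congr1 (fun M => Ui *m M *m V) E.
    by rewrite !mulmxA UU mul1mx -!mulmxA VV mulmx1 !mulmxA.
  by rewrite !mulmxA UU' mul1mx -mulmxA VV' mulmx1.
have WE' : diag_mx d' *m W = W *m diag_mx e'.
  apply/matrixP => i j; have := congr1 (fun M : 'M[R]_(m, n) => M i j) WE.
  rewrite !mul_diag_mx !mul_mx_diag !mxE [W i j * _]mulrC => /eqP.
  rewrite -subr_eq0 -mulrBl mulf_eq0 subr_eq0 => /orP[/eqP /h ->|/eqP ->].
    by rewrite mulrC.
  by rewrite mulr0 mul0r.
rewrite {1}ZE {1}[Z in RHS]ZE -!mulmxA (mulmxA Ui) UU mul1mx (mulmxA Vi) VV mul1mx.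
by rewrite (mulmxA (diag_mx d')) WE' !mulmxA.
Qed.

Lemma diag_conj_mul (R : realType) n (U Ui : 'M[R]_n) (d e : 'rV[R]_n) :
  Ui *m U = 1%:M ->
  (U *m diag_mx d *m Ui) *m (U *m diag_mx e *m Ui) =
  U *m diag_mx (\row_i (d 0 i * e 0 i)) *m Ui.
Proof.
move=> UU; rewrite -!mulmxA (mulmxA Ui) UU mul1mx (mulmxA (diag_mx d)) mulmx_diag.
by [].
Qed.

Lemma diag_conj1 (R : realType) n (U Ui : 'M[R]_n) :
  Ui *m U = 1%:M -> U *m diag_mx (const_mx 1) *m Ui = 1%:M.
Proof. by move=> UU; rewrite diag_const_mx mulmx1; exact: mulmx1C. Qed.

Lemma psd_eigen_ge0 (R : realType) n (A U : 'M[R]_n) (d : 'rV[R]_n) :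
  psdmx A -> U^T *m U = 1%:M -> A = U *m diag_mx d *m U^T -> forall i, 0 <= d 0 i.
Proof.
move=> [_ pA] UU AE i; have := pA (U *m delta_mx i 0).
rewrite AE trmx_mul -!mulmxA (mulmxA U^T U) UU mul1mx (mulmxA U^T U) UU mul1mx.
rewrite -[_ 0 0]/(dotv _ _) dotv_delta mul_diag_mx !mxE !eqxx mulr1.
exact.
Qed.

Lemma psd_conj (R : realType) m n (A : 'M[R]_n) (C : 'M[R]_(n, m)) :
  psdmx A -> psdmx (C^T *m A *m C).
Proof.
move=> [sA pA]; split; first by rewrite !trmx_mul trmxK sA mulmxA.
by move=> x; have := pA (C *m x); rewrite trmx_mul !mulmxA.
Qed.

Lemma psd_diag (R : realType) n (d : 'rV[R]_n) :
  (forall i, 0 <= d 0 i) -> psdmx (diag_mx d).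
Proof.
move=> d0; split; first by rewrite tr_diag_mx.
move=> x; rewrite -mulmxA -[_ 0 0]/(dotv _ _) dotvE sumr_ge0// => i _.
by rewrite mul_diag_mx !mxE mulrCA mulr_ge0// -expr2 sqr_ge0.
Qed.

Lemma psd_diag_conj (R : realType) n (U : 'M[R]_n) (d : 'rV[R]_n) :
  (forall i, 0 <= d 0 i) -> psdmx (U *m diag_mx d *m U^T).
Proof. by move=> /psd_diag /(psd_conj U^T); rewrite trmxK. Qed.

(** The identity intertwines the two squares, and nonnegative eigenvalues with equal squares are
    equal, so it intertwines [A] and [B]. *)
Lemma psd_sqrt_unique (R : realType) n (A B : 'M[R]_n) :
  psdmx A -> psdmx B -> A *m A = B *m B -> A = B.
Proof.
move=> pA pB AB.
have [U [d [UU AE]]] := symmetric_spectral pA.1.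
have [V [e [VV BE]]] := symmetric_spectral pB.1.
have d0 := psd_eigen_ge0 pA UU AE; have e0 := psd_eigen_ge0 pB VV BE.
have := @diag_intertwine R n n U U^T V V^T (\row_i (d 0 i * d 0 i)) d
  (\row_i (e 0 i * e 0 i)) e 1%:M UU VV.
rewrite -(diag_conj_mul _ _ UU) -(diag_conj_mul _ _ VV) -AE -BE AB mulmx1 mul1mx.
rewrite mulmx1 mul1mx; apply => // i j; rewrite !mxE => /eqP.
by rewrite -!expr2 eqrXn2// => /eqP.
Qed.

Lemma sqrtmx_spec (R : realType) n (A : 'M[R]_n) :
  psdmx A -> psdmx (sqrtmx A) /\ sqrtmx A *m sqrtmx A = A.
Proof.
move=> pA.
have [U [d [UU AE]]] := symmetric_spectral pA.1.
have d0 := psd_eigen_ge0 pA UU AE.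
apply: (@xgetPex _ 0 [set B | psdmx B /\ B *m B = A]).
exists (U *m diag_mx (map_mx Num.sqrt d) *m U^T); split.
  by apply: psd_diag_conj => i; rewrite mxE sqrtr_ge0.
rewrite diag_conj_mul// [RHS]AE; congr (_ *m diag_mx _ *m _).
by apply/rowP => i; rewrite !mxE -expr2 sqr_sqrtr.
Qed.

Lemma sqrtmx_sqr (R : realType) n (A : 'M[R]_n) :
  psdmx A -> sqrtmx (A *m A) = A.
Proof.
move=> pA; have pAA : psdmx (A *m A).
  have := psd_conj A (psd_diag (fun i : 'I_n => _ : 0 <= (const_mx 1 : 'rV[R]_n) 0 i)).
  rewrite diag_const_mx pA.1 mulmx1; apply => i; by rewrite mxE.
have [p E] := sqrtmx_spec pAA.
exact: psd_sqrt_unique.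
Qed.

Lemma isqrtmx_spec (R : realType) n (A : 'M[R]_n) :
  psdmx A -> A \in unitmx ->
  [/\ (isqrtmx A)^T = isqrtmx A, isqrtmx A *m isqrtmx A = invmx A,
      isqrtmx A \in unitmx & isqrtmx A *m A *m isqrtmx A = 1%:M].
Proof.
move=> pA Au; have [[sS pS] SS] := sqrtmx_spec pA.
have Su : sqrtmx A \in unitmx.
  by move: Au; rewrite -{1}SS unitmx_mul => /andP[].
rewrite /isqrtmx; set S := sqrtmx A in sS pS SS Su *; split.
- by rewrite trmx_inv sS.
- by rewrite -[LHS]mulmx1 -(mulmxV Au) -{1}SS !mulmxA mulmxKV// mulVmx// mul1mx.
- by rewrite unitmx_inv.
- by rewrite -SS mulmxA mulVmx// mul1mx mulmxV.
Qed.

(** The partial sums of the series are conjugates of diagonal matrices of scalar partial sums. Any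
    inverse pair [U], [Ui] is allowed because the rate matrix is diagonalisable without being
    symmetric. *)
Lemma diag_conj_exp (R : realType) n (U Ui : 'M[R]_n) (d : 'rV[R]_n) :
  Ui *m U = 1%:M ->
  expmx (U *m diag_mx d *m Ui) = U *m diag_mx (map_mx expR d) *m Ui.
Proof.
move=> UU; have UU' := mulmx1C UU.
have pow k : (U *m diag_mx d *m Ui) ^+ k = U *m diag_mx (\row_i d 0 i ^+ k) *m Ui.
  elim: k => [|k IH].
    rewrite expr0 (_ : \row_i _ = const_mx 1) ?diag_conj1//.
    by apply/rowP => i; rewrite !mxE expr0.
  rewrite exprS IH -[LHS]/(_ *m _) diag_conj_mul//; congr (_ *m diag_mx _ *m _).
  by apply/rowP => i; rewrite !mxE exprS.
apply: (@mxcvg_lim R nat n n \oo _ (series (fun k => k`!%:R^-1 *: (U *m diag_mx d *m Ui) ^+ k))).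
have -> : series (fun k => k`!%:R^-1 *: (U *m diag_mx d *m Ui) ^+ k) =
    (fun k => U *m diag_mx (\row_i series (exp_coeff (d 0 i)) k) *m Ui).
  apply/funext => k; rewrite /series /=.
  under eq_bigr do rewrite pow scalemxAl scalemxAr.
  rewrite -mulmx_suml -mulmx_sumr; congr (_ *m _ *m _).
  apply/matrixP => i j; rewrite summxE !mxE -sumrMnl; apply: eq_bigr => l _.
  by rewrite !mxE /exp_coeff mulrnAr mulrC.
apply: mxcvgM; last exact: mxcvg_cst.
apply: mxcvgM; first exact: mxcvg_cst.
move=> i j; under eq_fun do rewrite !mxE; rewrite !mxE.
have [->|ij] := eqVneq i j; last by rewrite mulr0n; exact: cvg_cst.
rewrite mulr1n; exact: is_cvg_series_exp_coeff.
Qed.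

(** * Spectral and nuclear norms and their dual balls *)

Lemma eq_leW (R : realType) (a b : R) : a = b -> a <= b.
Proof. by move=> ->. Qed.

Lemma norm2E (R : realType) n (x : 'cV[R]_n) :
  norm2 x = Num.sqrt (dotv x x).
Proof.
by rewrite /norm2 dotvE; congr Num.sqrt; apply: eq_bigr => i _; rewrite expr2.
Qed.

Lemma norm2_sqr (R : realType) n (x : 'cV[R]_n) :
  norm2 x ^+ 2 = dotv x x.
Proof. by rewrite norm2E sqr_sqrtr// dotv_ge0. Qed.

Lemma norm2_ge0 (R : realType) n (x : 'cV[R]_n) : 0 <= norm2 x.
Proof. exact: sqrtr_ge0. Qed.

Lemma norm2_le1 (R : realType) n (x : 'cV[R]_n) :
  (norm2 x <= 1) = (dotv x x <= 1).
Proof.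
by rewrite -(@ler_pXn2r _ 2)// ?nnegrE ?norm2_ge0// norm2_sqr expr1n.
Qed.

Lemma dotv_le_norm2 (R : realType) n (x y : 'cV[R]_n) :
  dotv x y <= norm2 x * norm2 y.
Proof.
apply: (le_trans (ler_norm _)); rewrite -(@ler_pXn2r _ 2)// ?nnegrE//.
  by rewrite real_normK ?num_real// exprMn !norm2_sqr cauchy_schwarz.
by rewrite mulr_ge0 ?norm2_ge0.
Qed.

Lemma normalize_dotv (R : realType) n (v : 'cV[R]_n) :
  norm2 v != 0 ->
  dotv ((norm2 v)^-1 *: v) ((norm2 v)^-1 *: v) = 1 /\
  dotv ((norm2 v)^-1 *: v) v = norm2 v.
Proof.
by move=> v0; rewrite !dotvZl !dotvZr -norm2_sqr; split; field.
Qed.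

Definition entry_sum (R : realType) m n (A : 'M[R]_(m, n)) : R :=
  \sum_i \sum_j `|A i j|.

Lemma bilinear_le_entry_sum (R : realType) m n (A : 'M[R]_(m, n)) x y :
  dotv x x <= 1 -> dotv y y <= 1 -> dotv x (A *m y) <= entry_sum A.
Proof.
have coord k (z : 'cV[R]_k) i : dotv z z <= 1 -> `|z i 0| <= 1.
  move=> z1; rewrite -(@ler_pXn2r _ 2)// ?nnegrE// expr1n real_normK ?num_real//.
  apply: le_trans z1; rewrite dotvE (bigD1 i)//= expr2 lerDl sumr_ge0// => l _.
  by rewrite -expr2 sqr_ge0.
move=> x1 y1; rewrite dotvE; apply: ler_sum => i _.
rewrite mxE mulr_sumr; apply: ler_sum => j _.
apply: (le_trans (ler_norm _)); rewrite !normrM mulrCA.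
rewrite -[X in _ <= X]mulr1 ler_wpM2l// -[X in _ <= X]mulr1.
by apply: ler_pM => //; exact: coord.
Qed.

Lemma spectral_norm_le (R : realType) m n (A : 'M[R]_(m, n)) (c : R) :
  (forall x y, dotv x x <= 1 -> dotv y y <= 1 -> dotv x (A *m y) <= c) ->
  spectral_norm A <= c.
Proof.
move=> h; apply: ge_sup; first by exists (norm2 (A *m 0)), 0; rewrite //= norm2_le1 dotv0.
move=> _ [y /= + <-]; rewrite norm2_le1 => y1.
have [->|n0] := eqVneq (norm2 (A *m y)) 0.
  by have := h 0 0; rewrite mulmx0 !dotv0 !ler01; apply.
have np : 0 < norm2 (A *m y) by rewrite lt_neqAle eq_sym n0 norm2_ge0.
have [e1 e2] := normalize_dotv n0.
by have := h _ y (eq_leW e1) y1; rewrite e2.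
Qed.

Lemma spectral_norm_ge_norm2 (R : realType) m n (A : 'M[R]_(m, n)) y :
  dotv y y <= 1 -> norm2 (A *m y) <= spectral_norm A.
Proof.
move=> y1; apply: ub_le_sup; last by exists y; rewrite //= norm2_le1.
exists (entry_sum A) => _ [z /= + <-]; rewrite norm2_le1 => z1.
have [->|n0] := eqVneq (norm2 (A *m z)) 0.
  by apply: sumr_ge0 => i _; apply: sumr_ge0.
have [e1 e2] := normalize_dotv n0.
by have := bilinear_le_entry_sum A (eq_leW e1) z1; rewrite e2.
Qed.

Lemma spectral_norm_ge0 (R : realType) m n (A : 'M[R]_(m, n)) :
  0 <= spectral_norm A.
Proof.
have := @spectral_norm_ge_norm2 R m n A 0.
by rewrite dotv0 ler01 => /(_ isT); apply: le_trans; exact: norm2_ge0.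
Qed.

Lemma spectral_norm_norm2 (R : realType) m n (A : 'M[R]_(m, n)) y :
  norm2 (A *m y) <= spectral_norm A * norm2 y.
Proof.
have [y0|n0] := eqVneq (norm2 y) 0.
  have -> : y = 0 by apply: dotv_eq0; rewrite -norm2_sqr y0 expr0n.
  by rewrite mulmx0 !norm2E !dotv0 sqrtr0 mulr0.
have np : 0 < norm2 y by rewrite lt_neqAle eq_sym n0 norm2_ge0.
have [e1 _] := normalize_dotv n0.
have := spectral_norm_ge_norm2 A (eq_leW e1); rewrite -scalemxAr [X in X <= _]norm2E dotvZl dotvZr mulrA -expr2.
rewrite sqrtrM ?sqr_ge0// sqrtr_sqr ger0_norm ?invr_ge0 ?norm2_ge0// -norm2E.
by rewrite ler_pdivrMl// mulrC.
Qed.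

Lemma spectral_norm_bilinear (R : realType) m n (A : 'M[R]_(m, n)) x y :
  dotv x (A *m y) <= spectral_norm A * (norm2 x * norm2 y).
Proof.
apply: (le_trans (dotv_le_norm2 _ _)).
by rewrite mulrCA ler_wpM2l ?norm2_ge0 ?spectral_norm_norm2.
Qed.

Lemma spectral_norm_lipschitz (R : realType) m n (A B : 'M[R]_(m, n)) :
  spectral_norm A - spectral_norm B <= entry_sum (A - B).
Proof.
rewrite lerBlDl; apply: spectral_norm_le => x y x1 y1.
rewrite -[A in dotv x (A *m y)](subrK B) addrC mulmxDl dotvDr lerD//.
  apply: (le_trans (spectral_norm_bilinear _ _ _)).
  rewrite -[X in _ <= X]mulr1 ler_wpM2l ?spectral_norm_ge0//.
  rewrite -[X in _ <= X]mulr1 ler_pM ?norm2_ge0// ?norm2_le1//.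
exact: bilinear_le_entry_sum.
Qed.

Lemma nuclear_norm_psd (R : realType) n (A : 'M[R]_n) :
  psdmx A -> nuclear_norm A = \tr A.
Proof. by move=> pA; rewrite /nuclear_norm pA.1 sqrtmx_sqr. Qed.

Lemma psd_cvg (R : realType) (T : Type) n (F : set_system T)
    (FF : ProperFilter F) (A : T -> 'M[R]_n) (A0 : 'M[R]_n) :
  (\forall g \near F, psdmx (A g)) -> mxcvg F A A0 -> psdmx A0.
Proof.
move=> pA cA; split.
  apply/matrixP => i j; rewrite mxE.
  have c2 : A g i j @[g --> F] --> A0 j i.
    by apply: (cvg_near _ _ (cA j i)); apply: filterS pA => g [sA _]; rewrite -{1}sA mxE.
  exact: (@cvg_unique _ (@Rhausdorff R) _ _ _ _ c2 (cA i j)).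
move=> x.
have c : (x^T *m A g *m x) 0 0 @[g --> F] --> (x^T *m A0 *m x) 0 0.
  have := mxcvgM _ (mxcvgM _ (mxcvg_cst _ x^T) cA) (mxcvg_cst _ x).
  by apply.
apply: (cvgr_to_ge c); by apply: filterS pA => g [_]; apply.
Qed.

(** On positive semidefinite matrices the nuclear norm is the trace, so continuity of the matrix
    square root is avoided; the spectral norm is Lipschitz with respect to [entry_sum]. *)
Lemma mxnorm_cvg (R : realType) (T : Type) n (F : set_system T)
    (FF : ProperFilter F) (b : norm_index) (A : T -> 'M[R]_n) (A0 : 'M[R]_n) :
  (\forall g \near F, psdmx (A g)) -> mxcvg F A A0 ->
  mxnorm b (A g) @[g --> F] --> mxnorm b A0.
Proof.
move=> pA cA; have pA0 := psd_cvg FF pA cA; case: b => /=; last first.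
  rewrite nuclear_norm_psd//; apply: (cvg_near _ _ (mxcvg_tr _ cA)).
  by apply: filterS pA => g pg; rewrite nuclear_norm_psd.
have c0 : entry_sum (A0 - A g) @[g --> F] --> (0 : R).
  have -> : (0 : R) = entry_sum (A0 - A0).
    by rewrite subrr /entry_sum big1// => i _; rewrite big1// => j _; rewrite mxE normr0.
  apply: cvg_bigsum => i _; apply: cvg_bigsum => j _; apply: cvg_norm.
  exact: (@mxcvgB R T n n F FF (fun _ => A0) A A0 A0 (@mxcvg_cst R T n n F FF A0) cA i j).
apply/cvgrPdist_le => e e0; have /cvgr0Pnorm_le /(_ e e0) := c0.
apply: filterS => g /=.
have E : entry_sum (A g - A0) = entry_sum (A0 - A g).
  apply: eq_bigr => i _; apply: eq_bigr => j _.
  by rewrite !mxE distrC.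
move=> /(le_trans (ler_norm _)) le; rewrite ler_norml; apply/andP; split.
  by rewrite lerNl opprB -E in le *; apply: le_trans (spectral_norm_lipschitz _ _) le.
exact: le_trans (spectral_norm_lipschitz _ _) le.
Qed.

Definition contractive (R : realType) m n (A : 'M[R]_(m, n)) : Prop :=
  forall x, dotv (A *m x) (A *m x) <= dotv x x.

(** For y = A^T x one has |y|^2 = (x, A y) <= |x| |y|. *)
Lemma contractive_tr (R : realType) m n (A : 'M[R]_(m, n)) :
  contractive A -> contractive A^T.
Proof.
move=> cA x; set y := A^T *m x.
have yE : dotv y y = dotv x (A *m y) by rewrite dotv_mulmx.
have [->|y0] := eqVneq y 0; first by rewrite dotv0 dotv_ge0.
have yp := dotv_gt0 y0.
rewrite -(ler_pM2r yp) -expr2 {1}yE.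
apply: (le_trans (cauchy_schwarz _ _)).
by rewrite ler_wpM2l ?dotv_ge0.
Qed.

Lemma contractive_mul (R : realType) m n p (A : 'M[R]_(m, n))
    (B : 'M[R]_(n, p)) :
  contractive A -> contractive B -> contractive (A *m B).
Proof. by move=> cA cB x; rewrite -mulmxA (le_trans (cA _)). Qed.

Lemma contractive_isometry (R : realType) m n (A : 'M[R]_(m, n)) :
  A^T *m A = 1%:M -> contractive A.
Proof. by move=> AA x; rewrite dotv_mulmx mulmxA AA mul1mx. Qed.

(* The unit ball of the norm dual to mxnorm b (its extreme points suffice for
   b = Spectral). *)
Definition dual_ball (b : norm_index) (R : realType) m n
    (W : 'M[R]_(m, n)) : Prop :=
  match b with
  | Spectral => exists x y, [/\ dotv x x <= 1, dotv y y <= 1 & W = x *m y^T]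
  | Nuclear => contractive W
  end.

Lemma dual_ball_mul (b : norm_index) (R : realType) m n p q
    (A : 'M[R]_(p, m)) (B : 'M[R]_(n, q)) (W : 'M[R]_(m, n)) :
  contractive A -> contractive B -> dual_ball b W -> dual_ball b (A *m W *m B).
Proof.
move=> cA cB; case: b => /= [[x [y [x1 y1 ->]]]|cW].
  exists (A *m x), (B^T *m y); split.
  - exact: le_trans (cA _) x1.
  - exact: le_trans (contractive_tr cB _) y1.
  - by rewrite trmx_mul trmxK !mulmxA.
by apply: contractive_mul => //; exact: contractive_mul.
Qed.

Lemma mxtrace_rank1 (R : realType) m n (x : 'cV[R]_m) (y : 'cV[R]_n)
    (D : 'M[R]_(m, n)) : \tr ((x *m y^T)^T *m D) = dotv x (D *m y).
Proof.
by rewrite trmx_mul trmxK -mulmxA mxtrace_mulC -mulmxA [_ *m _]mx11_scalar mxtrace_scalar.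
Qed.

(** For the nuclear norm the extremal [W] is the sign of [D], defined through the eigenvalues
    because [D] is symmetric. *)
Lemma mxnorm_le (b : norm_index) (R : realType) n (D : 'M[R]_n) (c : R) :
  D^T = D -> (forall W : 'M[R]_n, dual_ball b W -> \tr (W^T *m D) <= c) ->
  mxnorm b D <= c.
Proof.
move=> sD; case: b => /= h.
  apply: spectral_norm_le => x y x1 y1.
  by rewrite -mxtrace_rank1; apply: h; exists x, y.
have [U [d [UU DE]]] := symmetric_spectral sD.
pose S := U *m diag_mx (map_mx Num.sg d) *m U^T.
pose B := U *m diag_mx (map_mx Num.norm d) *m U^T.
have pB : psdmx B by apply: psd_diag_conj => i; rewrite mxE.
have DD : D^T *m D = B *m B.
  rewrite sD DE /B !diag_conj_mul//; congr (_ *m diag_mx _ *m _).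
  by apply/rowP => i; rewrite !mxE -!expr2 real_normK ?num_real.
have SD : S^T *m D = B.
  rewrite /S !trmx_mul trmxK tr_diag_mx mulmxA DE diag_conj_mul//.
  by congr (_ *m diag_mx _ *m _); apply/rowP => i; rewrite !mxE -normrEsg.
rewrite /nuclear_norm DD sqrtmx_sqr// -SD; apply: h.
move=> x; rewrite /S -!mulmxA.
apply: (le_trans (contractive_isometry UU _)).
have : contractive U^T by apply: contractive_tr; exact: contractive_isometry.
move=> /(_ x); apply: le_trans; set z := U^T *m x.
rewrite !dotvE; apply: ler_sum => i _; rewrite mul_diag_mx !mxE.
rewrite mulrACA -!expr2 [X in X <= _]mulrC -[X in _ <= X]mulr1 ler_wpM2l ?sqr_ge0//.
by rewrite sqr_sg; case: (_ != 0).
Qed.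

Lemma mxnorm_conj (b : norm_index) (R : realType) m n (O : 'M[R]_(n, m))
    (A : 'M[R]_m) : O^T *m O = 1%:M -> psdmx A ->
  mxnorm b (O *m A *m O^T) = mxnorm b A.
Proof.
move=> OO pA; have iO := contractive_isometry OO; case: b => /=; last first.
  have pOA := psd_conj O^T pA; rewrite trmxK in pOA.
  by rewrite !nuclear_norm_psd// mxtrace_mulC mulmxA OO mul1mx.
apply/eqP; rewrite eq_le; apply/andP; split; apply: spectral_norm_le => x y x1 y1.
  rewrite -!mulmxA dotv_mulmx.
  apply: (le_trans (spectral_norm_bilinear _ _ _)).
  rewrite -[X in _ <= X]mulr1 ler_wpM2l ?spectral_norm_ge0//.
  by rewrite -[X in _ <= X]mulr1 ler_pM ?norm2_ge0// norm2_le1;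
    apply: le_trans (contractive_tr iO _) _.
have -> : dotv x (A *m y) = dotv (O *m x) (O *m A *m O^T *m (O *m y)).
  by rewrite [RHS]dotvC [RHS]dotv_mulmx -!mulmxA !(mulmxA O^T O) OO !mul1mx dotvC.
apply: (le_trans (spectral_norm_bilinear _ _ _)).
rewrite -[X in _ <= X]mulr1 ler_wpM2l ?spectral_norm_ge0//.
by rewrite -[X in _ <= X]mulr1 ler_pM ?norm2_ge0// norm2_le1; apply: le_trans (iO _) _.
Qed.

(** In the spectral case [W] has rank one and is absorbed into the test vectors, which gives weights
    proportional to x_i^2 and y_j^2. In the nuclear case E = F F turns the entries into inner
    products of the columns of F U and F V. For each coordinate [l] the contraction [W] acts on a
    pair of vectors, and the squared column norms serve as weights, each family summing to tr E. *)
Lemma dominated_schur (b : norm_index) (R : realType) k m n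
    (E : 'M[R]_k) (U : 'M[R]_(k, m)) (V : 'M[R]_(k, n)) (W : 'M[R]_(m, n)) :
  psdmx E -> U^T *m U = 1%:M -> V^T *m V = 1%:M ->
  U *m U^T = 1%:M -> V *m V^T = 1%:M -> dual_ball b W ->
  dominated (fun i j => W i j * (U^T *m E *m V) i j) (mxnorm b E).
Proof.
move=> pE UU VV UU' VV'; case: b => /= [[x [y [x1 y1 ->]]]|cW].
  have s0 := spectral_norm_ge0 E.
  exists (fun i => spectral_norm E * x i 0 ^+ 2), (fun j => spectral_norm E * y j 0 ^+ 2).
  split.
  - by move=> i; rewrite mulr_ge0 ?sqr_ge0.
  - by move=> i; rewrite mulr_ge0 ?sqr_ge0.
  - rewrite -mulr_sumr -[X in _ <= X]mulr1 ler_wpM2l//.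
    by apply: le_trans x1; rewrite dotvE; apply: ler_sum => i _; rewrite expr2.
  - rewrite -mulr_sumr -[X in _ <= X]mulr1 ler_wpM2l//.
    by apply: le_trans y1; rewrite dotvE; apply: ler_sum => i _; rewrite expr2.
  move=> u v.
  pose xu : 'cV[R]_m := \col_i (x i 0 * u i); pose yv : 'cV[R]_n := \col_j (y j 0 * v j).
  have -> : \sum_i \sum_j (x *m y^T) i j * (U^T *m E *m V) i j * u i * v j =
     dotv (U *m xu) (E *m (V *m yv)).
    rewrite [RHS]dotvC dotv_mulmx dotvC !mulmxA dotvE; apply: eq_bigr => i _.
    rewrite [X in _ = _ * X]mxE mulr_sumr; apply: eq_bigr => j _.
    move: (U^T *m E *m V) => M; rewrite [(x *m y^T) i j]mxE big_ord1 !mxE; ring.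
  apply: (le_trans (spectral_norm_bilinear _ _ _)).
  have nU : dotv (U *m xu) (U *m xu) = \sum_i (x i 0 ^+ 2 * u i ^+ 2).
    rewrite dotv_mulmx mulmxA UU mul1mx dotvE; apply: eq_bigr => i _.
    by rewrite !mxE; ring.
  have nV : dotv (V *m yv) (V *m yv) = \sum_j (y j 0 ^+ 2 * v j ^+ 2).
    rewrite dotv_mulmx mulmxA VV mul1mx dotvE; apply: eq_bigr => i _.
    by rewrite !mxE; ring.
  under [X in _ <= (X + _) / 2]eq_bigr do rewrite -mulrA.
  under [X in _ <= (_ + X) / 2]eq_bigr do rewrite -mulrA.
  rewrite -!mulr_sumr -mulrDr -mulrA ler_wpM2l// -nU -nV -!norm2_sqr.
  by have := sqr_ge0 (norm2 (U *m xu) - norm2 (V *m yv)); lra.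
have [[sF pF] FF] := sqrtmx_spec pE; set F := sqrtmx E in sF pF FF.
pose f := F *m U; pose g := F *m V.
have fg : U^T *m E *m V = f^T *m g.
  by rewrite /f /g trmx_mul sF -FF !mulmxA.
have nf (p : nat) (Z : 'M[R]_(k, p)) : Z *m Z^T = 1%:M ->
    \sum_i \sum_l (F *m Z) l i ^+ 2 <= nuclear_norm E.
  move=> ZZ; rewrite nuclear_norm_psd//.
  have -> : \tr E = \tr ((F *m Z)^T *m (F *m Z)).
    by rewrite mxtrace_mulC trmx_mul !mulmxA -(mulmxA F Z) ZZ mulmx1 sF FF.
  rewrite /mxtrace; apply: ler_sum => i _; rewrite [X in _ <= X]mxE.
  by apply: ler_sum => l _; rewrite [X in _ <= X * _]mxE expr2.
exists (fun i => \sum_l f l i ^+ 2), (fun j => \sum_l g l j ^+ 2); split.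
- by move=> i; apply: sumr_ge0 => l _; exact: sqr_ge0.
- by move=> i; apply: sumr_ge0 => l _; exact: sqr_ge0.
- exact: nf.
- exact: nf.
move=> u v.
pose fu l : 'cV[R]_m := \col_i (f l i * u i); pose gv l : 'cV[R]_n := \col_j (g l j * v j).
have -> : \sum_i \sum_j W i j * (U^T *m E *m V) i j * u i * v j =
   \sum_l dotv (fu l) (W *m gv l).
  under [RHS]eq_bigr do rewrite dotvE.
  rewrite [RHS]exchange_big; apply: eq_bigr => i _.
  under [RHS]eq_bigr do rewrite [(W *m _) _ _]mxE mulr_sumr.
  rewrite [RHS]exchange_big; apply: eq_bigr => j _.
  rewrite fg mxE mulr_sumr !mulr_suml; apply: eq_bigr => l _.
  by rewrite !mxE; ring.
have -> : (\sum_i (\sum_l f l i ^+ 2) * u i ^+ 2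
   + \sum_j (\sum_l g l j ^+ 2) * v j ^+ 2) / 2 =
  \sum_l (dotv (fu l) (fu l) + dotv (gv l) (gv l)) / 2.
  rewrite -mulr_suml big_split /=; congr ((_ + _) / 2).
    under eq_bigr do rewrite mulr_suml.
    rewrite exchange_big; apply: eq_bigr => l _; rewrite dotvE; apply: eq_bigr => i _.
    by rewrite !mxE; ring.
  under eq_bigr do rewrite mulr_suml.
  rewrite exchange_big; apply: eq_bigr => l _; rewrite dotvE; apply: eq_bigr => i _.
  by rewrite !mxE; ring.
apply: ler_sum => l _.
apply: (@le_trans _ _ ((dotv (fu l) (fu l) + dotv (W *m gv l) (W *m gv l)) / 2)).
  have := dotv_ge0 (fu l - W *m gv l).
  by rewrite dotvDl !dotvDr !dotvNl !dotvNr (dotvC (W *m gv l) (fu l)); lra.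
by rewrite ler_wpM2r// lerD2l.
Qed.

(** * The two error bounds for positive definite L *)

Lemma eq_dominated (R : realType) m n (M N : 'I_m -> 'I_n -> R) (c : R) :
  (forall i j, M i j = N i j) -> dominated M c -> dominated N c.
Proof. by move=> MN; have -> // : N = M by apply/funext => i; apply/funext => j. Qed.

Lemma dominated_scalar (R : realType) m n (M : 'I_m -> 'I_n -> R) (c k : R) :
  0 <= k -> dominated M c -> dominated (fun i j => k * M i j) (k * c).
Proof.
move=> k0 [r [s [r0 s0 rc sc dom]]].
exists (fun i => k * r i), (fun j => k * s j); split.
- by move=> i; rewrite mulr_ge0.
- by move=> j; rewrite mulr_ge0.
- by rewrite -mulr_sumr ler_wpM2l.
- by rewrite -mulr_sumr ler_wpM2l.
move=> u v; have := ler_wpM2l k0 (dom u v).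
rewrite mulr_sumr mulrA mulrDr !mulr_sumr.
under eq_bigr do rewrite mulr_sumr.
under eq_bigr do under eq_bigr do rewrite !mulrA.
move=> /le_trans; apply; rewrite le_eqVlt; apply/orP; left; apply/eqP.
by congr ((_ + _) / 2); apply: eq_bigr => i _; rewrite mulrA.
Qed.

Lemma dominated_rank1 (R : realType) m n (M : 'I_m -> 'I_n -> R) (c q : R)
    (a : 'I_m -> R) (b : 'I_n -> R) :
  (forall i, a i ^+ 2 <= q) -> (forall j, b j ^+ 2 <= q) -> 0 <= q ->
  dominated M c -> dominated (fun i j => M i j * (a i * b j)) (q * c).
Proof.
move=> aq bq q0 [r [s [r0 s0 rc sc dom]]].
exists (fun i => r i * a i ^+ 2), (fun j => s j * b j ^+ 2); split.
- by move=> i; rewrite mulr_ge0 ?sqr_ge0.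
- by move=> i; rewrite mulr_ge0 ?sqr_ge0.
- apply: (@le_trans _ _ (q * \sum_i r i)); last by rewrite ler_wpM2l.
  by rewrite mulr_sumr; apply: ler_sum => i _; rewrite mulrC ler_wpM2r.
- apply: (@le_trans _ _ (q * \sum_i s i)); last by rewrite ler_wpM2l.
  by rewrite mulr_sumr; apply: ler_sum => i _; rewrite mulrC ler_wpM2r.
move=> u v; have := dom (fun i => a i * u i) (fun j => b j * v j).
have -> : \sum_i \sum_j M i j * (a i * u i) * (b j * v j) =
  \sum_i \sum_j M i j * (a i * b j) * u i * v j.
  by apply: eq_bigr => i _; apply: eq_bigr => j _; ring.
move=> /le_trans; apply; rewrite le_eqVlt; apply/orP; left; apply/eqP.
by congr ((_ + _) / 2); apply: eq_bigr => i _; ring.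
Qed.

Lemma mxtrace_pairing (R : realType) m n (W D : 'M[R]_(m, n)) :
  \tr (W^T *m D) = \sum_i \sum_j W i j * D i j.
Proof.
rewrite exchange_big; apply: eq_bigr => j _; rewrite mxE.
by apply: eq_bigr => i _; rewrite mxE.
Qed.

Definition pdmx (R : realType) n (A : 'M[R]_n) : Prop :=
  psdmx A /\ A \in unitmx.

Lemma pd_spectral (R : realType) n (A : 'M[R]_n) : pdmx A ->
  exists (U : 'M[R]_n) (d : 'rV[R]_n),
    [/\ U^T *m U = 1%:M, A = U *m diag_mx d *m U^T & forall i, 0 < d 0 i].
Proof.
move=> [pA Au]; have [U [d [UU AE]]] := symmetric_spectral pA.1.
exists U, d; split => // i; rewrite lt_neqAle (psd_eigen_ge0 pA UU AE) andbT.
apply/eqP => d0; move: Au; rewrite AE !unitmx_mul => /andP[/andP[_]].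
by rewrite unitmxE det_diag unitfE (bigD1 i)//= -d0 mul0r eqxx.
Qed.

Lemma diag_conj_inv (R : realType) n (U : 'M[R]_n) (d : 'rV[R]_n) :
  U^T *m U = 1%:M -> (forall i, d 0 i != 0) ->
  invmx (U *m diag_mx d *m U^T) = U *m diag_mx (map_mx GRing.inv d) *m U^T.
Proof.
move=> UU d0; set A := _ *m U^T; set B := _ *m U^T.
have AB : A *m B = 1%:M.
  rewrite /A /B diag_conj_mul// (_ : \row_i _ = const_mx 1) ?diag_conj1//.
  by apply/rowP => i; rewrite !mxE mulfV.
have [Au _] := mulmx1_unit AB.
by rewrite -[LHS]mulmx1 -AB mulKmx.
Qed.

Lemma diag_conj_expN (R : realType) n (U : 'M[R]_n) (d : 'rV[R]_n) (t : R) :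
  U^T *m U = 1%:M ->
  expmx (- (t *: (U *m diag_mx d *m U^T))) =
  U *m diag_mx (\row_i expR (- (t * d 0 i))) *m U^T.
Proof.
move=> UU; have -> : - (t *: (U *m diag_mx d *m U^T)) =
    U *m diag_mx (\row_i - (t * d 0 i)) *m U^T.
  have -> : diag_mx (\row_i - (t * d 0 i)) = (- t) *: diag_mx d.
    by apply/matrixP => i j; rewrite !mxE mulNr mulrnAr -mulNrn.
  by rewrite -scalemxAr -scalemxAl scaleNr.
rewrite diag_conj_exp//; congr (_ *m diag_mx _ *m _).
by apply/rowP => i; rewrite !mxE.
Qed.

(** Since K' L K' = K', the residual E = L^-1 - K' satisfies E = E L E. *)
Lemma compression_psd (R : realType) m n (L : 'M[R]_n) (V : 'M[R]_(n, m)) :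
  pdmx L -> V^T *m L *m V \in unitmx ->
  psdmx (invmx L - V *m invmx (V^T *m L *m V) *m V^T).
Proof.
move=> [pL Lu] Au; set A := V^T *m L *m V; set K' := _ *m V^T.
have sA : A^T = A by rewrite /A !trmx_mul trmxK pL.1 mulmxA.
have sE : (invmx L - K')^T = invmx L - K'.
  by rewrite linearB /= trmx_inv pL.1 /K' !trmx_mul trmxK trmx_inv sA mulmxA.
have KLK : K' *m L *m K' = K'.
  rewrite /K' !mulmxA -(mulmxA _ V^T L) -(mulmxA _ (V^T *m L) V) -/A.
  by rewrite -(mulmxA _ A) mulmxV// mulmx1.
suff -> : invmx L - K' = (invmx L - K')^T *m L *m (invmx L - K') by exact: psd_conj.
rewrite sE mulmxBl mulVmx// mulmxBl mul1mx mulmxBr KLK mulmxK//.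
by rewrite subrr subr0.
Qed.

(** The compressed semigroup, extended by zero off the range of [V], equals g(K') for g(x) = e^(-t /
    x) with g(0) = 0, while e^(-tL) = g(L^-1). Both terms are thus the same function of two
    symmetric matrices whose difference is the residual. *)
Theorem compression_error (b : norm_index) (R : realType) m n (L : 'M[R]_n)
    (V : 'M[R]_(n, m)) (W : 'M[R]_n) (t : R) :
  pdmx L -> V^T *m V = 1%:M -> pdmx (V^T *m L *m V) -> 0 < t -> dual_ball b W ->
  \tr (W^T *m (expmx (- (t *: L)) -
               V *m expmx (- (t *: (V^T *m L *m V))) *m V^T)) <=
  35 / 48 * (t^-1 * mxnorm b (invmx L - V *m invmx (V^T *m L *m V) *m V^T)).
Proof.
move=> pL VV pA t0 bW.
have := compression_psd pL pA.2.
have [U [d [UU LE d0]]] := pd_spectral pL.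
have [U1 [mu [UU1 AE mu0]]] := pd_spectral pA.
set A := V^T *m L *m V in pA AE *; set K' := V *m invmx A *m V^T.
set E := invmx L - K' => pE.
have UU' := mulmx1C UU; have UU1' := mulmx1C UU1.
have sK' : K'^T = K' by rewrite /K' !trmx_mul trmxK trmx_inv pA.1.1 mulmxA.
have AiE : invmx A = U1 *m diag_mx (map_mx GRing.inv mu) *m U1^T.
  by rewrite AE diag_conj_inv// => i; rewrite gt_eqF.
have pK' : psdmx K'.
  have := psd_conj V^T (psd_diag_conj U1 (d := map_mx GRing.inv mu) _).
  rewrite trmxK -AiE; apply => i; by rewrite mxE invr_ge0 ltW.
have [Z [k [ZZ KE]]] := symmetric_spectral sK'.
have ZZ' := mulmx1C ZZ.
have k0 := psd_eigen_ge0 pK' ZZ KE.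
pose g (x : R) : R := hexp 1 0 (x / t).
have gV (x : R) : 0 < x -> g x^-1 = expR (- (t * x)).
  move=> x0; rewrite /g hexpE ?divr_gt0 ?invr_gt0//.
  by rewrite expr0 mul1r invfM !invrK mulN1r mulrC.
pose gK := Z *m diag_mx (map_mx g k) *m Z^T.
have eA : expmx (- (t *: A)) = U1 *m diag_mx (map_mx g (map_mx GRing.inv mu)) *m U1^T.
  rewrite AE diag_conj_expN//; congr (_ *m diag_mx _ *m _).
  by apply/rowP => i; rewrite !mxE gV.
have eL : expmx (- (t *: L)) = U *m diag_mx (map_mx g (map_mx GRing.inv d)) *m U^T.
  rewrite LE diag_conj_expN//; congr (_ *m diag_mx _ *m _).
  by apply/rowP => i; rewrite !mxE gV.
have gKV : gK *m V = V *m expmx (- (t *: A)).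
  rewrite eA; apply: (@diag_intertwine _ _ _ Z Z^T U1 U1^T k _ (map_mx GRing.inv mu)) => //.
    by rewrite -KE -AiE /K' -!mulmxA VV mulmx1.
  by move=> i j; rewrite !mxE => ->.
(* K' annihilates the complement of the range of [V]; because [g] vanishes at 0, so does g(K'). *)
have gKW : gK *m (1%:M - V *m V^T) = 0.
  transitivity ((1%:M - V *m V^T) *m (1%:M *m diag_mx 0 *m (1%:M)^T : 'M[R]_n)).
    apply: (@diag_intertwine _ _ _ Z Z^T 1%:M (1%:M)^T k _ 0) => //.
    - by rewrite trmx1 mul1mx.
    - rewrite -KE (_ : diag_mx 0 = 0) ?mulmx0 ?mul0mx ?mulmx0; last by apply/matrixP => i j; rewrite !mxE mul0rn.
      by rewrite mulmxBr mulmx1 /K' -!mulmxA (mulmxA V^T) VV mul1mx subrr.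
    - by move=> i j; rewrite !mxE => ->; rewrite /g mul0r hexp_le0.
  rewrite (_ : diag_mx 0 = 0) ?mulmx0 ?mul0mx ?mulmx0//.
  by apply/matrixP => i j; rewrite !mxE mul0rn.
have gKE : V *m expmx (- (t *: A)) *m V^T = gK.
  rewrite -gKV -mulmxA; move/eqP: gKW; rewrite mulmxBr mulmx1 subr_eq0 => /eqP.
  by move=> <-.
pose W' := U^T *m W *m Z.
have cUt : contractive U^T by apply: contractive_tr; exact: contractive_isometry.
have bW' : dual_ball b W'.
  by apply: dual_ball_mul => //; exact: contractive_isometry.
have dom := dominated_schur pE UU ZZ UU' ZZ' bW'.
pose Y := U^T *m Z.
have conjE (d1 e1 : 'rV[R]_n) i j :
    (U^T *m (U *m diag_mx d1 *m U^T - Z *m diag_mx e1 *m Z^T) *m Z) i j =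
    (d1 0 i - e1 0 j) * Y i j.
  rewrite mulmxBr mulmxBl !mulmxA UU mul1mx -[_ *m U^T *m Z]mulmxA.
  rewrite -(mulmxA _ Z^T) ZZ mulmx1 -/Y; move: Y => Y'.
  by rewrite mul_diag_mx mul_mx_diag !mxE; ring.
rewrite gKE eL.
have -> : \tr (W^T *m (U *m diag_mx (map_mx g (map_mx GRing.inv d)) *m U^T - gK)) =
   \sum_i \sum_j (W' i j * Y i j) * (hexp 1 0 ((d 0 i)^-1 / t) - hexp 1 0 (k 0 j / t)).
  set D := _ - gK.
  have -> : W^T *m D = Z *m (W'^T *m (U^T *m D *m Z)) *m Z^T.
    rewrite /W' !trmx_mul trmxK !mulmxA ZZ' mul1mx -(mulmxA _ U) UU' mulmx1.
    by rewrite -(mulmxA _ Z) ZZ' mulmx1.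
  rewrite mxtrace_mulC (mulmxA Z^T Z) ZZ mul1mx mxtrace_pairing.
  apply: eq_bigr => i _; apply: eq_bigr => j _.
  by rewrite conjE; move: (W' i j) (Y i j) => w y; rewrite !mxE /g; ring.
apply: (@dominated_exp_inv _ _ _ (fun i j => W' i j * Y i j) _ (fun i => (d 0 i)^-1 / t)
   (fun j => k 0 j / t)).
- apply: eq_dominated (dominated_scalar (_ : 0 <= t^-1) dom).
  + move=> i j; rewrite /E {1}LE diag_conj_inv; last by move=> l; rewrite gt_eqF.
      by rewrite KE conjE; move: (W' i j) (Y i j) => w y; rewrite !mxE; ring.
    by [].
  + by rewrite invr_ge0 ltW.
- by move=> i; rewrite divr_ge0 ?invr_ge0 ?ltW.
- by move=> j; rewrite divr_ge0// ltW.
Qed.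

(** The range of [C] lies in that of [V], so the two compressions are compared through the square
    matrix [Y] of C^T V in the eigenbases of both compressed operators. The matrix O = lambda^(-1/2)
    Y mu^(1/2) is orthogonal, and Psi read between the bases [U] and [U O] has entries containing
    the differences 1 / lambda_i - 1 / mu_j. *)
Theorem oblique_error (b : norm_index) (R : realType) m n (L : 'M[R]_n)
    (V C : 'M[R]_(n, m)) (W : 'M[R]_n) (t : R) :
  pdmx L -> V^T *m V = 1%:M -> pdmx (V^T *m L *m V) -> pdmx (C^T *m L *m C) ->
  V *m V^T *m C = C -> contractive C ->
  C *m invmx (C^T *m L *m C) *m C^T = V *m invmx (V^T *m L *m V) *m V^T ->
  0 < t -> dual_ball b W ->
  forall S, S = isqrtmx (C^T *m L *m C) ->
  \tr (W^T *m (sp_compression L C t -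
               V *m expmx (- (t *: (V^T *m L *m V))) *m V^T)) <=
  47 / 20 * (4^-1 * mxnorm b (S *m (1%:M - C^T *m C) *m S)) / t.
Proof.
move=> pL VV pA pH VVC cC CHC t0 bW S SE0.
have [U [la [UU HE la0]]] := pd_spectral pH.
have [U1 [mu [UU1 AE mu0]]] := pd_spectral pA.
rewrite /sp_compression.
have [A AA] : exists A, A = V^T *m L *m V by eexists.
rewrite -AA in pA AE CHC *.
have [H HH] : exists H, H = C^T *m L *m C by eexists.
rewrite -HH in pH HE CHC SE0 *.
have UU' := mulmx1C UU; have UU1' := mulmx1C UU1.
have CVV : C^T *m V *m V^T = C^T.
  by rewrite -{2}VVC !trmx_mul trmxK mulmxA.
have [Y YE] : exists Y, Y = U^T *m (C^T *m V) *m U1 by eexists.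
have CV : C^T *m V = U *m Y *m U1^T.
  by rewrite YE !mulmxA UU' mul1mx -mulmxA UU1' mulmx1.
have CLV : C^T *m L *m V = C^T *m V *m A.
  by rewrite -{1}CVV AA !mulmxA.
(* From V V^T C = C: the operator C^T L C equals (C^T V) A (C^T V)^T. *)
have YmuY : Y *m diag_mx mu *m Y^T = diag_mx la.
  have : C^T *m V *m A *m (C^T *m V)^T = H.
    by rewrite -CLV trmx_mul trmxK -(mulmxA _ V) (mulmxA V) VVC HH.
  rewrite CV AE HE !trmx_mul trmxK !mulmxA => /(congr1 (fun M => U^T *m M *m U)).
  by rewrite !mulmxA UU !mul1mx -!(mulmxA _ U1^T U1) UU1 !mulmx1 -!(mulmxA _ U^T U) UU !mulmx1.
pose D : 'M[R]_m := diag_mx (\row_i (Num.sqrt (la 0 i))^-1).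
pose Dm : 'M[R]_m := diag_mx (\row_i Num.sqrt (mu 0 i)).
have sla i : Num.sqrt (la 0 i) != 0 by rewrite gt_eqF// sqrtr_gt0.
have smu i : Num.sqrt (mu 0 i) != 0 by rewrite gt_eqF// sqrtr_gt0.
have lan0 i : la 0 i != 0 by rewrite gt_eqF.
have mun0 i : mu 0 i != 0 by rewrite gt_eqF.
have sqla i : Num.sqrt (la 0 i) ^+ 2 = la 0 i by rewrite sqr_sqrtr// ltW.
have sqmu i : Num.sqrt (mu 0 i) ^+ 2 = mu 0 i by rewrite sqr_sqrtr// ltW.
have SE : S = U *m D *m U^T.
  have sq : sqrtmx H = U *m diag_mx (map_mx Num.sqrt la) *m U^T.
    have [pS SS] := sqrtmx_spec pH.1.
    apply: psd_sqrt_unique => //.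
      by apply: psd_diag_conj => i; rewrite mxE sqrtr_ge0.
    rewrite SS HE diag_conj_mul//; congr (_ *m diag_mx _ *m _).
    by apply/rowP => i; rewrite !mxE -expr2 sqla.
  rewrite SE0 /isqrtmx sq diag_conj_inv//; last by move=> i; rewrite mxE.
  by congr (_ *m diag_mx _ *m _); apply/rowP => i; rewrite !mxE.
pose O := D *m Y *m Dm.
have DmDm : Dm *m Dm = diag_mx mu.
  by rewrite /Dm mulmx_diag; congr diag_mx; apply/rowP => i; rewrite !mxE -expr2 sqmu.
have DlaD : D *m diag_mx la *m D = 1%:M.
  rewrite /D !mulmx_diag -diag_const_mx; congr diag_mx; apply/rowP => i; rewrite !mxE.
  by rewrite -[X in _ * X * _]sqla; field; rewrite sla.
have OO' : O *m O^T = 1%:M.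
  rewrite /O !trmx_mul !tr_diag_mx !mulmxA -(mulmxA _ Dm Dm) DmDm.
  by rewrite -!mulmxA (mulmxA Y) (mulmxA (Y *m _)) YmuY mulmxA DlaD.
have OO := mulmx1C OO'.
have YDDY : Y^T *m D *m D *m Y = diag_mx (map_mx GRing.inv mu).
  pose Di : 'M[R]_m := diag_mx (\row_i (Num.sqrt (mu 0 i))^-1).
  have DDi : Dm *m Di = 1%:M.
    rewrite /Dm /Di mulmx_diag -diag_const_mx; congr diag_mx; apply/rowP => i.
    by rewrite !mxE mulfV.
  have DiD := mulmx1C DDi.
  have : Di *m (O^T *m O) *m Di = diag_mx (map_mx GRing.inv mu).
    rewrite OO mulmx1 /Di mulmx_diag; congr diag_mx; apply/rowP => i.
    by rewrite !mxE -invfM -expr2 sqmu.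
  move=> <-; rewrite /O !trmx_mul !tr_diag_mx -/D -/Dm !mulmxA DiD mul1mx.
  by rewrite -(mulmxA _ Dm Di) DDi mulmx1.
set Psi := S *m _ *m S.
have cU := contractive_isometry UU; have cU1 := contractive_isometry UU1.
have cV := contractive_isometry VV.
pose W' := (C *m U)^T *m W *m (V *m U1).
have bW' : dual_ball b W'.
  apply: dual_ball_mul => //; last exact: contractive_mul.
  by apply: contractive_tr; exact: contractive_mul.
have cC1 : psdmx (1%:M - C^T *m C).
  split; first by rewrite linearB /= trmx1 trmx_mul trmxK.
  move=> x; rewrite -mulmxA -[_ 0 0]/(dotv _ _) mulmxBl mul1mx dotvDr dotvNr subr_ge0.
  by have := cC x; rewrite [X in X <= _]dotv_mulmx dotvC mulmxA.
have sS : S^T = S by rewrite SE !trmx_mul trmxK tr_diag_mx mulmxA.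
have pPsi : psdmx Psi by rewrite /Psi -{1}sS; exact: psd_conj.
have UOO : (U *m O)^T *m (U *m O) = 1%:M.
  by rewrite trmx_mul -(mulmxA O^T) (mulmxA U^T U) UU mul1mx OO.
have dom := dominated_schur pPsi UU UOO UU' (mulmx1C UOO) bW'.
have EE i j : (U^T *m Psi *m (U *m O)) i j =
   (Num.sqrt (la 0 i))^-1 * (((la 0 i)^-1 - (mu 0 j)^-1) * Y i j) * Num.sqrt (mu 0 j).
  have -> : U^T *m Psi *m (U *m O) = D *m (D *m D *m Y - Y *m diag_mx (map_mx GRing.inv mu)) *m Dm.
    rewrite -YDDY /Psi SE.
    have CC : U^T *m (C^T *m C) *m U = Y *m Y^T.
      have : (C^T *m V) *m (C^T *m V)^T = C^T *m C.
        by rewrite trmx_mul trmxK mulmxA CVV.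
      rewrite YE; move: (C^T *m V) => Q <-.
      by rewrite !trmx_mul trmxK !mulmxA -(mulmxA _ U1) UU1' mulmx1.
    have -> : U^T *m (U *m D *m U^T *m (1%:M - C^T *m C) *m (U *m D *m U^T)) *m (U *m O)
       = D *m (1%:M - U^T *m (C^T *m C) *m U) *m D *m O.
      rewrite !mulmxA UU mul1mx -(mulmxA _ U^T U) UU mulmx1.
      rewrite -!(mulmxA D) mulmxBr mulmxBl mulmx1 UU !mulmxA.
      by [].
    rewrite CC /O !mulmxA; congr (_ *m _).
    by rewrite !(mulmxBr, mulmxBl) mulmx1 !mulmxA.
  have -> : D *m D = diag_mx (map_mx GRing.inv la).
    rewrite /D mulmx_diag; congr diag_mx; apply/rowP => l.
    by rewrite !mxE -invfM -expr2 sqla.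
  rewrite /D /Dm.
  by rewrite !mul_mx_diag !mul_diag_mx !mxE; ring.
pose f (x : R) := x * expR (- (t * x)).
have LHS : \tr (W^T *m (C *m expmx (- (t *: H)) *m C^T -
               V *m expmx (- (t *: A)) *m V^T)) =
   \sum_i \sum_j (W' i j * Y i j / la 0 i) * (f (la 0 i) - f (mu 0 j)).
  pose X := U *m (diag_mx (\row_i expR (- (t * la 0 i))) *m Y
     - diag_mx (map_mx GRing.inv la) *m Y *m diag_mx (map_mx f mu)) *m U1^T.
  have HiE : invmx H = U *m diag_mx (map_mx GRing.inv la) *m U^T.
    by rewrite HE diag_conj_inv.
  have -> : C *m expmx (- (t *: H)) *m C^T - V *m expmx (- (t *: A)) *m V^T =
     C *m X *m V^T.
    (* Both Galerkin inverses agree, so V e^(-tA) V^T = (V A^-1 V^T) V A e^(-tA) V^T may start with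
       C H^-1 C^T instead. This gives both terms the same outer factors [C] and [V^T], and leaves x
       e^(-t x) after division by lambda_i. *)
    have -> : V *m expmx (- (t *: A)) *m V^T =
       C *m (invmx H *m (C^T *m V) *m A *m expmx (- (t *: A))) *m V^T.
      by rewrite !mulmxA CHC -(mulmxA _ V^T V) VV mulmx1 mulmxKV// pA.2.
    rewrite -{1}CVV mulmxA -[_ *m (C^T *m V)]mulmxA -mulmxBl -mulmxBr.
    congr (_ *m _ *m _).
    rewrite [in expmx (- (t *: H))]HE [in expmx (- (t *: A))]AE !diag_conj_expN// HiE CV.
    rewrite AE -!mulmxA (mulmxA U^T U) UU mul1mx (mulmxA U1^T U1) UU1 mul1mx.
    rewrite (mulmxA U^T U) UU mul1mx (mulmxA U1^T U1) UU1 mul1mx.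
    rewrite /X -!mulmxA -mulmxBr mulmxBl; congr (_ *m (_ - _)); first by rewrite !mulmxA.
    rewrite -!mulmxA; congr (_ *m (_ *m _)); rewrite mulmxA mulmx_diag.
    by congr (diag_mx _ *m _); apply/rowP => i; rewrite !mxE.
  have -> : W^T *m (C *m X *m V^T) = W^T *m C *m X *m V^T by rewrite !mulmxA.
  rewrite mxtrace_mulC.
  have -> : V^T *m (W^T *m C *m X) = U1 *m (W'^T *m (U^T *m X *m U1)) *m U1^T.
    rewrite /W'; clearbody X.
    rewrite !trmx_mul !trmxK !mulmxA UU1' mul1mx -!(mulmxA _ U U^T) UU' mulmx1.
    by rewrite -!(mulmxA _ U1 U1^T) UU1' mulmx1.
  rewrite mxtrace_mulC (mulmxA U1^T U1) UU1 mul1mx mxtrace_pairing.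
  apply: eq_bigr => i _; apply: eq_bigr => j _.
  rewrite /X !mulmxA UU mul1mx -(mulmxA _ U1^T U1) UU1 mulmx1.
  move: (W' i j) => w; rewrite !mul_mx_diag !mul_diag_mx !mxE /f.
  by field.
rewrite LHS.
pose ph (x : R) : R := (1 + t * x)^-1.
pose G v : R := expR 1 * (hexp 1 1 v - hexp 1 0 v).
have ph01 x : 0 < x -> 0 <= ph x <= 1.
  move=> x0; have tx : 0 < t * x by rewrite mulr_gt0.
  by rewrite invr_ge0 addr_ge0 ?(ltW tx)//= invf_le1 ?lerDl ?ltW// ltr_pwDl// ltW.
have Gph x : 0 < x -> G (ph x) = t * f x.
  move=> x0; have tx : 0 < t * x by rewrite mulr_gt0.
  have p0 : 0 < 1 + t * x by rewrite ltr_pwDl// ltW.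
  rewrite /G /ph !hexpE ?invr_gt0// invrK expr1 expr0 mulN1r opprD expRD /f.
  transitivity (expR 1 * expR (- 1) * (t * (x * expR (- (t * x))))); first by ring.
  by rewrite expRxMexpNx_1 mul1r.
have key : \sum_i \sum_j (W' i j * Y i j / la 0 i) * (G (ph (la 0 i)) - G (ph (mu 0 j))) <=
   47 / 20 * (4^-1 * mxnorm b Psi).
  apply: (@dominated_mul_exp _ _ _ (fun i j => W' i j * Y i j / la 0 i) _
     (fun i => ph (la 0 i)) (fun j => ph (mu 0 j))); last 2 first.
  - by move=> i; exact: ph01.
  - by move=> i; exact: ph01.
  (* The bound on its square is AM-GM in the form 4 t x <= (1 + t x)^2. *)
  pose al (x : R) := Num.sqrt (t * x) / (1 + t * x).
  have alq x : 0 < x -> al x ^+ 2 <= 4^-1.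
    move=> x0; have tx : 0 < t * x by rewrite mulr_gt0.
    have p0 : 0 < 1 + t * x by rewrite ltr_pwDl// ltW.
    rewrite /al exprMn sqr_sqrtr ?(ltW tx)// exprVn ler_pdivrMr ?exprn_gt0//.
    by have := sqr_ge0 (1 - t * x); lra.
  apply: eq_dominated (dominated_rank1 (a := fun i => al (la 0 i))
    (b := fun j => al (mu 0 j)) (fun i => alq _ (la0 i)) (fun j => alq _ (mu0 j)) _ dom); last first.
    by rewrite invr_ge0.
  move=> i j; rewrite EE /al /ph !sqrtrM ?(ltW t0)//.
  have tl : 0 < t * la 0 i by rewrite mulr_gt0.
  have tm : 0 < t * mu 0 j by rewrite mulr_gt0.
  have pl : 1 + t * la 0 i != 0 by rewrite gt_eqF// ltr_pwDl// ltW.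
  have pm : 1 + t * mu 0 j != 0 by rewrite gt_eqF// ltr_pwDl// ltW.
  have st : Num.sqrt t ^+ 2 = t by rewrite sqr_sqrtr// ltW.
  move: (W' i j) (Y i j) (sla i) (smu j) (sqla i) (sqmu j) st pl pm => w y.
  move: (Num.sqrt (la 0 i)) (Num.sqrt (mu 0 j)) (Num.sqrt t) => u v s u0 v0 <- <- <- pl pm.
  by field; rewrite !exprMn u0 v0 pl pm.
rewrite ler_pdivlMr//; apply: le_trans key; rewrite mulr_suml le_eqVlt.
apply/orP; left; apply/eqP; apply: eq_bigr => i _; rewrite mulr_suml.
apply: eq_bigr => j _; rewrite !Gph//; ring.
Qed.

(** * Dirichlet problems for the killed Laplacian *)

Lemma unitmx_of_injective (R : realType) n (A : 'M[R]_n) :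
  (forall x : 'cV[R]_n, A *m x = 0 -> x = 0) -> A \in unitmx.
Proof.
move=> inj; rewrite unitmxE unitfE -det_tr; apply/negP => /det0P[v v0 vA].
case/negP: v0; apply/eqP; apply: trmx_inj; rewrite trmx0; apply: inj.
by rewrite -[A]trmxK -trmx_mul vA trmx0.
Qed.

Lemma pdmx_of_pos (R : realType) n (A : 'M[R]_n) : A^T = A ->
  (forall x : 'cV[R]_n, x != 0 -> 0 < dotv x (A *m x)) -> pdmx A.
Proof.
move=> sA pA; split.
  split=> // x; rewrite -mulmxA -[_ 0 0]/(dotv _ _).
  have [->|x0] := eqVneq x 0; first by rewrite mulmx0 dotv0.
  exact/ltW/pA.
apply: unitmx_of_injective => x Ax; apply/eqP; apply: contraTT isT => x0.
by have := pA x x0; rewrite Ax dotv0 ltxx.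
Qed.

(** If the form vanishes at x, Cauchy-Schwarz for the form, tested against A x, yields A x = 0. *)
Lemma pdmx_pos (R : realType) n (A : 'M[R]_n) (x : 'cV[R]_n) :
  pdmx A -> x != 0 -> 0 < dotv x (A *m x).
Proof.
move=> [[sA pA] Au] x0.
have pA' z : 0 <= dotv z (A *m z).
  by have := pA z; rewrite -mulmxA -[_ 0 0]/(dotv _ _).
rewrite lt_neqAle pA' andbT; apply: contraNneq x0 => /esym x0.
have := psd_cauchy_schwarz (A *m x) x sA pA'.
rewrite x0 mulr0 => h.
have : dotv (A *m x) (A *m x) = 0.
  by apply/eqP; rewrite -sqrf_eq0 eq_le h sqr_ge0.
by move=> /dotv_eq0 Ax; rewrite -[x](mulKmx Au) Ax mulmx0.
Qed.

Lemma pdmx_conj (R : realType) m n (A : 'M[R]_n) (X : 'M[R]_(n, m)) :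
  pdmx A -> (forall x : 'cV[R]_m, X *m x = 0 -> x = 0) -> pdmx (X^T *m A *m X).
Proof.
move=> pA inj; apply: pdmx_of_pos; first exact: (psd_conj X pA.1).1.
move=> x x0; rewrite -!mulmxA dotv_mulmx trmxK; apply: pdmx_pos => //.
by apply: contraNneq x0 => /inj ->.
Qed.

Lemma pdmx1 (R : realType) n : pdmx (1%:M : 'M[R]_n).
Proof.
by apply: pdmx_of_pos; rewrite ?trmx1// => x x0; rewrite mul1mx dotv_gt0.
Qed.

Lemma pdmx_inv (R : realType) n (A : 'M[R]_n) : pdmx A -> pdmx (invmx A).
Proof.
move=> pA; have -> : invmx A = (invmx A)^T *m A *m invmx A.
  by rewrite trmx_inv pA.1.1 mulVmx ?mul1mx// pA.2.
apply: pdmx_conj => // x; move/(congr1 (mulmx A)).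
by rewrite mulKVmx ?mulmx0// pA.2.
Qed.

Lemma invmx_mul (R : realType) n (A B : 'M[R]_n) :
  A \in unitmx -> B \in unitmx -> invmx (A *m B) = invmx B *m invmx A.
Proof.
move=> Au Bu; have ABu : A *m B \in unitmx by rewrite unitmx_mul Au.
have E : (A *m B) *m (invmx B *m invmx A) = 1%:M.
  by rewrite mulmxA mulmxK// mulmxV.
by rewrite -[LHS]mulmx1 -E mulKmx.
Qed.

Definition sel (R : realType) n (I : {set 'I_n}) : 'M[R]_(n, #|I|) :=
  cols I 1%:M.
Arguments sel {R n} I.

Lemma colsE (R : realType) m n (I : {set 'I_n}) (A : 'M[R]_(m, n)) :
  cols I A = A *m sel I.
Proof. by rewrite /sel /cols -[in LHS](mulmx1 A) mulmx_colsub. Qed.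

Lemma rows_tr (R : realType) m n (I : {set 'I_m}) (A : 'M[R]_(m, n)) :
  rows I A = (cols I A^T)^T.
Proof. by apply/matrixP => i j; rewrite !mxE. Qed.

Lemma rowsE (R : realType) m n (I : {set 'I_m}) (A : 'M[R]_(m, n)) :
  rows I A = (sel I)^T *m A.
Proof. by rewrite rows_tr colsE trmx_mul trmxK. Qed.

Lemma blockE (R : realType) n (I : {set 'I_n}) (A : 'M[R]_n) :
  block I A = (sel I)^T *m A *m sel I.
Proof. by rewrite /block rowsE colsE mulmxA. Qed.

Lemma selE (R : realType) n (I : {set 'I_n}) i k :
  (sel I : 'M[R]_(n, #|I|)) i k = (i == enum_val k)%:R.
Proof. by rewrite !mxE. Qed.

Lemma rows_mxE (R : realType) m n (I : {set 'I_m}) (A : 'M[R]_(m, n)) k j :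
  rows I A k j = A (enum_val k) j.
Proof. by rewrite !mxE. Qed.

Lemma sel_tr_sel (R : realType) n (I : {set 'I_n}) :
  (sel I)^T *m sel I = 1%:M :> 'M[R]_#|I|.
Proof.
rewrite -rowsE; apply/matrixP => k l; rewrite rows_mxE selE mxE.
by rewrite (inj_eq enum_val_inj).
Qed.

Lemma sel_sel_trE (R : realType) n q (I : {set 'I_n}) (A : 'M[R]_(n, q)) i j :
  (sel I *m (sel I)^T *m A) i j = (i \in I)%:R * A i j.
Proof.
rewrite -mulmxA -rowsE mxE.
under eq_bigr do rewrite selE rows_mxE.
have [iI|iI] := boolP (i \in I).
  rewrite mul1r (bigD1 (enum_rank_in iI i))//= enum_rankK_in// eqxx mul1r big1 ?addr0//.
  move=> k; apply: contraNeq => h; apply/eqP.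
  apply: enum_val_inj; rewrite enum_rankK_in//; apply/eqP; rewrite eq_sym.
  by move: h; case: (i == _) => //; rewrite mul0r eqxx.
rewrite mul0r big1// => k _; have [ik|] := eqVneq; last by rewrite mul0r.
by move: iI; rewrite ik enum_valP.
Qed.

(* The Dirichlet problem off I: A u = 0 outside I, with u prescribed on I. *)
Definition dirichlet (R : realType) n (I : {set 'I_n}) (A : 'M[R]_n) :
    'M[R]_n :=
  sel I *m (sel I)^T + (1%:M - sel I *m (sel I)^T) *m A.

Lemma dirichlet_mulE (R : realType) n q (I : {set 'I_n}) (A : 'M[R]_n)
    (B : 'M[R]_(n, q)) i j :
  (dirichlet I A *m B) i j = if i \in I then B i j else (A *m B) i j.
Proof.
have E (M N P : 'M[R]_(n, q)) : (M + (N - P)) i j = M i j + (N i j - P i j).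
  by rewrite !mxE.
rewrite /dirichlet mulmxDl -[_ *m A *m B]mulmxA mulmxBl mul1mx E.
rewrite !sel_sel_trE; case: ifP => _; first by rewrite mul1r mul1r subrr addr0.
by rewrite !mul0r add0r subr0.
Qed.

(** Column [k] is the A-harmonic function off [I] with boundary value 1 at the state numbered [k]
    and 0 at the other states of [I]. *)
Definition extension (R : realType) n (I : {set 'I_n}) (A : 'M[R]_n) :
    'M[R]_(n, #|I|) := invmx (dirichlet I A) *m sel I.

(** A times the columns of A^-1 indexed by [I] is supported on [I], so these columns are harmonic
    off [I]; multiplying by the inverse block normalises their boundary values to the identity. *)
Lemma nystrom_extension (R : realType) n (I : {set 'I_n}) (A : 'M[R]_n) :
  pdmx A -> dirichlet I A \in unitmx ->
  cols I (invmx A) *m invmx (block I (invmx A)) = extension I A.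
Proof.
move=> pA Du; rewrite /extension colsE blockE.
have pK := pdmx_inv pA.
have Gu : (sel I)^T *m invmx A *m sel I \in unitmx.
  apply: (pdmx_conj pK _).2 => x /(congr1 (mulmx (sel I)^T)).
  by rewrite mulmxA sel_tr_sel mul1mx mulmx0.
set G := _ *m sel I in Gu *.
pose X := invmx A *m sel I *m invmx G.
have AX : A *m X = sel I *m invmx G by rewrite /X !mulmxA mulmxV ?pA.2// mul1mx.
have EX : (sel I)^T *m X = 1%:M by rewrite /X !mulmxA -/G mulmxV.
suff E : dirichlet I A *m X = sel I by rewrite -[in RHS]E mulKmx.
rewrite /dirichlet mulmxDl -!mulmxA EX AX mulmx1 mulmxBl mul1mx.
by rewrite -mulmxA (mulmxA (sel I)^T) sel_tr_sel mul1mx subrr addr0.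
Qed.

(** For the killed Laplacian both terms of the residual blow up as gamma -> 0. Their difference is
    the Green operator of the Dirichlet problem, which stays bounded. *)
Lemma nystrom_residualE (R : realType) n (I : {set 'I_n}) (A : 'M[R]_n) :
  pdmx A -> dirichlet I A \in unitmx ->
  nystrom_residual I (invmx A) =
  invmx (dirichlet I A) *m (1%:M - sel I *m (sel I)^T).
Proof.
move=> pA Du; rewrite /nystrom_residual (nystrom_extension pA Du) rowsE.
apply: (canRL (mulKmx Du)).
rewrite mulmxBr /extension -!mulmxA mulKVmx// /dirichlet (mulmxDl (sel I *m _)).
by rewrite mulmxK ?pA.2// -!mulmxA addrAC subrr add0r.
Qed.

(** * Energy form and minimum principle of a reversible Laplacian *)

Lemma diagc_mulE (R : realType) m n (v : 'cV[R]_m) (A : 'M[R]_(m, n)) i j :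
  (diagc v *m A) i j = v i 0 * A i j.
Proof. by rewrite /diagc mul_diag_mx !mxE. Qed.

Lemma mul_diagcE (R : realType) m n (v : 'cV[R]_n) (A : 'M[R]_(m, n)) i j :
  (A *m diagc v) i j = A i j * v j 0.
Proof. by rewrite /diagc mul_mx_diag !mxE. Qed.

Lemma diagc_inv (R : realType) n (v : 'cV[R]_n) :
  (forall i, v i 0 != 0) ->
  diagc v \in unitmx /\ invmx (diagc v) = diagc (map_mx GRing.inv v).
Proof.
move=> v0; have E : diagc v *m diagc (map_mx GRing.inv v) = 1%:M.
  apply/matrixP => i j; rewrite diagc_mulE !mxE.
  by have [->|ij] := eqVneq i j; rewrite ?mulr1n ?mulfV// !mulr0n mulr0.
have [u _] := mulmx1_unit E; split => //.
by rewrite -[LHS]mulmx1 -E mulKmx.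
Qed.

Lemma sqrtv_gt0 (R : realType) n (p : 'cV[R]_n) i :
  0 < p i 0 -> 0 < sqrtv p i 0.
Proof. by move=> p0; rewrite mxE sqrtr_gt0. Qed.

Lemma sqrtv_sqr (R : realType) n (p : 'cV[R]_n) i :
  0 < p i 0 -> sqrtv p i 0 * sqrtv p i 0 = p i 0.
Proof. by move=> p0; rewrite mxE -expr2 sqr_sqrtr// ltW. Qed.

Lemma laplacianE (R : realType) n (Q : 'M[R]_n) (p : 'cV[R]_n) i j :
  (forall i, 0 < p i 0) ->
  laplacian Q p i j = - (sqrtv p i 0 * Q i j / sqrtv p j 0).
Proof.
move=> p0; rewrite /laplacian mxE (diagc_inv _).2; last first.
  by move=> k; rewrite gt_eqF ?sqrtv_gt0.
by rewrite mul_diagcE diagc_mulE !mxE.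
Qed.

Lemma detailed_balance (R : realType) n (Q : 'M[R]_n) (p : 'cV[R]_n) i j :
  reversible_rate_matrix Q p -> p i 0 * Q i j = p j 0 * Q j i.
Proof.
move=> hQ; have := congr1 (fun M : 'M[R]_n => M i j) (stat_reversible hQ).
by rewrite diagc_mulE mul_diagcE !mxE mulrC [in RHS]mulrC => ->; rewrite mulrC.
Qed.

Lemma rate_row_sum0 (R : realType) n (Q : 'M[R]_n) (p : 'cV[R]_n) i :
  reversible_rate_matrix Q p -> \sum_j Q i j = 0.
Proof.
move=> hQ; have := congr1 (fun M : 'cV[R]_n => M i 0) (rate_row_sum hQ).
rewrite mxE [RHS]mxE => E; rewrite -[RHS]E.
by apply: eq_bigr => j _; rewrite mxE mulr1.
Qed.

Lemma laplacian_sym (R : realType) n (Q : 'M[R]_n) (p : 'cV[R]_n) :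
  reversible_rate_matrix Q p -> (laplacian Q p)^T = laplacian Q p.
Proof.
move=> hQ; apply/matrixP => i j; rewrite mxE !laplacianE; try exact: stat_gt0 hQ.
have hi := sqrtv_gt0 (stat_gt0 hQ i); have hj := sqrtv_gt0 (stat_gt0 hQ j).
have := detailed_balance i j hQ.
rewrite -(sqrtv_sqr (stat_gt0 hQ i)) -(sqrtv_sqr (stat_gt0 hQ j)) => E.
have hin : sqrtv p i 0 != 0 by rewrite gt_eqF.
have hjn : sqrtv p j 0 != 0 by rewrite gt_eqF.
congr (- _); apply/eqP; rewrite eqr_div//; apply/eqP.
by move: E; move: (sqrtv p i 0) (sqrtv p j 0) => a b E; lra.
Qed.

Lemma laplacian_null (R : realType) n (Q : 'M[R]_n) (p : 'cV[R]_n) :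
  reversible_rate_matrix Q p -> laplacian Q p *m sqrtv p = 0.
Proof.
move=> hQ; apply/matrixP => i k; rewrite ord1 mxE [RHS]mxE.
rewrite (eq_bigr (fun j => - sqrtv p i 0 * Q i j)); last first.
  move=> j _; rewrite laplacianE; last exact: stat_gt0 hQ.
  by rewrite mulNr divfK ?mulNr// gt_eqF// sqrtv_gt0// (stat_gt0 hQ).
by rewrite -mulr_sumr (rate_row_sum0 i hQ) mulr0.
Qed.

(** Only the cross term of the expanded square survives: one pure sum vanishes because the rows of
    [Q] sum to zero, the other by detailed balance after exchanging the indices. *)
Lemma dirichlet_form (R : realType) n (Q : 'M[R]_n) (p x : 'cV[R]_n) :
  reversible_rate_matrix Q p ->
  dotv x (laplacian Q p *m x) = 2^-1 * \sum_i \sum_j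
    p i 0 * Q i j * (x i 0 / sqrtv p i 0 - x j 0 / sqrtv p j 0) ^+ 2.
Proof.
move=> hQ; pose y i := x i 0 / sqrtv p i 0.
have hn i : sqrtv p i 0 != 0 by rewrite gt_eqF// sqrtv_gt0// (stat_gt0 hQ).
have -> : dotv x (laplacian Q p *m x) = - \sum_i \sum_j p i 0 * Q i j * (y i * y j).
  rewrite dotvE -sumrN; apply: eq_bigr => i _; rewrite mxE mulr_sumr -sumrN.
  apply: eq_bigr => j _; rewrite laplacianE; last exact: stat_gt0 hQ.
  rewrite -(sqrtv_sqr (stat_gt0 hQ i)) /y; field; by rewrite !hn.
have S1 : \sum_i \sum_j p i 0 * Q i j * y i ^+ 2 = 0.
  apply: big1 => i _; rewrite -mulr_suml -mulr_sumr (rate_row_sum0 i hQ).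
  by rewrite mulr0 mul0r.
have S2 : \sum_i \sum_j p i 0 * Q i j * y j ^+ 2 = 0.
  rewrite exchange_big -[RHS]S1; apply: eq_bigr => j _; apply: eq_bigr => i _.
  by rewrite (detailed_balance i j hQ).
rewrite [in RHS](eq_bigr (fun i => \sum_j p i 0 * Q i j * y i ^+ 2
   + \sum_j p i 0 * Q i j * y j ^+ 2
   - 2 * \sum_j p i 0 * Q i j * (y i * y j))); last first.
  move=> i _; rewrite mulr_sumr -big_split -sumrB; apply: eq_bigr => j _ /=.
  by rewrite -/(y i) -/(y j); ring.
by rewrite [in RHS]sumrB big_split /= S1 S2 -[in RHS]mulr_sumr; field.
Qed.

Lemma laplacian_ge0 (R : realType) n (Q : 'M[R]_n) (p x : 'cV[R]_n) :
  reversible_rate_matrix Q p -> 0 <= dotv x (laplacian Q p *m x).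
Proof.
move=> hQ; rewrite dirichlet_form// mulr_ge0// sumr_ge0// => i _.
rewrite sumr_ge0// => j _; have [->|ij] := eqVneq i j.
  by rewrite subrr expr0n mulr0.
rewrite mulr_ge0 ?sqr_ge0// mulr_ge0 ?(rate_ge0 hQ)// ltW// (stat_gt0 hQ)//.
Qed.

(** Zero energy makes x / h constant along every edge of positive rate, hence everywhere by
    irreducibility. *)
Lemma laplacian_eq0 (R : realType) n (Q : 'M[R]_n) (p x : 'cV[R]_n) i0 :
  reversible_rate_matrix Q p -> dotv x (laplacian Q p *m x) = 0 ->
  x = (x i0 0 / sqrtv p i0 0) *: sqrtv p.
Proof.
move=> hQ; rewrite dirichlet_form// => /eqP.
rewrite mulf_eq0 invr_eq0 pnatr_eq0 /=.
have t0 i j : 0 <= p i 0 * Q i j * (x i 0 / sqrtv p i 0 - x j 0 / sqrtv p j 0) ^+ 2.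
  have [->|ij] := eqVneq i j; first by rewrite subrr expr0n mulr0.
  by rewrite mulr_ge0 ?sqr_ge0// mulr_ge0 ?(rate_ge0 hQ)// ltW// (stat_gt0 hQ).
rewrite psumr_eq0; last by move=> i _; apply: sumr_ge0 => j _.
move=> /allP z.
have edge i j : 0 < Q i j -> x i 0 / sqrtv p i 0 = x j 0 / sqrtv p j 0.
  move=> q0; have := z i (mem_index_enum _); rewrite psumr_eq0// => /allP.
  move=> /(_ j (mem_index_enum _)); rewrite /= mulf_eq0 sqrf_eq0 mulf_eq0.
  by rewrite (gt_eqF (stat_gt0 hQ i)) (gt_eqF q0) /= subr_eq0 => /eqP.
have path i : x i0 0 / sqrtv p i0 0 = x i 0 / sqrtv p i 0.
  have /connectP[s] := rate_irreducible hQ i0 i.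
  elim: s i0 => [|j s IH] k /=; first by move=> _ ->.
  by move=> /andP[/edge -> /IH h] /h.
apply/matrixP => i k; rewrite ord1 mxE (path i) divfK// gt_eqF// sqrtv_gt0//.
exact: stat_gt0 hQ i.
Qed.

Lemma killed_mul (R : realType) n q (L : 'M[R]_n) (g : R) (A : 'M[R]_(n, q)) :
  killed L g *m A = L *m A + g *: A.
Proof. by rewrite /killed mulmxDl mul_scalar_mx. Qed.

Lemma killed_pd (R : realType) n (Q : 'M[R]_n) (p : 'cV[R]_n) (g : R) :
  reversible_rate_matrix Q p -> 0 < g -> pdmx (killed (laplacian Q p) g).
Proof.
move=> hQ g0; apply: pdmx_of_pos.
  by rewrite /killed linearD /= tr_scalar_mx laplacian_sym.
move=> x x0; rewrite killed_mul dotvDr dotvZr.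
by rewrite ltr_wpDl ?laplacian_ge0// mulr_gt0// dotv_gt0.
Qed.

(** A kernel vector vanishes on [I] and has zero energy, so it is a multiple of h vanishing at a
    state of [I]. The argument includes g = 0, and this is what allows the passage to the limit. *)
Lemma dirichlet_killed_unit (R : realType) n (Q : 'M[R]_n) (p : 'cV[R]_n)
    (I : {set 'I_n}) (g : R) :
  reversible_rate_matrix Q p -> 0 <= g -> I != finset.set0 ->
  dirichlet I (killed (laplacian Q p) g) \in unitmx.
Proof.
move=> hQ g0 /set0Pn[i0 i0I]; apply: unitmx_of_injective => x Dx.
have xE i : (if i \in I then x i 0 else (killed (laplacian Q p) g *m x) i 0) = 0.
  by rewrite -dirichlet_mulE Dx mxE.
have : dotv x (killed (laplacian Q p) g *m x) = 0.
  rewrite dotvE big1// => i _; have := xE i; case: ifP => _ ->; first by rewrite mul0r.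
  by rewrite mulr0.
rewrite killed_mul dotvDr dotvZr => /eqP.
rewrite paddr_eq0 ?laplacian_ge0 ?mulr_ge0 ?dotv_ge0// => /andP[/eqP x0 _].
rewrite (laplacian_eq0 i0 hQ x0).
by have := xE i0; rewrite i0I => ->; rewrite mul0r scale0r.
Qed.

(** At a negative minimum, necessarily off [I], zero row sums give (Q c) >= 0, whereas the
    hypothesis gives (Q c) <= g c < 0. *)
Lemma killed_min_principle (R : realType) n (Q : 'M[R]_n) (p c : 'cV[R]_n)
    (I : {set 'I_n}) (g : R) :
  reversible_rate_matrix Q p -> 0 < g ->
  (forall i, i \notin I -> (Q *m c) i 0 <= g * c i 0) ->
  (forall i, i \in I -> 0 <= c i 0) -> forall i, 0 <= c i 0.
Proof.
move=> hQ g0 cJ cI i.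
have [m _ mmin] := @arg_minP _ R 'I_n i xpredT (fun k => c k 0) isT.
apply: le_trans (mmin i isT); rewrite leNgt; apply/negP => cm.
have mJ : m \notin I by apply/negP => /cI; rewrite leNgt cm.
have : 0 <= (Q *m c) m 0.
  rewrite mxE (_ : \sum_j _ = \sum_j Q m j * (c j 0 - c m 0)).
    apply: sumr_ge0 => j _; have [->|jm] := eqVneq j m; first by rewrite subrr mulr0.
    by rewrite mulr_ge0 ?subr_ge0 ?mmin// (rate_ge0 hQ)// eq_sym.
  under [RHS]eq_bigr do rewrite mulrBr.
  by rewrite sumrB -mulr_suml (rate_row_sum0 m hQ) mul0r subr0.
move=> /le_trans /(_ (cJ m mJ)); rewrite leNgt => /negP; apply.
by rewrite pmulr_rlt0.
Qed.

(** Cauchy-Schwarz on each row with C_ik split as sqrt(C_ik hh_k) times sqrt(C_ik / hh_k); the first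
    factors are controlled by C hh <= h, and summing the second over rows uses C^T h = hh. *)
Lemma schur_test (R : realType) m n (C : 'M[R]_(n, m)) (h : 'cV[R]_n)
    (hh : 'cV[R]_m) :
  (forall i k, 0 <= C i k) -> (forall i, 0 <= h i 0) -> (forall k, 0 < hh k 0) ->
  (forall i, (C *m hh) i 0 <= h i 0) -> C^T *m h = hh -> contractive C.
Proof.
move=> C0 h0 hh0 Chh Ch x; rewrite [X in X <= _]dotvE.
have row i : (C *m x) i 0 * (C *m x) i 0 <=
    h i 0 * \sum_k C i k * (x k 0 ^+ 2 / hh k 0).
  pose u : 'cV[R]_m := \col_k Num.sqrt (C i k * hh k 0).
  pose v : 'cV[R]_m := \col_k (Num.sqrt (C i k / hh k 0) * x k 0).
  have uv : dotv u v = (C *m x) i 0.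
    rewrite dotvE mxE; apply: eq_bigr => k _; rewrite !mxE mulrA -sqrtrM; last first.
      by rewrite mulr_ge0 ?C0// ltW.
    rewrite (_ : C i k * hh k 0 * (C i k / hh k 0) = C i k ^+ 2); last first.
      by field; rewrite gt_eqF.
    by rewrite sqrtr_sqr ger0_norm.
  have uu : dotv u u = (C *m hh) i 0.
    rewrite dotvE mxE; apply: eq_bigr => k _; rewrite !mxE -expr2 sqr_sqrtr//.
    by rewrite mulr_ge0 ?C0// ltW.
  have vv : dotv v v = \sum_k C i k * (x k 0 ^+ 2 / hh k 0).
    rewrite dotvE; apply: eq_bigr => k _; rewrite !mxE -expr2 exprMn sqr_sqrtr.
      by ring.
    by rewrite divr_ge0 ?C0// ltW.
  rewrite -expr2 -uv; apply: (le_trans (cauchy_schwarz _ _)).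
  by rewrite uu -vv ler_wpM2r ?dotv_ge0.
apply: (@le_trans _ _ (\sum_i h i 0 * \sum_k C i k * (x k 0 ^+ 2 / hh k 0))).
  by apply: ler_sum => i _.
under eq_bigr do rewrite mulr_sumr.
rewrite exchange_big dotvE; apply: ler_sum => k _ /=.
have -> : \sum_i h i 0 * (C i k * (x k 0 ^+ 2 / hh k 0)) =
   (C^T *m h) k 0 * (x k 0 ^+ 2 / hh k 0).
  by rewrite mxE mulr_suml; apply: eq_bigr => i _; rewrite !mxE; ring.
by rewrite Ch le_eqVlt; apply/orP; left; apply/eqP; field; rewrite gt_eqF.
Qed.

(** * Projections, extensions and committors at fixed killing rate *)

Lemma orthmx_spec (R : realType) m n (X : 'M[R]_(n, m)) :
  (forall x : 'cV[R]_m, X *m x = 0 -> x = 0) ->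
  [/\ (orthmx X)^T *m orthmx X = 1%:M,
      orthmx X *m (orthmx X)^T = X *m invmx (X^T *m X) *m X^T &
      exists2 T, T \in unitmx & orthmx X = X *m T].
Proof.
move=> inj; have pX : pdmx (X^T *m X).
  by have := pdmx_conj (pdmx1 R n) inj; rewrite mulmx1.
have [sS SS Su SXS] := isqrtmx_spec pX.1 pX.2.
rewrite /orthmx; set S := isqrtmx _ in sS SS Su SXS *; split.
- by rewrite trmx_mul sS !mulmxA -(mulmxA S) SXS.
- by rewrite trmx_mul sS !mulmxA -(mulmxA X) SS.
- by exists S.
Qed.

(** The Galerkin inverse depends only on the range of [X]. The orthonormalised columns of K_gamma
    and the matrix C_gamma share their range, hence also this operator. *)
Lemma galerkin_inv (R : realType) m n (A : 'M[R]_n) (X : 'M[R]_(n, m))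
    (T : 'M[R]_m) : T \in unitmx -> X^T *m A *m X \in unitmx ->
  (X *m T) *m invmx ((X *m T)^T *m A *m (X *m T)) *m (X *m T)^T =
  X *m invmx (X^T *m A *m X) *m X^T.
Proof.
move=> Tu Gu; have -> : (X *m T)^T *m A *m (X *m T) = T^T *m (X^T *m A *m X) *m T.
  by rewrite trmx_mul !mulmxA.
set G := X^T *m A *m X in Gu *.
rewrite !invmx_mul ?unitmx_mul ?unitmx_tr ?Tu ?Gu// trmx_mul !mulmxA.
by rewrite mulmxK// mulmxKV ?unitmx_tr.
Qed.

Lemma sel_mul_injective (R : realType) n (I : {set 'I_n}) (A : 'M[R]_n) :
  A \in unitmx -> forall x : 'cV[R]_#|I|, A *m sel I *m x = 0 -> x = 0.
Proof.
move=> Au x /(congr1 (fun M => (sel I)^T *m (invmx A *m M))).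
by rewrite -mulmxA mulKmx// mulmxA sel_tr_sel mul1mx !mulmx0.
Qed.

Lemma extension_tr_sel (R : realType) n (I : {set 'I_n}) (A : 'M[R]_n) :
  dirichlet I A \in unitmx -> (sel I)^T *m extension I A = 1%:M.
Proof.
move=> Du; have E : dirichlet I A *m extension I A = sel I by rewrite mulKVmx.
apply/matrixP => k l; rewrite -rowsE rows_mxE.
have := congr1 (fun M : 'M[R]_(n, #|I|) => M (enum_val k) l) E.
rewrite dirichlet_mulE enum_valP => ->.
by rewrite -rows_mxE rowsE sel_tr_sel.
Qed.

Lemma extension_harmonic (R : realType) n (I : {set 'I_n}) (A : 'M[R]_n) i k :
  dirichlet I A \in unitmx -> i \notin I -> (A *m extension I A) i k = 0.
Proof.
move=> Du iI; have E : dirichlet I A *m extension I A = sel I by rewrite mulKVmx.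
have := congr1 (fun M : 'M[R]_(n, #|I|) => M i k) E.
rewrite dirichlet_mulE (negbTE iI) => ->; rewrite selE.
by case: eqP => // ik; move: iI; rewrite ik enum_valP.
Qed.

Lemma extension_unique (R : realType) n (I : {set 'I_n}) (A : 'M[R]_n)
    (B : 'M[R]_(n, #|I|)) : dirichlet I A \in unitmx ->
  (forall k l, B (enum_val k) l = (k == l)%:R) ->
  (forall i k, i \notin I -> (A *m B) i k = 0) -> B = extension I A.
Proof.
move=> Du BI BJ; rewrite -[LHS](mulKmx Du); congr (_ *m _).
apply/matrixP => i k; rewrite dirichlet_mulE selE; case: ifPn => [iI|iJ].
  by rewrite -(enum_rankK_in iI iI) BI (inj_eq enum_val_inj).
by rewrite BJ//; case: eqP => // ik; move: iJ; rewrite ik enum_valP.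
Qed.

Definition unsymmetrize (R : realType) n (p : 'cV[R]_n) (I : {set 'I_n})
    (B : 'M[R]_(n, #|I|)) : 'M[R]_(n, #|I|) :=
  invmx (diagc (sqrtv p)) *m B *m diagc (rows I (sqrtv p)).

Lemma unsymmetrizeE (R : realType) n (p : 'cV[R]_n) (I : {set 'I_n})
    (B : 'M[R]_(n, #|I|)) i k : (forall i, 0 < p i 0) ->
  unsymmetrize p B i k = (sqrtv p i 0)^-1 * B i k * sqrtv p (enum_val k) 0.
Proof.
move=> p0; rewrite /unsymmetrize (diagc_inv _).2; last first.
  by move=> j; rewrite gt_eqF ?sqrtv_gt0.
by rewrite mul_diagcE diagc_mulE rows_mxE !mxE.
Qed.

Definition pihat (R : realType) n (p : 'cV[R]_n) (I : {set 'I_n})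
    (B : 'M[R]_(n, #|I|)) : 'cV[R]_#|I| := (unsymmetrize p B)^T *m p.

(** The column rescaling between the extension [B] and the symmetrised committor, which is
    [B *m delta_diag p B]. *)
Definition delta_diag (R : realType) n (p : 'cV[R]_n) (I : {set 'I_n})
    (B : 'M[R]_(n, #|I|)) : 'M[R]_#|I| :=
  diagc (rows I (sqrtv p)) *m invmx (diagc (sqrtv (pihat p B))).

Lemma pihat_gt0 (R : realType) n (p : 'cV[R]_n) (I : {set 'I_n})
    (B : 'M[R]_(n, #|I|)) k : (forall i, 0 < p i 0) ->
  (forall i k, 0 <= B i k) -> (sel I)^T *m B = 1%:M -> 0 < pihat p B k 0.
Proof.
move=> p0 B0 B1; rewrite /pihat mxE (bigD1 (enum_val k))//=.
have h0 i : 0 < sqrtv p i 0 by exact: sqrtv_gt0.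
rewrite ltr_pwDl//.
  rewrite mxE unsymmetrizeE//.
  have -> : B (enum_val k) k = 1.
    have := congr1 (fun M : 'M[R]_#|I| => M k k) B1.
    by rewrite -rowsE rows_mxE mxE eqxx.
  by rewrite mulr1 mulVf ?mul1r// gt_eqF.
apply: sumr_ge0 => i _; rewrite mxE unsymmetrizeE//.
by rewrite mulr_ge0 ?(ltW (p0 _))// mulr_ge0 ?(ltW (h0 _))// mulr_ge0// invr_ge0 ltW.
Qed.

Lemma symmetrize_unsymmetrize (R : realType) n (p : 'cV[R]_n)
    (I : {set 'I_n}) (B : 'M[R]_(n, #|I|)) : (forall i, 0 < p i 0) ->
  symmetrize p (unsymmetrize p B) = B *m delta_diag p B.
Proof.
move=> p0; rewrite /symmetrize /delta_diag -/(pihat p B) /unsymmetrize !mulmxA.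
rewrite mulmxV ?mul1mx//; apply: (diagc_inv _).1 => i.
by rewrite gt_eqF ?sqrtv_gt0.
Qed.

Lemma delta_diag_unit (R : realType) n (p : 'cV[R]_n)
    (I : {set 'I_n}) (B : 'M[R]_(n, #|I|)) : (forall i, 0 < p i 0) ->
  (forall k, 0 < pihat p B k 0) ->
  delta_diag p B \in unitmx /\ delta_diag p B *m sqrtv (pihat p B) = rows I (sqrtv p).
Proof.
move=> p0 h0.
have hn k : sqrtv (pihat p B) k 0 != 0 by rewrite gt_eqF ?sqrtv_gt0.
have [u uE] := diagc_inv hn; split.
  rewrite /delta_diag unitmx_mul unitmx_inv u andbT; apply: (diagc_inv _).1 => k.
  by rewrite rows_mxE gt_eqF ?sqrtv_gt0.
rewrite /delta_diag uE -mulmxA; apply/matrixP => k l; rewrite !ord1.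
rewrite diagc_mulE diagc_mulE [map_mx _ _ _ _]mxE mulVf ?mulr1//.
Qed.

Lemma symmetrize_tr_h (R : realType) n (p : 'cV[R]_n)
    (I : {set 'I_n}) (B : 'M[R]_(n, #|I|)) : (forall i, 0 < p i 0) ->
  (forall k, 0 < pihat p B k 0) ->
  (symmetrize p (unsymmetrize p B))^T *m sqrtv p = sqrtv (pihat p B).
Proof.
move=> p0 h0; rewrite /symmetrize -/(pihat p B).
have hn k : sqrtv (pihat p B) k 0 != 0 by rewrite gt_eqF ?sqrtv_gt0.
have [u uE] := diagc_inv hn.
rewrite uE; apply/matrixP => k l; rewrite ord1 mxE.
transitivity (pihat p B k 0 / sqrtv (pihat p B) k 0); last first.
  by rewrite -{1}(sqrtv_sqr (h0 k)) mulfK.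
rewrite [in RHS]/pihat [((_)^T *m p) k 0]mxE mulr_suml; apply: eq_bigr => i _.
rewrite mxE [(unsymmetrize _ _)^T _ _]mxE mul_diagcE diagc_mulE [map_mx _ _ _ _]mxE.
rewrite -[in RHS](sqrtv_sqr (p0 i)) -/(pihat p B).
by move: (unsymmetrize p B i k) (pihat p B) => c q; rewrite !mxE; ring.
Qed.

Lemma killed_min_principle_sym (R : realType) n (Q : 'M[R]_n) (p b : 'cV[R]_n)
    (I : {set 'I_n}) (g : R) :
  reversible_rate_matrix Q p -> 0 < g ->
  (forall i, i \notin I -> 0 <= (killed (laplacian Q p) g *m b) i 0) ->
  (forall i, i \in I -> 0 <= b i 0) -> forall i, 0 <= b i 0.
Proof.
move=> hQ g0 bJ bI i; have p0 := stat_gt0 hQ.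
have h0 k : 0 < sqrtv p k 0 by exact: sqrtv_gt0.
pose c : 'cV[R]_n := \col_k (b k 0 / sqrtv p k 0).
suff : 0 <= c i 0 by rewrite mxE pmulr_lge0// invr_gt0.
apply: (killed_min_principle hQ g0 (I := I)) => [k kI|k kI]; last first.
  by rewrite mxE divr_ge0 ?bI// ltW.
have QcE : (Q *m c) k 0 = - ((laplacian Q p *m b) k 0 / sqrtv p k 0).
  rewrite !mxE mulr_suml -sumrN; apply: eq_bigr => j _; rewrite laplacianE// !mxE.
  have := h0 k; have := h0 j; rewrite !mxE => /lt0r_neq0 j0 /lt0r_neq0 k0.
  by field; rewrite j0 k0.
have := bJ k kI; rewrite killed_mul [X in 0 <= X]mxE [(g *: b) k 0]mxE QcE => h.
rewrite (_ : c k 0 = b k 0 / sqrtv p k 0); last by rewrite mxE.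
rewrite -subr_ge0 opprK (_ : _ + _ = ((laplacian Q p *m b) k 0 + g * b k 0) / sqrtv p k 0).
  by rewrite divr_ge0// ltW.
by rewrite mulrDl mulrA addrC.
Qed.

Lemma extension_ge0 (R : realType) n (Q : 'M[R]_n) (p : 'cV[R]_n)
    (I : {set 'I_n}) (g : R) i k :
  reversible_rate_matrix Q p -> 0 < g -> I != finset.set0 ->
  0 <= extension I (killed (laplacian Q p) g) i k.
Proof.
move=> hQ g0 I0; set B := extension _ _.
have Du := dirichlet_killed_unit hQ (ltW g0) I0.
have := @killed_min_principle_sym _ _ _ _ (col k B) I g hQ g0 _ _ i.
rewrite mxE; apply => j jI.
  by rewrite colE mulmxA -colE [col _ _ _ _]mxE extension_harmonic.
rewrite mxE -(enum_rankK_in jI jI) -rows_mxE rowsE extension_tr_sel// mxE.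
by rewrite ler0n.
Qed.

(** Because L h = 0, the vector h solves the killed Dirichlet problem with source g h off [I]. The
    extension of its boundary values therefore misses h by a term of order g, made explicit for
    later use in the limit. *)
Lemma extension_h (R : realType) n (Q : 'M[R]_n) (p : 'cV[R]_n)
    (I : {set 'I_n}) (g : R) :
  reversible_rate_matrix Q p -> 0 < g -> I != finset.set0 ->
  extension I (killed (laplacian Q p) g) *m rows I (sqrtv p) =
  sqrtv p - g *: (invmx (dirichlet I (killed (laplacian Q p) g))
                  *m (1%:M - sel I *m (sel I)^T) *m sqrtv p).
Proof.
move=> hQ g0 I0; have Du := dirichlet_killed_unit hQ (ltW g0) I0.
have Lh : killed (laplacian Q p) g *m sqrtv p = g *: sqrtv p.
  by rewrite killed_mul laplacian_null// add0r.
have E : dirichlet I (killed (laplacian Q p) g) *m sqrtv p =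
   sel I *m ((sel I)^T *m sqrtv p) + g *: ((1%:M - sel I *m (sel I)^T) *m sqrtv p).
  by rewrite /dirichlet mulmxDl -[_ *m killed _ _ *m _]mulmxA Lh -scalemxAr mulmxA.
apply/eqP; rewrite eq_sym subr_eq; apply/eqP.
by rewrite -[LHS](mulKmx Du) E mulmxDr -scalemxAr /extension rowsE !mulmxA.
Qed.

(** The difference vanishes on [I] and has the nonnegative source g h off [I]: killing makes the
    committor substochastic. *)
Lemma extension_h_le (R : realType) n (Q : 'M[R]_n) (p : 'cV[R]_n)
    (I : {set 'I_n}) (g : R) i :
  reversible_rate_matrix Q p -> 0 < g -> I != finset.set0 ->
  (extension I (killed (laplacian Q p) g) *m rows I (sqrtv p)) i 0 <= sqrtv p i 0.
Proof.
move=> hQ g0 I0; set B := extension _ _.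
have Du := dirichlet_killed_unit hQ (ltW g0) I0.
pose b := sqrtv p - B *m rows I (sqrtv p).
have sub_entry (M N : 'cV[R]_n) k : (M - N) k 0 = M k 0 - N k 0 by rewrite !mxE.
have bE j : b j 0 = sqrtv p j 0 - (B *m rows I (sqrtv p)) j 0 by exact: sub_entry.
rewrite -subr_ge0 -bE; apply: (killed_min_principle_sym hQ g0 (I := I)) => j jI.
  have E0 : (killed (laplacian Q p) g *m B *m rows I (sqrtv p)) j 0 = 0.
    by rewrite mxE big1// => k _; rewrite extension_harmonic// mul0r.
  have E1 : (killed (laplacian Q p) g *m sqrtv p) j 0 = g * sqrtv p j 0.
    by rewrite killed_mul laplacian_null// add0r mxE.
  rewrite /b mulmxBr mulmxA sub_entry E0 E1 subr0.
  by rewrite mulr_ge0 ?ltW// sqrtv_gt0// (stat_gt0 hQ).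
rewrite bE -(enum_rankK_in jI jI) -[(B *m _) _ _]rows_mxE rowsE mulmxA.
by rewrite extension_tr_sel// mul1mx rows_mxE subrr.
Qed.

Lemma killed_committorE (R : realType) n (Q : 'M[R]_n) (p : 'cV[R]_n)
    (I : {set 'I_n}) (g : R) :
  reversible_rate_matrix Q p -> 0 < g -> I != finset.set0 ->
  killed_committor (laplacian Q p) p I g =
  unsymmetrize p (extension I (killed (laplacian Q p) g)).
Proof.
move=> hQ g0 I0; have Du := dirichlet_killed_unit hQ (ltW g0) I0.
by rewrite /killed_committor nystrom_extension//; exact: killed_pd.
Qed.

(** The Schur test with weights pi^(1/2) and pihat^(1/2): one inequality is substochasticity, the
    other relation is the definition of pihat. *)
Lemma killed_committor_contractive (R : realType) n (Q : 'M[R]_n)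
    (p : 'cV[R]_n) (I : {set 'I_n}) (g : R) :
  reversible_rate_matrix Q p -> 0 < g -> I != finset.set0 ->
  contractive (symmetrize p (killed_committor (laplacian Q p) p I g)).
Proof.
move=> hQ g0 I0; rewrite killed_committorE//.
have Du := dirichlet_killed_unit hQ (ltW g0) I0; have p0 := stat_gt0 hQ.
set B := extension _ _.
have B0 i k : 0 <= B i k by exact: extension_ge0.
have hh0 k := pihat_gt0 k p0 B0 (extension_tr_sel Du).
have [_ dE] := delta_diag_unit p0 hh0.
have mapV (v : 'cV[R]_#|I|) k : map_mx GRing.inv v k 0 = (v k 0)^-1 by rewrite mxE.
apply: (@schur_test _ _ _ _ (sqrtv p) (sqrtv (pihat p B))).
- move=> i k; rewrite symmetrize_unsymmetrize// /delta_diag mulmxA.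
  rewrite (diagc_inv _).2; last by move=> j; rewrite gt_eqF ?sqrtv_gt0.
  rewrite mul_diagcE mul_diagcE rows_mxE mapV.
  apply: mulr_ge0; last by rewrite invr_ge0; apply/ltW/sqrtv_gt0.
  by apply: mulr_ge0 => //; apply/ltW/sqrtv_gt0.
- by move=> i; rewrite ltW ?sqrtv_gt0.
- by move=> k; rewrite sqrtv_gt0.
- move=> i; rewrite symmetrize_unsymmetrize// -mulmxA dE.
  exact: extension_h_le.
- exact: symmetrize_tr_h.
Qed.

Lemma killed_bounds (b : norm_index) (R : realType) n (Q : 'M[R]_n)
    (p : 'cV[R]_n) (I : {set 'I_n}) (W : 'M[R]_n) (t g : R) :
  reversible_rate_matrix Q p -> I != finset.set0 -> 0 < t -> 0 < g -> dual_ball b W ->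
  \tr (W^T *m (sp_compression (killed (laplacian Q p) g)
                 (symmetrize p (killed_committor (laplacian Q p) p I g)) t
               - proj_compression_at (laplacian Q p) I t g)) <=
    47 / 20 * (4^-1 * mxnorm b (obliqueness_at (laplacian Q p) p I g)) / t /\
  \tr (W^T *m (expmx (- (t *: killed (laplacian Q p) g))
               - proj_compression_at (laplacian Q p) I t g)) <=
    35 / 48 * (t^-1 * mxnorm b (nystrom_residual I (killed_inv (laplacian Q p) g))).
Proof.
move=> hQ I0 t0 g0 bW.
have cC := killed_committor_contractive hQ g0 I0.
have pA := killed_pd hQ g0; have Du := dirichlet_killed_unit hQ (ltW g0) I0.
have p0 := stat_gt0 hQ.
have hh0 k := pihat_gt0 k p0 (fun i k => extension_ge0 i k hQ g0 I0) (extension_tr_sel Du).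
have [dU _] := delta_diag_unit p0 hh0.
have CE : symmetrize p (killed_committor (laplacian Q p) p I g) =
    extension I (killed (laplacian Q p) g) *m
    delta_diag p (extension I (killed (laplacian Q p) g)).
  by rewrite killed_committorE// symmetrize_unsymmetrize.
rewrite /proj_compression_at /obliqueness_at /killed_inv.
move: cC CE; set C := symmetrize _ _; move: C => C cC CE.
move: dU CE; set d := delta_diag _ _; move: d => d dU CE.
rewrite -(nystrom_extension pA Du) in CE.
set A := killed _ _ in pA Du CE *; move: A pA Du CE => A pA Du CE.
set X := cols I (invmx A) in CE *.
have XE : X = invmx A *m sel I by rewrite /X colsE.
have Xinj (x : 'cV[R]_#|I|) : X *m x = 0 -> x = 0.
  by rewrite XE; apply: sel_mul_injective; rewrite unitmx_inv pA.2.
have [] := orthmx_spec Xinj; set V := orthmx X => VV VVt [T Tu VE].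
have XAX : X^T *m A *m X = block I (invmx A).
  rewrite XE blockE trmx_mul trmx_inv pA.1.1 -!mulmxA (mulmxA A) mulmxV ?pA.2//.
  by rewrite mul1mx.
have Xr : X^T = rows I (invmx A) by rewrite /X rows_tr trmx_inv pA.1.1.
have Gu : X^T *m A *m X \in unitmx by exact: (pdmx_conj pA Xinj).2.
have pV : pdmx (V^T *m A *m V).
  by apply: pdmx_conj => // x /(congr1 (mulmx V^T)); rewrite mulmxA VV mul1mx mulmx0.
have KE : V *m invmx (V^T *m A *m V) *m V^T =
    X *m invmx (block I (invmx A)) *m rows I (invmx A).
  by rewrite VE galerkin_inv// XAX Xr.
have T'u : invmx (block I (invmx A)) *m d \in unitmx.
  by rewrite unitmx_mul unitmx_inv dU -XAX Gu.
split; last first.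
  have := compression_error pA VV pV t0 bW.
  by rewrite /nystrom_residual -/X KE.
have CE' : C = X *m (invmx (block I (invmx A)) *m d) by rewrite CE mulmxA.
apply: (oblique_error pA VV pV _ _ cC _ t0 bW) => //.
- apply: pdmx_conj => // x; rewrite CE' -mulmxA => /Xinj /(congr1 (mulmx (invmx (invmx (block I (invmx A)) *m d)))).
  by rewrite mulKmx// mulmx0.
- have XXu : X^T *m X \in unitmx by have := (pdmx_conj (pdmx1 R n) Xinj).2; rewrite mulmx1.
  by rewrite VVt CE' !mulmxA -(mulmxA _ X^T X) mulmxKV.
- by rewrite KE CE' galerkin_inv// XAX Xr.
Qed.

(** * Continuity of the semigroup in its generator *)

Lemma mul_sum_entry (R : realType) n (x y : 'cV[R]_n) (A : 'M[R]_n) :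
  dotv x (A *m y) = \sum_i \sum_j x i 0 * y j 0 * A i j.
Proof.
rewrite dotvE; apply: eq_bigr => i _; rewrite mxE mulr_sumr.
by apply: eq_bigr => j _; ring.
Qed.

(* exp(-t .) is t-Lipschitz on positive semidefinite matrices: differentiate
   x^T e^{-s t A} e^{-(1-s) t B} y in s. *)
Lemma expmx_lipschitz (R : realType) n (A B : 'M[R]_n) (x y : 'cV[R]_n) (t : R) :
  psdmx A -> psdmx B -> 0 < t -> dotv x x <= 1 -> dotv y y <= 1 ->
  dotv x ((expmx (- (t *: A)) - expmx (- (t *: B))) *m y) <= t * entry_sum (A - B).
Proof.
move=> pA pB t0 x1 y1.
have [U [d [UU AE]]] := symmetric_spectral pA.1.
have [V [e [VV BE]]] := symmetric_spectral pB.1.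
have d0 := psd_eigen_ge0 pA UU AE; have e0 := psd_eigen_ge0 pB VV BE.
have UU' := mulmx1C UU; have VV' := mulmx1C VV.
have [Y YE] : exists Y, Y = U^T *m V by eexists.
pose xi := U^T *m x; pose et := V^T *m y.
have conjE (d1 e1 : 'rV[R]_n) i j :
    (U^T *m (U *m diag_mx d1 *m U^T - V *m diag_mx e1 *m V^T) *m V) i j =
    (d1 0 i - e1 0 j) * Y i j.
  rewrite mulmxBr mulmxBl !mulmxA UU mul1mx -[_ *m U^T *m V]mulmxA.
  rewrite -(mulmxA _ V^T) VV mulmx1 -YE.
  by rewrite mul_diag_mx mul_mx_diag !mxE; ring.
have rot (u v : 'cV[R]_n) (M : 'M[R]_n) :
    dotv (U *m u) (M *m (V *m v)) = dotv u (U^T *m M *m V *m v).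
  by rewrite [LHS]dotvC [LHS]dotv_mulmx [LHS]dotvC !mulmxA.
have xE : x = U *m xi by rewrite /xi mulmxA UU' mul1mx.
have yE : y = V *m et by rewrite /et mulmxA VV' mul1mx.
have xi1 : dotv xi xi <= 1 by rewrite dotv_mulmx trmxK -xE.
have et1 : dotv et et <= 1 by rewrite dotv_mulmx trmxK -yE.
pose F s := \sum_i \sum_j (xi i 0 * et j 0 * Y i j)
  * expR (- (t * e 0 j) + (- (t * (d 0 i - e 0 j))) * s).
have Fd (s : R) : is_derive s 1 F (\sum_i \sum_j (xi i 0 * et j 0 * Y i j) *
    (- (t * (d 0 i - e 0 j)) * expR (- (t * e 0 j) + - (t * (d 0 i - e 0 j)) * s))).
  by apply: der_sum => i; apply: der_sum => j; apply: derZ; exact: der_exp_affine.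
have [s /andP[s0 s1]] := mean_value (@ler01 R) Fd.
rewrite subr0 mulr1.
have -> : F 1 - F 0 = dotv x ((expmx (- (t *: A)) - expmx (- (t *: B))) *m y).
  rewrite AE BE !diag_conj_expN// {1}xE {1}yE rot mul_sum_entry /F -sumrB.
  apply: eq_bigr => i _; rewrite -sumrB; apply: eq_bigr => j _.
  rewrite conjE mulr1 mulr0 addr0 [X in (X - _) * _]mxE [X in (_ - X) * _]mxE.
  rewrite (_ : _ + - _ = - (t * d 0 i)); last by ring.
  by ring.
move=> ->.
pose xs : 'cV[R]_n := \col_i (xi i 0 * expR (- (t * s * d 0 i))).
pose ys : 'cV[R]_n := \col_j (- et j 0 * expR (- (t * (1 - s) * e 0 j))).
have small (u v : 'cV[R]_n) (w : 'I_n -> R) : dotv u u <= 1 ->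
    (forall i, v i 0 ^+ 2 = u i 0 ^+ 2 * w i) -> (forall i, w i <= 1) -> dotv v v <= 1.
  move=> u1 vE w1; apply: le_trans u1; rewrite !dotvE; apply: ler_sum => i _.
  by rewrite -!expr2 vE -[X in _ <= X]mulr1 ler_wpM2l ?sqr_ge0.
have exp1 (z : R) : 0 <= z -> expR (- z) ^+ 2 <= 1.
  by move=> z0; rewrite expr_le1 ?expR_ge0// expR_le1 oppr_le0.
have s10 : 0 <= 1 - s by rewrite subr_ge0.
have xs1 : dotv (U *m xs) (U *m xs) <= 1.
  rewrite dotv_mulmx mulmxA UU mul1mx.
  apply: (small xi _ (fun i => expR (- (t * s * d 0 i)) ^+ 2)) => //.
    by move=> i; rewrite /xs mxE exprMn.
  by move=> i; apply: exp1; rewrite mulr_ge0// mulr_ge0// ltW.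
have ys1 : dotv (V *m ys) (V *m ys) <= 1.
  rewrite dotv_mulmx mulmxA VV mul1mx.
  apply: (small et _ (fun i => expR (- (t * (1 - s) * e 0 i)) ^+ 2)) => //.
    by move=> i; rewrite /ys mxE exprMn sqrrN.
  by move=> i; apply: exp1; rewrite mulr_ge0// mulr_ge0// ltW.
apply: (@le_trans _ _ (t * dotv (U *m xs) ((A - B) *m (V *m ys)))); last first.
  by rewrite ler_wpM2l ?(ltW t0)// bilinear_le_entry_sum.
rewrite le_eqVlt; apply/orP; left; apply/eqP.
rewrite AE BE rot mul_sum_entry mulr_sumr; apply: eq_bigr => i _.
rewrite mulr_sumr; apply: eq_bigr => j _; rewrite conjE.
rewrite [xs i 0]mxE [ys j 0]mxE.
have -> : expR (- (t * e 0 j) + - (t * (d 0 i - e 0 j)) * s) =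
   expR (- (t * s * d 0 i)) * expR (- (t * (1 - s) * e 0 j)).
  by rewrite -expRD; congr expR; ring.
by ring.
Qed.

Lemma expmx_cvg (R : realType) (T : Type) n (F : set_system T)
    (FF : ProperFilter F) (A : T -> 'M[R]_n) (A0 : 'M[R]_n) (t : R) : 0 < t ->
  (\forall g \near F, psdmx (A g)) -> mxcvg F A A0 ->
  mxcvg F (fun g => expmx (- (t *: A g))) (expmx (- (t *: A0))).
Proof.
move=> t0 pA cA; have pA0 := psd_cvg FF pA cA; move=> i j.
have c0 : t * entry_sum (A0 - A g) @[g --> F] --> (0 : R).
  have -> : (0 : R) = t * entry_sum (A0 - A0).
    rewrite subrr /entry_sum big1 ?mulr0// => k _; rewrite big1// => l _.
    by rewrite mxE normr0.
  apply: cvgM; first exact: cvg_cst.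
  apply: cvg_bigsum => k _; apply: cvg_bigsum => l _; apply: cvg_norm.
  exact: (@mxcvgB R T n n F _ (fun _ => A0) A A0 A0 (mxcvg_cst _ A0) cA k l).
apply/cvgrPdist_le => e e0; have /cvgr0Pnorm_le /(_ e e0) := c0.
apply: filterS2 pA => g pg /= /(le_trans (ler_norm _)) le.
have d1 k : dotv (delta_mx k 0 : 'cV[R]_n) (delta_mx k 0) <= 1.
  by rewrite dotv_delta mxE !eqxx.
have entE (M : 'M[R]_n) : dotv (delta_mx i 0) (M *m delta_mx j 0) = M i j.
  by rewrite dotv_delta -colE mxE.
have es : entry_sum (A g - A0) = entry_sum (A0 - A g).
  by apply: eq_bigr => k _; apply: eq_bigr => l _; rewrite !mxE distrC.
have h1 := expmx_lipschitz pA0 pg t0 (d1 i) (d1 j).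
have h2 := expmx_lipschitz pg pA0 t0 (d1 i) (d1 j).
have subE (M N : 'M[R]_n) : (M - N) i j = M i j - N i j by rewrite !mxE.
rewrite entE subE in h1; rewrite entE subE es in h2.
rewrite ler_norml; apply/andP; split; last exact: le_trans h1 le.
by rewrite lerNl opprB; exact: le_trans h2 le.
Qed.

(** * Vanishing killing rate *)

Lemma expmx_intertwine (R : realType) m n (A : 'M[R]_m) (B : 'M[R]_n)
    (Z : 'M[R]_(m, n)) (t : R) : A^T = A -> B^T = B -> A *m Z = Z *m B ->
  expmx (- (t *: A)) *m Z = Z *m expmx (- (t *: B)).
Proof.
move=> sA sB; have [U [d [UU AE]]] := symmetric_spectral sA.
have [V [e [VV BE]]] := symmetric_spectral sB.
rewrite AE BE !diag_conj_expN// => E.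
by apply: diag_intertwine UU VV E _ => i j; rewrite !mxE => ->.
Qed.

Lemma mxcvg_diagc (R : realType) (T : Type) n (F : set_system T)
    (FF : Filter F) (v : T -> 'cV[R]_n) (v0 : 'cV[R]_n) :
  mxcvg F v v0 -> mxcvg F (fun g => diagc (v g)) (diagc v0).
Proof.
move=> cv i j.
have E (w : 'cV[R]_n) : diagc w i j = w i 0 * (i == j)%:R by rewrite !mxE mulr_natr.
rewrite E; under eq_fun do rewrite E.
by apply: cvgM; [exact: cv|exact: cvg_cst].
Qed.

Lemma killed_cvg (R : realType) n (L : 'M[R]_n) :
  mxcvg (0^'+) (killed L) L.
Proof.
rewrite -[X in mxcvg _ _ X]addr0; apply: mxcvgD; first exact: mxcvg_cst.
move=> i j; under eq_fun do rewrite mxE; rewrite mxE.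
have -> : (0 : R) = 0 *+ (i == j) by rewrite mul0rn.
case: (i == j); last by rewrite mulr0n; under eq_fun do rewrite mulr0n; exact: cvg_cst.
rewrite mulr1n; under eq_fun do rewrite mulr1n.
exact: cvg_at_right_filter.
Qed.

Lemma dirichlet_cvg (R : realType) n (I : {set 'I_n}) (L : 'M[R]_n) :
  mxcvg (0^'+) (fun g => dirichlet I (killed L g)) (dirichlet I L).
Proof.
apply: mxcvgD; first exact: mxcvg_cst.
by apply: mxcvgM; [exact: mxcvg_cst|exact: killed_cvg].
Qed.

Lemma dirichlet_laplacian_unit (R : realType) n (Q : 'M[R]_n) (p : 'cV[R]_n)
    (I : {set 'I_n}) : reversible_rate_matrix Q p -> I != finset.set0 ->
  dirichlet I (laplacian Q p) \in unitmx.
Proof.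
move=> hQ I0; have := dirichlet_killed_unit hQ (lexx 0) I0.
by rewrite /killed (_ : 0%:M = 0) ?addr0//; apply/matrixP => i j; rewrite !mxE mul0rn.
Qed.

Lemma dirichlet_inv_cvg (R : realType) n (Q : 'M[R]_n) (p : 'cV[R]_n)
    (I : {set 'I_n}) : reversible_rate_matrix Q p -> I != finset.set0 ->
  mxcvg (0^'+) (fun g => invmx (dirichlet I (killed (laplacian Q p) g)))
    (invmx (dirichlet I (laplacian Q p))).
Proof.
move=> hQ I0; apply: mxcvg_inv; first exact: dirichlet_laplacian_unit.
exact: dirichlet_cvg.
Qed.

Lemma extension_cvg (R : realType) n (Q : 'M[R]_n) (p : 'cV[R]_n)
    (I : {set 'I_n}) : reversible_rate_matrix Q p -> I != finset.set0 ->
  mxcvg (0^'+) (fun g => extension I (killed (laplacian Q p) g))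
    (extension I (laplacian Q p)).
Proof.
move=> hQ I0; apply: mxcvgM; first exact: dirichlet_inv_cvg.
exact: mxcvg_cst.
Qed.

Lemma extension0_ge0 (R : realType) n (Q : 'M[R]_n) (p : 'cV[R]_n)
    (I : {set 'I_n}) i k : reversible_rate_matrix Q p -> I != finset.set0 ->
  0 <= extension I (laplacian Q p) i k.
Proof.
move=> hQ I0; have c : extension I (killed (laplacian Q p) g) i k @[g --> 0^'+] -->
    extension I (laplacian Q p) i k by exact: extension_cvg.
apply: (cvgr_to_ge c); near=> g; apply: extension_ge0 => //; near: g; exact: nbhs_right_gt.
Unshelve. all: by end_near. Qed.

Lemma pihat_gt0_killed (R : realType) n (Q : 'M[R]_n) (p : 'cV[R]_n)
    (I : {set 'I_n}) g k : reversible_rate_matrix Q p -> I != finset.set0 -> 0 < g ->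
  0 < pihat p (extension I (killed (laplacian Q p) g)) k 0.
Proof.
move=> hQ I0 g0; apply: pihat_gt0; first exact: stat_gt0 hQ.
  by move=> i l; exact: extension_ge0.
by apply: extension_tr_sel; exact: dirichlet_killed_unit (ltW g0) I0.
Qed.

Lemma pihat_gt0_laplacian (R : realType) n (Q : 'M[R]_n) (p : 'cV[R]_n)
    (I : {set 'I_n}) k : reversible_rate_matrix Q p -> I != finset.set0 ->
  0 < pihat p (extension I (laplacian Q p)) k 0.
Proof.
move=> hQ I0; apply: pihat_gt0; first exact: stat_gt0 hQ.
  by move=> i l; exact: extension0_ge0.
by apply: extension_tr_sel; exact: dirichlet_laplacian_unit.
Qed.

Lemma sqrtv_pihat_cvg (R : realType) n (Q : 'M[R]_n) (p : 'cV[R]_n)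
    (I : {set 'I_n}) : reversible_rate_matrix Q p -> I != finset.set0 ->
  mxcvg (0^'+) (fun g => sqrtv (pihat p (extension I (killed (laplacian Q p) g))))
    (sqrtv (pihat p (extension I (laplacian Q p)))).
Proof.
move=> hQ I0; have c : mxcvg (0^'+) (fun g => pihat p (extension I (killed (laplacian Q p) g)))
    (pihat p (extension I (laplacian Q p))).
  apply: mxcvgM; last exact: mxcvg_cst.
  apply: mxcvgT; apply: mxcvgM; last exact: mxcvg_cst.
  by apply: mxcvgM; [exact: mxcvg_cst|exact: extension_cvg].
move=> i j; under eq_fun do rewrite mxE; rewrite mxE.
apply: continuous_cvg; first exact: sqrt_continuous.
exact: c.
Qed.

Lemma delta_diag_cvg (R : realType) n (Q : 'M[R]_n) (p : 'cV[R]_n)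
    (I : {set 'I_n}) : reversible_rate_matrix Q p -> I != finset.set0 ->
  mxcvg (0^'+) (fun g => delta_diag p (extension I (killed (laplacian Q p) g)))
    (delta_diag p (extension I (laplacian Q p))).
Proof.
move=> hQ I0; apply: mxcvgM; first exact: mxcvg_cst.
apply: mxcvg_inv.
  apply: (diagc_inv _).1 => k; rewrite gt_eqF// sqrtv_gt0//.
  exact: pihat_gt0_laplacian.
by apply: mxcvg_diagc; exact: sqrtv_pihat_cvg.
Qed.

Lemma symmetrize_cvg (R : realType) n (Q : 'M[R]_n) (p : 'cV[R]_n)
    (I : {set 'I_n}) : reversible_rate_matrix Q p -> I != finset.set0 ->
  mxcvg (0^'+) (fun g => symmetrize p (killed_committor (laplacian Q p) p I g))
    (symmetrize p (unsymmetrize p (extension I (laplacian Q p)))).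
Proof.
move=> hQ I0; have p0 := stat_gt0 hQ; rewrite symmetrize_unsymmetrize//.
apply: (@mxcvg_near _ _ _ _ _ _ (fun g => extension I (killed (laplacian Q p) g) *m
    delta_diag p (extension I (killed (laplacian Q p) g)))).
  near=> g; have g0 : 0 < g by near: g; exact: nbhs_right_gt.
  by rewrite killed_committorE// symmetrize_unsymmetrize.
by apply: mxcvgM; [exact: extension_cvg|exact: delta_diag_cvg].
Unshelve. all: by end_near. Qed.

Lemma sp_compression_cvg (R : realType) n (Q : 'M[R]_n) (p : 'cV[R]_n)
    (I : {set 'I_n}) (t : R) : reversible_rate_matrix Q p -> I != finset.set0 -> 0 < t ->
  mxcvg (0^'+) (fun g => sp_compression (killed (laplacian Q p) g)
           (symmetrize p (killed_committor (laplacian Q p) p I g)) t)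
    (sp_compression (laplacian Q p)
      (symmetrize p (unsymmetrize p (extension I (laplacian Q p)))) t).
Proof.
move=> hQ I0 t0; have cC := symmetrize_cvg hQ I0.
apply: mxcvgM; last exact: mxcvgT.
apply: mxcvgM => //; apply: expmx_cvg => //.
  near=> g; have g0 : 0 < g by near: g; exact: nbhs_right_gt.
  by apply: psd_conj; exact: (killed_pd hQ g0).1.
by apply: mxcvgM => //; apply: mxcvgM; [exact: mxcvgT|exact: killed_cvg].
Unshelve. all: by end_near. Qed.

Definition range_proj (R : realType) m n (B : 'M[R]_(n, m)) : 'M[R]_n :=
  B *m invmx (B^T *m B) *m B^T.

(** The columns of K_gamma blow up as gamma -> 0, but V V^T depends only on their range and is the
    projection onto the range of the extension, which converges. Intertwining with V moves the
    exponential onto P A P. *)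
Lemma proj_compression_atE (R : realType) n (Q : 'M[R]_n) (p : 'cV[R]_n)
    (I : {set 'I_n}) (t g : R) : reversible_rate_matrix Q p -> I != finset.set0 -> 0 < g ->
  forall P, P = range_proj (extension I (killed (laplacian Q p) g)) ->
  proj_compression_at (laplacian Q p) I t g =
  expmx (- (t *: (P^T *m killed (laplacian Q p) g *m P))) *m P.
Proof.
move=> hQ I0 g0 P PE; rewrite /proj_compression_at /killed_inv.
have pA := killed_pd hQ g0; have Du := dirichlet_killed_unit hQ (ltW g0) I0.
move: PE; rewrite -nystrom_extension//.
set A := killed _ _ in pA Du *; set X := cols I (invmx A) => PE.
have Xinj (x : 'cV[R]_#|I|) : X *m x = 0 -> x = 0.
  by rewrite /X colsE; apply: sel_mul_injective; rewrite unitmx_inv pA.2.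
have [] := orthmx_spec Xinj; set V := orthmx X => VV VVt [T Tu VE].
have XXu : X^T *m X \in unitmx by have := (pdmx_conj (pdmx1 R n) Xinj).2; rewrite mulmx1.
have Gu : block I (invmx A) \in unitmx.
  rewrite blockE; apply: (pdmx_conj (pdmx_inv pA) _).2 => x.
  move=> /(congr1 (mulmx (sel I)^T)).
  by rewrite mulmxA sel_tr_sel mul1mx mulmx0.
have PV : P = V *m V^T.
  rewrite PE VVt /range_proj.
  have := @galerkin_inv R _ _ 1%:M X (invmx (block I (invmx A))).
  by rewrite !mulmx1 unitmx_inv; apply.
have key : expmx (- (t *: (P^T *m A *m P))) *m V = V *m expmx (- (t *: (V^T *m A *m V))).
  apply: expmx_intertwine.
  - exact: (psd_conj P pA.1).1.
  - exact: (psd_conj V pA.1).1.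
  - by rewrite PV trmx_mul trmxK -!mulmxA VV mulmx1.
by rewrite -key -mulmxA -PV.
Qed.

Lemma range_proj_cvg (R : realType) n (Q : 'M[R]_n) (p : 'cV[R]_n)
    (I : {set 'I_n}) : reversible_rate_matrix Q p -> I != finset.set0 ->
  mxcvg (0^'+) (fun g => range_proj (extension I (killed (laplacian Q p) g)))
     (range_proj (extension I (laplacian Q p))).
Proof.
move=> hQ I0; have cB := extension_cvg hQ I0.
apply: mxcvgM; last exact: mxcvgT.
apply: mxcvgM => //; apply: mxcvg_inv; last first.
  by apply: mxcvgM => //; exact: mxcvgT.
have := @pdmx_conj R _ _ _ (extension I (laplacian Q p)) (pdmx1 R n).
rewrite mulmx1; case=> // x /(congr1 (mulmx (sel I)^T)).
by rewrite mulmxA extension_tr_sel ?mul1mx ?mulmx0//; exact: dirichlet_laplacian_unit.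
Qed.

Lemma proj_compression_cvg (R : realType) n (Q : 'M[R]_n) (p : 'cV[R]_n)
    (I : {set 'I_n}) (t : R) : reversible_rate_matrix Q p -> I != finset.set0 -> 0 < t ->
  mxcvg (0^'+) (proj_compression_at (laplacian Q p) I t)
    (proj_compression (laplacian Q p) I t).
Proof.
move=> hQ I0 t0; pose P := range_proj (extension I (laplacian Q p)).
have c : mxcvg (0^'+) (proj_compression_at (laplacian Q p) I t)
    (expmx (- (t *: (P^T *m laplacian Q p *m P))) *m P).
  pose Pg g := range_proj (extension I (killed (laplacian Q p) g)).
  apply: (@mxcvg_near _ _ _ _ _ _ (fun g => expmx (- (t *: ((Pg g)^T *m killed (laplacian Q p) g *m Pg g))) *m Pg g)).
    near=> g; have g0 : 0 < g by near: g; exact: nbhs_right_gt.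
    by rewrite (proj_compression_atE t hQ I0 g0 (erefl (Pg g))).
  have cP := range_proj_cvg hQ I0.
  apply: mxcvgM => //; apply: expmx_cvg => //.
    near=> g; have g0 : 0 < g by near: g; exact: nbhs_right_gt.
    by apply: psd_conj; exact: (killed_pd hQ g0).1.
  by apply: mxcvgM => //; apply: mxcvgM; [exact: mxcvgT|exact: killed_cvg].
by rewrite /proj_compression (mxcvg_lim _ c).
Unshelve. all: by end_near. Qed.

Lemma proj_compression_sym (R : realType) n (Q : 'M[R]_n) (p : 'cV[R]_n)
    (I : {set 'I_n}) (t : R) : reversible_rate_matrix Q p -> I != finset.set0 -> 0 < t ->
  (proj_compression (laplacian Q p) I t)^T = proj_compression (laplacian Q p) I t.
Proof.
move=> hQ I0 t0; have c := proj_compression_cvg hQ I0 t0.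
apply/matrixP => i j; rewrite mxE.
have c2 : proj_compression_at (laplacian Q p) I t g i j @[g --> 0^'+] -->
    proj_compression (laplacian Q p) I t j i.
  apply: (cvg_near _ _ (c j i)); near=> g.
  have g0 : 0 < g by near: g; exact: nbhs_right_gt.
  rewrite /proj_compression_at; set V := orthmx _.
  have sB := (psd_conj V (killed_pd hQ g0).1).1.
  have [U [d [UU BE]]] := symmetric_spectral sB.
  rewrite BE diag_conj_expN//.
  set D := diag_mx _; have : (V *m (U *m D *m U^T) *m V^T)^T = V *m (U *m D *m U^T) *m V^T.
    by move: V sB BE => V _ _; rewrite !trmx_mul !trmxK tr_diag_mx !mulmxA.
  by move=> /matrixP/(_ i j); rewrite mxE.
exact: (@cvg_unique _ (@Rhausdorff R) _ _ _ _ c2 (c i j)).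
Unshelve. all: by end_near. Qed.

Lemma nystrom_error_cvg (b : norm_index) (R : realType) n (Q : 'M[R]_n)
    (p : 'cV[R]_n) (I : {set 'I_n}) : reversible_rate_matrix Q p -> I != finset.set0 ->
  mxnorm b (nystrom_residual I (killed_inv (laplacian Q p) g)) @[g --> 0^'+] -->
  nystrom_error b (laplacian Q p) I.
Proof.
move=> hQ I0.
pose M0 := invmx (dirichlet I (laplacian Q p)) *m (1%:M - sel I *m (sel I)^T).
have c : mxnorm b (nystrom_residual I (killed_inv (laplacian Q p) g)) @[g --> 0^'+] -->
    mxnorm b M0.
  apply: mxnorm_cvg.
    near=> g; have g0 : 0 < g by near: g; exact: nbhs_right_gt.
    have pA := killed_pd hQ g0; rewrite /killed_inv.
    set A := killed _ _ in pA *.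
    pose V := cols I (invmx A).
    have Vinj (x : 'cV[R]_#|I|) : V *m x = 0 -> x = 0.
      by rewrite /V colsE; apply: sel_mul_injective; rewrite unitmx_inv pA.2.
    have := compression_psd pA (pdmx_conj pA Vinj).2.
    rewrite /nystrom_residual.
    have -> : V^T *m A *m V = block I (invmx A).
      rewrite /V colsE blockE trmx_mul trmx_inv pA.1.1 -!mulmxA (mulmxA A).
      by rewrite mulmxV ?pA.2// mul1mx.
    by rewrite /V rows_tr trmx_inv pA.1.1.
  apply: (@mxcvg_near _ _ _ _ _ _ (fun g => invmx (dirichlet I (killed (laplacian Q p) g))
      *m (1%:M - sel I *m (sel I)^T))).
    near=> g; have g0 : 0 < g by near: g; exact: nbhs_right_gt.
    rewrite /killed_inv nystrom_residualE//; first exact: killed_pd.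
    exact: dirichlet_killed_unit (ltW g0) I0.
  by apply: mxcvgM; [exact: dirichlet_inv_cvg|exact: mxcvg_cst].
by rewrite /nystrom_error (cvg_lim _ c).
Unshelve. all: by end_near. Qed.

Lemma invmx_conj (R : realType) m (T G : 'M[R]_m) :
  T \in unitmx -> G \in unitmx ->
  invmx (T^T *m invmx G *m T) = invmx T *m G *m (invmx T)^T.
Proof.
move=> Tu Gu; rewrite !invmx_mul ?unitmx_mul ?unitmx_tr ?unitmx_inv ?Tu ?Gu//.
by rewrite invmxK trmx_inv mulmxA.
Qed.

Lemma conj_mul (R : realType) m n k (A : 'M[R]_n) (X : 'M[R]_(n, m))
    (Y : 'M[R]_(m, k)) :
  (X *m Y)^T *m A *m (X *m Y) = Y^T *m (X^T *m A *m X) *m Y.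
Proof. by rewrite trmx_mul !mulmxA. Qed.

Lemma sandwich (R : realType) m n (D : 'M[R]_n) (X : 'M[R]_(m, n))
    (Z : 'M[R]_m) : D^T = D ->
  (D *m X^T) *m Z *m (D *m X^T)^T = D *m (X^T *m Z *m X) *m D.
Proof. by move=> sD; rewrite trmx_mul trmxK sD !mulmxA. Qed.

Lemma sandwich_tr (R : realType) m n (D : 'M[R]_n) (X : 'M[R]_(m, n)) :
  D^T = D -> (D *m X^T)^T *m (D *m X^T) = X *m (D *m D) *m X^T.
Proof. by move=> sD; rewrite trmx_mul trmxK sD !mulmxA. Qed.

Lemma col_mul3 (R : realType) m n k q (X : 'M[R]_(m, n)) (Z : 'M[R]_(n, k))
    (Y : 'M[R]_(k, q)) l : col l (X *m Z *m Y) = X *m (Z *m col l Y).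
Proof. by rewrite !colE !mulmxA. Qed.

Lemma trmx_conj (R : realType) m n (A : 'M[R]_n) (X : 'M[R]_(n, m)) :
  A^T = A -> (X^T *m A *m X)^T = X^T *m A *m X.
Proof. by move=> sA; rewrite !trmx_mul trmxK sA mulmxA. Qed.

(* Psi is orthogonally similar to Y (I - C^T C) Y^T for every Y with
   Y^T Y = (C^T A C)^-1. *)
Lemma obliqueness_conj (b : norm_index) (R : realType) m n (A : 'M[R]_n)
    (C : 'M[R]_(n, m)) (Y : 'M[R]_(n, m)) :
  pdmx (C^T *m A *m C) -> psdmx (1%:M - C^T *m C) ->
  Y^T *m Y = invmx (C^T *m A *m C) ->
  mxnorm b (isqrtmx (C^T *m A *m C) *m (1%:M - C^T *m C) *m isqrtmx (C^T *m A *m C)) =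
  mxnorm b (Y *m (1%:M - C^T *m C) *m Y^T).
Proof.
move=> pH pZ YY; have [sS SS Su SHS] := isqrtmx_spec pH.1 pH.2.
move: sS SS Su SHS; set S := isqrtmx _; move: S => S sS SS Su SHS.
move: pZ; move: (1%:M - _) => Z pZ.
have OO : (Y *m invmx S)^T *m (Y *m invmx S) = 1%:M.
  rewrite trmx_mul trmx_inv sS -mulmxA (mulmxA Y^T) YY -SS -mulmxA mulmxV// mulmx1.
  by rewrite mulVmx.
have pP : psdmx (S *m Z *m S) by have := psd_conj S pZ; rewrite sS.
rewrite -(mxnorm_conj b OO pP); congr mxnorm.
by rewrite trmx_mul trmx_inv sS !mulmxA mulmxKV// mulmxK.
Qed.

Lemma contractive_psd (R : realType) m n (C : 'M[R]_(n, m)) :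
  contractive C -> psdmx (1%:M - C^T *m C).
Proof.
move=> cC; split; first by rewrite linearB /= trmx1 trmx_mul trmxK.
move=> x; rewrite -mulmxA -[_ 0 0]/(dotv _ _) mulmxBl mul1mx dotvDr dotvNr subr_ge0.
by have := cC x; rewrite [X in X <= _]dotv_mulmx dotvC mulmxA.
Qed.

(* At the null vector h of L the weight (lambda + g)^-1/2 blows up, but there
   (I - C^T C) annihilates the corresponding vector up to O(g). *)
Lemma oblique_defect (R : realType) n (Q : 'M[R]_n) (p : 'cV[R]_n)
    (I : {set 'I_n}) (g : R) :
  reversible_rate_matrix Q p -> I != finset.set0 -> 0 < g ->
  let B := extension I (killed (laplacian Q p) g) in
  let C := symmetrize p (unsymmetrize p B) in
  (1%:M - C^T *m C) *m sqrtv (pihat p B) =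
  g *: (C^T *m (invmx (dirichlet I (killed (laplacian Q p) g))
                *m (1%:M - sel I *m (sel I)^T) *m sqrtv p)).
Proof.
move=> hQ I0 g0 B C; have p0 := stat_gt0 hQ.
have hh0 k := pihat_gt0_killed k hQ I0 g0.
have [_ dE] := delta_diag_unit p0 hh0.
have CE : C *m sqrtv (pihat p B) = B *m rows I (sqrtv p).
  by rewrite /C symmetrize_unsymmetrize// -mulmxA dE.
rewrite mulmxBl mul1mx -(mulmxA C^T C) CE [B *m _]extension_h// mulmxBr.
by rewrite (symmetrize_tr_h p0 hh0) opprB addrC subrK -scalemxAr.
Qed.

(** The inverse square root in Psi_gamma diverges, so Psi_gamma is replaced by the matrix [M g] of
    equal norm, written in the eigenbasis of L. Its entries are a_k a_l q_kl with a_l = (lambda_l +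
    g)^(-1/2) and q convergent, so all divergence sits in scalar weights at null eigenvalues, where
    [oblique_defect] supplies a factor g. *)
Theorem obliqueness_norm_cvg (b : norm_index) (R : realType) n (Q : 'M[R]_n)
    (p : 'cV[R]_n) (I : {set 'I_n}) : reversible_rate_matrix Q p -> I != finset.set0 ->
  mxnorm b (obliqueness_at (laplacian Q p) p I g) @[g --> 0^'+] -->
  obliqueness_norm b (laplacian Q p) p I.
Proof.
move=> hQ I0; have p0 := stat_gt0 hQ.
have sL := laplacian_sym hQ.
have [U [la [UU LE]]] := symmetric_spectral sL.
have UU' := mulmx1C UU.
have pL : psdmx (laplacian Q p).
  by split=> // x; rewrite -mulmxA -[_ 0 0]/(dotv _ _) laplacian_ge0.
have la0 := psd_eigen_ge0 pL UU LE.
pose B g := extension I (killed (laplacian Q p) g).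
pose B0 := extension I (laplacian Q p).
pose dl g := delta_diag p (B g); pose dl0 := delta_diag p B0.
pose C g := symmetrize p (unsymmetrize p (B g)).
pose C0 := symmetrize p (unsymmetrize p B0).
(* Chosen so that (C^T L_g C)^-1 = Wm diag(1 / (lambda + g)) Wm^T. *)
pose Wm g := invmx (dl g) *m (sel I)^T *m U.
pose Wm0 := invmx dl0 *m (sel I)^T *m U.
pose r g := (C g)^T *m (invmx (dirichlet I (killed (laplacian Q p) g))
                *m (1%:M - sel I *m (sel I)^T) *m sqrtv p).
pose r0 := C0^T *m (invmx (dirichlet I (laplacian Q p))
                *m (1%:M - sel I *m (sel I)^T) *m sqrtv p).
pose q g := (Wm g)^T *m (1%:M - (C g)^T *m C g) *m Wm g.
pose q0 := Wm0^T *m (1%:M - C0^T *m C0) *m Wm0.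
have dl0u : dl0 \in unitmx.
  by apply: (delta_diag_unit p0 _).1 => k; exact: pihat_gt0_laplacian.
have cC : mxcvg (0^'+) C C0.
  apply: mxcvg_near (symmetrize_cvg hQ I0); near=> g.
  have g0 : 0 < g by near: g; exact: nbhs_right_gt.
  by rewrite killed_committorE.
have cW : mxcvg (0^'+) Wm Wm0.
  apply: mxcvgM; last exact: mxcvg_cst.
  apply: mxcvgM; last exact: mxcvg_cst.
  by apply: mxcvg_inv => //; exact: delta_diag_cvg.
have cq : mxcvg (0^'+) q q0.
  apply: mxcvgM => //; apply: mxcvgM; first exact: mxcvgT.
  by apply: mxcvgB; [exact: mxcvg_cst|apply: mxcvgM => //; exact: mxcvgT].
have cr : mxcvg (0^'+) r r0.
  apply: mxcvgM; first exact: mxcvgT.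
  apply: mxcvgM; last exact: mxcvg_cst.
  by apply: mxcvgM; [exact: dirichlet_inv_cvg|exact: mxcvg_cst].
pose wr g := (Wm g)^T *m r g; pose wr0 := Wm0^T *m r0.
have cwr : mxcvg (0^'+) wr wr0 by apply: mxcvgM => //; exact: mxcvgT.
pose a g l := (Num.sqrt (la 0 l + g))^-1.
pose M g : 'M[R]_n := \matrix_(k, l) (a g k * a g l * q g k l).
have null l : la 0 l = 0 -> exists c, col l U = c *: sqrtv p.
  move=> l0; have : laplacian Q p *m col l U = 0.
    rewrite {1}LE colE -!mulmxA (mulmxA U^T) UU mul1mx.
    rewrite (_ : diag_mx la *m _ = 0) ?mulmx0//.
    apply/matrixP => i j; rewrite mul_diag_mx !mxE.
    by have [->|] := eqVneq i l; rewrite ?l0 ?mul0r// mulr0.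
  move=> Lu; have [i0 _] := set0Pn _ I0.
  have : dotv (col l U) (laplacian Q p *m col l U) = 0 by rewrite Lu dotv0.
  by move=> /(laplacian_eq0 i0 hQ) ->; eexists.
have qsym g k l : q g k l = q g l k.
  have : (q g)^T = q g.
    by apply: trmx_conj; rewrite linearB /= trmx1 trmx_mul trmxK.
  by move=> /matrixP/(_ k l); rewrite mxE => ->.
have qnull g l c : 0 < g -> col l U = c *: sqrtv p ->
    forall k, q g k l = g * (c * wr g k 0).
  move=> g0 Ul k.
  have hh0 j := pihat_gt0_killed j hQ I0 g0.
  have [du dE] : dl g \in unitmx /\ dl g *m sqrtv (pihat p (B g)) = rows I (sqrtv p).
    exact: delta_diag_unit.
  have Wl : col l (Wm g) = c *: sqrtv (pihat p (B g)).
    rewrite /Wm !colE -!mulmxA -colE Ul -!scalemxAr -rowsE; congr (_ *: _).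
    by rewrite -dE mulKmx.
  have -> : q g k l = (col l (q g)) k 0 by rewrite [RHS]mxE.
  have -> : col l (q g) = (Wm g)^T *m ((1%:M - (C g)^T *m C g) *m col l (Wm g)).
    exact: col_mul3.
  rewrite Wl -!scalemxAr (oblique_defect hQ I0 g0).
  have E3 (v : 'cV[R]_n) : (c *: (g *: v)) k 0 = g * (c * v k 0).
    by rewrite !mxE; ring.
  by rewrite -scalemxAr; exact: E3.
have cM : exists M0, mxcvg (0^'+) M M0.
  have ac l : la 0 l != 0 -> a g l @[g --> 0^'+] --> (Num.sqrt (la 0 l))^-1.
    move=> l0; apply: cvgV; first by rewrite gt_eqF// sqrtr_gt0 lt_neqAle eq_sym l0 la0.
    apply: continuous_cvg; first exact: sqrt_continuous.
    rewrite -[X in _ --> X]addr0; apply: cvgD; first exact: cvg_cst.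
    exact: cvg_at_right_filter.
  have sq0 : Num.sqrt g @[g --> 0^'+] --> (0 : R).
    rewrite -[X in _ --> X]sqrtr0; apply: continuous_cvg; first exact: sqrt_continuous.
    exact: cvg_at_right_filter.
  have ag g l : 0 < g -> la 0 l = 0 -> a g l * g = Num.sqrt g.
    move=> g0 l0; rewrite /a l0 add0r -[X in _ * X](sqr_sqrtr (ltW g0)) expr2.
    by rewrite mulKf// gt_eqF// sqrtr_gt0.
  have mixed k l : la 0 l = 0 -> la 0 k != 0 ->
      a g k * a g l * q g k l @[g --> 0^'+] --> (0 : R).
    move=> l0 k0; have [c Ul] := null _ l0.
    apply: (@cvg_near _ _ _ _ (fun g => a g k * (Num.sqrt g * (c * wr g k 0)))).
      near=> g; have g0 : 0 < g by near: g; exact: nbhs_right_gt.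
      by rewrite (qnull g l c g0 Ul) -(ag _ _ g0 l0); ring.
    have E0 : (Num.sqrt (la 0 k))^-1 * (0 * (c * wr0 k 0)) = 0 by rewrite mul0r mulr0.
    rewrite -[X in _ --> X]E0.
    apply: cvgM; [exact: (ac k k0)|].
    apply: cvgM => //; apply: cvgM; first exact: cvg_cst.
    exact: cwr.
  have entry k l : exists x : R, M g k l @[g --> 0^'+] --> x.
    have -> : (fun g => M g k l) = (fun g => a g k * a g l * q g k l).
      by apply/funext => g; rewrite mxE.
    (* For two null indices a_k a_l = 1 / g cancels the factor g of [q] exactly; for one null index
       sqrt g is left and the limit is 0; otherwise every factor converges. *)
    have [l0|l0] := eqVneq (la 0 l) 0; have [k0|k0] := eqVneq (la 0 k) 0.
    - have [c Ul] := null _ l0; exists (c * wr0 k 0).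
      apply: (@cvg_near _ _ _ _ (fun g => c * wr g k 0)).
        near=> g; have g0 : 0 < g by near: g; exact: nbhs_right_gt.
        rewrite (qnull g l c g0 Ul) (_ : _ * _ = a g k * (a g l * g) * (c * wr g k 0)); last by ring.
        by rewrite (ag _ _ g0 l0) /a k0 add0r mulVf ?mul1r// gt_eqF// sqrtr_gt0.
      by apply: cvgM; [exact: cvg_cst|exact: cwr].
    - by exists 0; exact: mixed.
    - exists 0; apply: cvg_near (mixed l k k0 l0); near=> g.
      by rewrite (qsym g k l) [a g l * _]mulrC.
    - exists ((Num.sqrt (la 0 k))^-1 * (Num.sqrt (la 0 l))^-1 * q0 k l).
      by apply: cvgM; [apply: cvgM; exact: ac|exact: cq].
  exists (\matrix_(k, l) xget 0 [set x | M g k l @[g --> 0^'+] --> x]) => k l.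
  rewrite mxE; exact: (@xgetPex _ 0 [set x | M g k l @[g --> 0^'+] --> x] (entry k l)).
have [M0 cM0] := cM.
have normE g : 0 < g -> psdmx (M g) /\
    mxnorm b (obliqueness_at (laplacian Q p) p I g) = mxnorm b (M g).
  move=> g0; have Du := dirichlet_killed_unit hQ (ltW g0) I0.
  have pA := killed_pd hQ g0.
  have hh0 j := pihat_gt0_killed j hQ I0 g0.
  have [du dE] : dl g \in unitmx /\ dl g *m sqrtv (pihat p (B g)) = rows I (sqrtv p).
    exact: delta_diag_unit.
  have CE : C g = B g *m dl g by exact: symmetrize_unsymmetrize.
  have cCg : contractive (C g).
    by have := killed_committor_contractive hQ g0 I0; rewrite killed_committorE.
  have pZ := contractive_psd cCg.
  have KE : invmx (killed (laplacian Q p) g) =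
      U *m diag_mx (map_mx GRing.inv (\row_i (la 0 i + g))) *m U^T.
    have AE : killed (laplacian Q p) g = U *m diag_mx (\row_i (la 0 i + g)) *m U^T.
      have -> : diag_mx (\row_i (la 0 i + g)) = diag_mx la + g%:M.
        by apply/matrixP => i j; rewrite !mxE -mulrnDl.
      by rewrite mulmxDr mulmxDl mul_mx_scalar -scalemxAl UU' scalemx1 -LE.
    rewrite AE diag_conj_inv// => i; rewrite mxE gt_eqF//.
    by rewrite ltr_wpDl.
  pose Y := diag_mx (\row_i a g i) *m (Wm g)^T.
  have ME : M g = Y *m (1%:M - (C g)^T *m C g) *m Y^T.
    rewrite /Y sandwich ?tr_diag_mx// -/(q g).
    apply/matrixP => k l; rewrite [LHS]mxE; move: (q g) => q1.
    by rewrite mul_mx_diag mul_diag_mx !mxE; ring.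
  have iu : invmx (dl g) \in unitmx by rewrite unitmx_inv.
  have [G GE] : exists G, G = (sel I)^T *m invmx (killed (laplacian Q p) g) *m sel I.
    by eexists.
  have pG : pdmx G.
    rewrite GE; apply: pdmx_conj; first exact: pdmx_inv.
    by move=> x /(congr1 (mulmx (sel I)^T)); rewrite mulmxA sel_tr_sel mul1mx mulmx0.
  have HE : (C g)^T *m killed (laplacian Q p) g *m C g = (dl g)^T *m invmx G *m dl g.
    rewrite CE conj_mul; congr (_ *m _ *m _).
    rewrite /B -(nystrom_extension pA Du) blockE -GE colsE conj_mul trmx_inv pG.1.1.
    rewrite (_ : _ *m (_ *m sel I) = G) ?mulVmx ?mul1mx ?pG.2//.
    by rewrite trmx_mul trmx_inv pA.1.1 mulmxKV ?pA.2// mulmxA GE.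
  have YY : Y^T *m Y = invmx ((C g)^T *m killed (laplacian Q p) g *m C g).
    rewrite HE (invmx_conj du pG.2).
    have DD : diag_mx (\row_i a g i) *m diag_mx (\row_i a g i) =
        diag_mx (map_mx GRing.inv (\row_i (la 0 i + g))).
      rewrite mulmx_diag; congr diag_mx; apply/rowP => i.
      by rewrite !mxE /a -invfM -expr2 sqr_sqrtr// addr_ge0 ?la0// ltW.
    rewrite /Y sandwich_tr ?tr_diag_mx// DD /Wm GE KE.
    by move: (invmx (dl g)) (diag_mx _) => J D; rewrite !trmx_mul trmxK !mulmxA.
  have pH : pdmx ((C g)^T *m killed (laplacian Q p) g *m C g).
    rewrite HE; apply: pdmx_conj; first exact: pdmx_inv.
    by move=> x /(congr1 (mulmx (invmx (dl g)))); rewrite mulKmx// mulmx0.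
  split; first by rewrite ME; have := psd_conj Y^T pZ; rewrite trmxK.
  rewrite ME -(obliqueness_conj b pH pZ YY) /obliqueness_at killed_committorE//.
have c : mxnorm b (obliqueness_at (laplacian Q p) p I g) @[g --> 0^'+] --> mxnorm b M0.
  apply: (@cvg_near _ _ _ _ (fun g => mxnorm b (M g))).
    near=> g; have g0 : 0 < g by near: g; exact: nbhs_right_gt.
    by rewrite (normE g g0).2.
  apply: mxnorm_cvg => //; near=> g; have g0 : 0 < g by near: g; exact: nbhs_right_gt.
  exact: (normE g g0).1.
by rewrite /obliqueness_norm (cvg_lim _ c).
Unshelve. all: by end_near. Qed.

(** * The committor is harmonic *)

Definition pr (R : realType) d (T : measurableType d)
    (P : probability T R) (E : set T) : R := fine (P E).

Lemma prK (R : realType) d (T : measurableType d)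
    (P : probability T R) (E : set T) : measurable E -> (pr P E)%:E = P E.
Proof. by move=> mE; rewrite /pr fineK// fin_num_measure. Qed.

Lemma pr_le (R : realType) d (T : measurableType d)
    (P : probability T R) (E F : set T) : measurable E -> measurable F ->
  E `<=` F -> pr P E <= pr P F.
Proof.
by move=> mE mF EF; rewrite -lee_fin !prK// le_measure// inE.
Qed.

Lemma pr_setC (R : realType) d (T : measurableType d)
    (P : probability T R) (E : set T) : measurable E -> pr P (~` E) = 1 - pr P E.
Proof.
move=> mE; apply: EFin_inj; rewrite prK; last exact: measurableC.
by rewrite EFinB prK// probability_setC.
Qed.

Lemma pr_setU (R : realType) d (T : measurableType d)
    (P : probability T R) (E F : set T) : measurable E -> measurable F ->
  E `&` F = set0 -> pr P (E `|` F) = pr P E + pr P F.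
Proof.
move=> mE mF EF; apply: EFin_inj; rewrite prK; last exact: measurableU.
by rewrite EFinD !prK// measureU.
Qed.

Lemma pr_split (R : realType) d (T : measurableType d)
    (P : probability T R) (n : nat) (Y : T -> 'I_n) (E : set T) :
  measurable E -> (forall a, measurable [set w | Y w = a]) ->
  pr P E = \sum_a pr P (E `&` [set w | Y w = a]).
Proof.
move=> mE mY; have mF a : measurable (E `&` [set w | Y w = a]) by exact: measurableI.
have EE : E = \big[setU/set0]_(a < n) (E `&` [set w | Y w = a]).
  apply/seteqP; split => w; rewrite -(bigcup_seq (index_enum _)) /=.
    by move=> Ew; exists (Y w) => //=; rewrite mem_index_enum.
  by move=> [a _ []].
apply: EFin_inj; rewrite prK// {1}EE measure_semi_additive_ord//; last 2 first.
- by move=> a b _ _ [w [[_ /= <-] [_ /= <-]]].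
- by apply: bigsetU_measurable => a _.
by rewrite -sumEFin; apply: eq_bigr => a _; rewrite prK.
Qed.

Lemma pr_nondecreasing_cvg (R : realType) d (T : measurableType d)
    (P : probability T R) (E : nat -> set T) : (forall i, measurable (E i)) ->
  (forall i j, (i <= j)%N -> E i `<=` E j) ->
  pr P (E i) @[i --> \oo] --> pr P (\bigcup_i E i).
Proof.
move=> mE ndE; have mU : measurable (\bigcup_i E i) by exact: bigcupT_measurable.
apply: fine_cvg; rewrite prK//.
apply: nondecreasing_cvg_mu => // i j ij; apply/subsetPset; exact: ndE.
Qed.

(** Convergence of probabilities from pointwise convergence of indicators: the tail intersections of
    [E] increase to [A], those of the complements increase to the complement of [A], and the
    probability of [E i] is squeezed in between. Measurability of [A] follows from the same
    description. *)
Lemma pr_cvg (R : realType) d (T : measurableType d)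
    (E : nat -> set T) (A : set T) : (forall i, measurable (E i)) ->
  (forall w, exists M, forall m, (M <= m)%N -> (E m w <-> A w)) ->
  measurable A /\
  forall P : probability T R, pr P (E i) @[i --> \oo] --> pr P A.
Proof.
move=> mE EA.
have lowE (F : nat -> set T) (B : set T) : (forall i, measurable (F i)) ->
    (forall w, exists M, forall m, (M <= m)%N -> (F m w <-> B w)) ->
    [/\ forall M, measurable (\bigcap_m F (M + m)%N),
        forall i j, (i <= j)%N -> \bigcap_m F (i + m)%N `<=` \bigcap_m F (j + m)%N &
        \bigcup_M \bigcap_m F (M + m)%N = B].
  move=> mF FB; split.
  - by move=> M; exact: bigcapT_measurable.
  - move=> i j ij w Fw m _; have := Fw (j - i + m)%N I.
    by rewrite addnA subnKC.
  - apply/seteqP; split => w /=.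
      move=> [M _ Fw]; have [M' FB'] := FB w.
      by apply/(FB' (M + M')%N); [rewrite leq_addl|exact: Fw].
    move=> Bw; have [M' FB'] := FB w; exists M' => // m _.
    by apply/(FB' (M' + m)%N) => //; rewrite leq_addr.
have [mL ndL LA] := lowE E A mE EA.
have mA : measurable A by rewrite -LA; exact: bigcupT_measurable.
split=> // P.
have mEC i : measurable (~` E i) by exact: measurableC.
have EAC w : exists M, forall m, (M <= m)%N -> ((~` E m) w <-> (~` A) w).
  have [M h] := EA w; exists M => m /h EAm; split => nE F; exact/nE/EAm.
have [mL' ndL' LA'] := lowE (fun i => ~` E i) (~` A) mEC EAC.
have c1 := @pr_nondecreasing_cvg _ _ _ P _ mL ndL; rewrite LA in c1.
have c2 := @pr_nondecreasing_cvg _ _ _ P _ mL' ndL'; rewrite LA' in c2.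
have c3 : 1 - pr P (\bigcap_m (~` E (i + m)%N)) @[i --> \oo] --> pr P A.
  rewrite (_ : pr P A = 1 - pr P (~` A)); last by rewrite pr_setC// opprB addrC subrK.
  by apply: cvgB => //; exact: cvg_cst.
apply: (squeeze_cvgr _ c1 c3); near=> i; apply/andP; split.
  by apply: pr_le => // w /(_ 0%N I); rewrite addn0.
rewrite lerBrDr -lerBrDl -pr_setC//; apply: pr_le => //.
by move=> w /(_ 0%N I); rewrite addn0.
Unshelve. all: by end_near. Qed.

Lemma measurable_pred (n : nat) d (T : measurableType d)
    (Y : T -> 'I_n) (G : pred 'I_n) :
  (forall a, measurable [set w | Y w = a]) -> measurable [set w | G (Y w)].
Proof.
move=> mY; rewrite (_ : [set w | G (Y w)] = \bigcup_(a in [set a | G a]) [set w | Y w = a]).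
  by apply: fin_bigcup_measurable => // a _; exact: mY.
by apply/seteqP; split=> [w Gw|w [a]]; [exists (Y w)|move=> Ga /= wa; rewrite -wa in Ga].
Qed.

(** The constraints are predicates rather than states, so that a fixed path and the avoidance of [I]
    are events of one form. *)
Definition cylinder (n : nat) (T : Type) (Y : nat -> T -> 'I_n)
    (G : nat -> pred 'I_n) (m : nat) : set T :=
  [set w | forall l, (l <= m)%N -> G l (Y l w)].

Lemma cylinder_measurable (n : nat) d (T : measurableType d)
    (Y : nat -> T -> 'I_n) (G : nat -> pred 'I_n) (m : nat) :
  (forall l a, measurable [set w | Y l w = a]) -> measurable (cylinder Y G m).
Proof.
move=> mY.
rewrite (_ : cylinder Y G m = \bigcap_(l in `I_m.+1) [set w | G l (Y l w)]).
  by apply: bigcap_measurable => [|l _]; [exists 0%N|exact: measurable_pred].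
by apply/seteqP; split.
Qed.

Record discrete_chain (R : realType) n (A : 'M[R]_n)
    d (T : measurableType d)
    (Pr : 'I_n -> probability T R) (Y : nat -> T -> 'I_n) : Prop := DiscreteChain {
  chain_measurable : forall l a, measurable [set w | Y l w = a] ;
  chain_initial : forall i, pr (Pr i) [set w | Y 0%N w = i] = 1 ;
  chain_path : forall i k (x : nat -> 'I_n),
    pr (Pr i) (cylinder Y (fun l => pred1 (x l)) k.+1) =
    pr (Pr i) (cylinder Y (fun l => pred1 (x l)) k) * A (x k) (x k.+1)
}.

Lemma pr0 (R : realType) d (T : measurableType d)
    (P : probability T R) : pr P set0 = 0.
Proof. by rewrite /pr measure0. Qed.

Lemma pr_cylinder_split (R : realType) n (A : 'M[R]_n)
    d (T : measurableType d)
    (Pr : 'I_n -> probability T R) (Y : nat -> T -> 'I_n) i (G : nat -> pred 'I_n) m j :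
  discrete_chain A Pr Y -> (j <= m)%N ->
  pr (Pr i) (cylinder Y G m) =
  \sum_(a | G j a) pr (Pr i) (cylinder Y (fun l => if l == j then pred1 a : pred _ else G l) m).
Proof.
move=> hY jm; have mY := chain_measurable hY.
rewrite (pr_split (Pr i) (cylinder_measurable G m mY) (mY j)).
rewrite [RHS]big_mkcond/=; apply: eq_bigr => a _.
case: ifPn => Ga.
  congr (pr _ _); apply/seteqP; split => w /=.
    move=> [wG wa] l lm; case: eqP => [->|_]; last exact: wG.
    by rewrite /= wa.
  move=> wG; have wa : Y j w = a by have := wG j jm; rewrite eqxx => /eqP.
  split=> // l lm; have := wG l lm; case: eqP => // -> _; by rewrite wa.
rewrite (_ : _ `&` _ = set0) ?pr0//; apply/seteqP; split => w //= -[wG wa].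
by move: Ga; rewrite -wa wG.
Qed.

(** The chain axiom speaks of fully specified paths. The induction is on an index [j] from which on
    the constraints are single states; the constraint at time [j] is resolved by total
    probability. *)
Lemma cylinder_markov (R : realType) n (A : 'M[R]_n)
    d (T : measurableType d)
    (Pr : 'I_n -> probability T R) (Y : nat -> T -> 'I_n) i (G : nat -> pred 'I_n) m x y :
  discrete_chain A Pr Y -> G m = pred1 x -> G m.+1 = pred1 y ->
  pr (Pr i) (cylinder Y G m.+1) = pr (Pr i) (cylinder Y G m) * A x y.
Proof.
move=> hY Gx Gy.
suff H j (G' : nat -> pred 'I_n) : (j <= m)%N -> (forall l, (j <= l <= m.+1)%N -> exists a, G' l = pred1 a :> pred _) ->
    G' m = pred1 x -> G' m.+1 = pred1 y ->
    pr (Pr i) (cylinder Y G' m.+1) = pr (Pr i) (cylinder Y G' m) * A x y.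
  apply: (H m) => // l /andP[ml]; rewrite leq_eqVlt => /predU1P[->|]; first by exists y.
  by rewrite ltnS => lm; exists x; rewrite (_ : l = m)//; apply/eqP; rewrite eqn_leq lm.
elim: j G' => [|j IH] G' jm.
  move=> sG Gm GS.
  (* For [l <= m.+1] each constraint is a single state, so the default [x] is not reached there. *)
  pose c l := if l == m.+1 then y else if l == m then x else odflt x [pick a | G' l a].
  have E l : (l <= m.+1)%N -> G' l = pred1 (c l).
    move=> lm; have [a aE] := sG l lm.
    rewrite /c; case: eqP => [->//|_]; case: eqP => [->//|_]; rewrite aE.
    by case: pickP => [b /eqP->//|/(_ a)]; rewrite /= eqxx.
  have ES k : (k <= m.+1)%N -> cylinder Y G' k = cylinder Y (fun l => pred1 (c l)) k.
    move=> km; apply/seteqP; split => w h l lk; have := h l lk;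
      by rewrite E// (leq_trans lk).
  rewrite !ES// (chain_path hY); congr (_ * A _ _); rewrite /c ?eqxx//.
  by rewrite eqn_leq ltnn andbF.
move=> sG Gm GS.
rewrite (pr_cylinder_split i G' hY (ltnW (leq_trans jm (leqnSn m)))).
rewrite (pr_cylinder_split i G' hY (ltnW jm)) mulr_suml; apply: eq_bigr => a _.
have mj : (m == j) = false by rewrite gtn_eqF.
have mSj : (m.+1 == j) = false by rewrite gtn_eqF// ltnW.
apply: IH => [|l /andP[jl lm]||]; rewrite ?mj ?mSj//; first exact: ltnW.
have [lj|lj] := eqVneq l j; first by exists a.
by apply: sG; rewrite lm andbT ltn_neqAle jl andbT eq_sym.
Qed.

(** The state [y] may lie outside [I]: the event is then survival up to time [m] in the state [y],
    which the recursion [first_visitS] needs. *)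
Definition first_visit (n : nat) (T : Type) (Y : nat -> T -> 'I_n) (I : {set 'I_n})
    (m : nat) (y : 'I_n) : set T :=
  cylinder Y (fun l => if l == m then pred1 y : pred _ else [pred z | z \notin I]) m.

Lemma first_visitP (n : nat) (T : Type) (Y : nat -> T -> 'I_n) (I : {set 'I_n})
    (m : nat) (y : 'I_n) w :
  first_visit Y I m y w <-> (forall l, (l < m)%N -> Y l w \notin I) /\ Y m w = y.
Proof.
split=> [h|[h <-] l].
  split=> [l lm|]; last by have := h m (leqnn m); rewrite eqxx => /eqP.
  by have := h l (ltnW lm); rewrite ltn_eqF.
rewrite leq_eqVlt => /predU1P[->|lm]; first by rewrite eqxx /=.
by rewrite ltn_eqF//= h.
Qed.

Lemma first_visit0 (R : realType) n (A : 'M[R]_n)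
    d (T : measurableType d)
    (Pr : 'I_n -> probability T R) (Y : nat -> T -> 'I_n) (I : {set 'I_n}) i y :
  discrete_chain A Pr Y -> pr (Pr i) (first_visit Y I 0 y) = (y == i)%:R.
Proof.
move=> hY; have mY := chain_measurable hY.
have E z : first_visit Y I 0 z = [set w | Y 0%N w = z].
  by apply/seteqP; split => w; rewrite first_visitP => //= -[].
rewrite E; have [->|yi] := eqVneq; first exact: chain_initial hY _.
have h : pr (Pr i) [set w | Y 0%N w = y] <= pr (Pr i) (~` [set w | Y 0%N w = i]).
  apply: pr_le => //; first exact: measurableC.
  by move=> w /= -> /eqP; rewrite (negbTE yi).
rewrite /= mulr0n; apply/eqP; rewrite eq_le; apply/andP; split.
  by rewrite (le_trans h)// pr_setC// (chain_initial hY) subrr.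
by rewrite -(pr0 (Pr i)); apply: pr_le => // w.
Qed.

Lemma first_visitS (R : realType) n (A : 'M[R]_n)
    d (T : measurableType d)
    (Pr : 'I_n -> probability T R) (Y : nat -> T -> 'I_n) (I : {set 'I_n}) i m y :
  discrete_chain A Pr Y -> pr (Pr i) (first_visit Y I m.+1 y) =
  \sum_(z | z \notin I) pr (Pr i) (first_visit Y I m z) * A z y.
Proof.
move=> hY; rewrite /first_visit (pr_cylinder_split i _ hY (leqnSn m)).
have mS : (m == m.+1) = false by rewrite ltn_eqF.
have Sm : (m.+1 == m) = false by rewrite gtn_eqF.
apply: eq_big => [z|z]; rewrite mS// => zI.
rewrite (cylinder_markov (x := z) (y := y) i hY) ?eqxx ?Sm//; congr (_ * _).
congr (pr _ _); apply/seteqP; split => w h l lm; have := h l lm.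
  by case: eqP => // _; rewrite ltn_eqF.
by case: eqP => // _; rewrite ltn_eqF.
Qed.

(** The Markov property acts at the last step; induction on [m] converts the last-step recursion
    into a first-step one. *)
Lemma first_visit_step (R : realType) n (A : 'M[R]_n)
    d (T : measurableType d)
    (Pr : 'I_n -> probability T R) (Y : nat -> T -> 'I_n) (I : {set 'I_n}) i m y :
  discrete_chain A Pr Y -> i \notin I -> pr (Pr i) (first_visit Y I m.+1 y) =
  \sum_j A i j * pr (Pr j) (first_visit Y I m y).
Proof.
move=> hY iI; elim: m y => [|m IH] y.
  rewrite (first_visitS _ _ _ _ hY).
  under eq_bigr do rewrite (first_visit0 _ _ _ hY).
  under [RHS]eq_bigr do rewrite (first_visit0 _ _ _ hY).
  rewrite (bigD1 i)//= eqxx mul1r big1 ?addr0; last first.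
    by move=> z /andP[_ /negbTE->]; rewrite mul0r.
  rewrite (bigD1 y)//= eqxx mulr1 big1 ?addr0// => z /negbTE.
  by rewrite eq_sym => ->; rewrite mulr0.
rewrite (first_visitS _ _ _ _ hY).
under eq_bigr do rewrite IH mulr_suml.
rewrite exchange_big/=; apply: eq_bigr => j _.
by rewrite (first_visitS _ _ _ _ hY) mulr_sumr; apply: eq_bigr => z _; rewrite mulrA.
Qed.

Lemma first_visit_start (R : realType) n (A : 'M[R]_n)
    d (T : measurableType d)
    (Pr : 'I_n -> probability T R) (Y : nat -> T -> 'I_n) (I : {set 'I_n}) i m y :
  discrete_chain A Pr Y -> i \in I -> pr (Pr i) (first_visit Y I m.+1 y) = 0.
Proof.
move=> hY iI; elim: m y => [|m IH] y; rewrite (first_visitS _ _ _ _ hY) big1// => z zI.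
  rewrite (first_visit0 _ _ _ hY); case: eqVneq zI => [->|_ _]; first by rewrite iI.
  by rewrite mul0r.
by rewrite IH mul0r.
Qed.

Definition hits_at (n : nat) (T : Type) (Y : nat -> T -> 'I_n) (I : {set 'I_n})
    (y : 'I_n) : set T := \bigcup_m first_visit Y I m y.

Lemma hits_at_measurable (R : realType) n (A : 'M[R]_n)
    d (T : measurableType d)
    (Pr : 'I_n -> probability T R) (Y : nat -> T -> 'I_n) (I : {set 'I_n}) y :
  discrete_chain A Pr Y -> measurable (hits_at Y I y).
Proof.
move=> hY; apply: bigcupT_measurable => m.
exact: cylinder_measurable (chain_measurable hY).
Qed.

Lemma hits_at_cvg (R : realType) n (A : 'M[R]_n)
    d (T : measurableType d)
    (Pr : 'I_n -> probability T R) (Y : nat -> T -> 'I_n) (I : {set 'I_n}) i y :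
  discrete_chain A Pr Y -> y \in I ->
  \sum_(m < N) pr (Pr i) (first_visit Y I m y) @[N --> \oo] --> pr (Pr i) (hits_at Y I y).
Proof.
move=> hY yI.
have mf m : measurable (first_visit Y I m y).
  exact: cylinder_measurable (chain_measurable hY).
pose E N := \bigcup_(m in `I_N) first_visit Y I m y.
have ES N : E N.+1 = E N `|` first_visit Y I N y.
  apply/seteqP; split => w /=.
    move=> [m /=]; rewrite ltnS leq_eqVlt => /predU1P[->|mN] h; first by right.
    by left; exists m.
  by move=> [[m /= mN h]|h]; [exists m => //=; exact: ltnW|exists N => /=].
have mE N : measurable (E N) by exact: bigcup_measurable.
have UE : hits_at Y I y = \bigcup_N E N.
  apply/seteqP; split => w; first by move=> [m _ h]; exists m.+1 => //; exists m => /=.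
  by move=> [N _ [m _ h]]; exists m.
have EE N : \sum_(m < N) pr (Pr i) (first_visit Y I m y) = pr (Pr i) (E N).
  elim: N => [|N IH].
    rewrite big_ord0 (_ : E 0%N = set0) ?pr0//; apply/seteqP; split => w //.
    by move=> [m].
  rewrite big_ord_recr/= IH ES pr_setU//.
  apply/seteqP; split => w //= -[[m /= mN]] /first_visitP[_ wm] /first_visitP[/(_ m mN)].
  by rewrite wm yI.
under eq_fun do rewrite EE.
rewrite UE; apply: pr_nondecreasing_cvg => // N N' NN' w [m /= mN h].
by exists m => //=; exact: leq_trans NN'.
Qed.

(** The term m = 0 vanishes since [i] is off [I], so the series shifted by one is the first-step
    image of the series itself. *)
Lemma hits_at_harmonic (R : realType) n (A : 'M[R]_n)
    d (T : measurableType d)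
    (Pr : 'I_n -> probability T R) (Y : nat -> T -> 'I_n) (I : {set 'I_n}) i y :
  discrete_chain A Pr Y -> y \in I -> i \notin I ->
  pr (Pr i) (hits_at Y I y) = \sum_j A i j * pr (Pr j) (hits_at Y I y).
Proof.
move=> hY yI iI.
have c1 := hits_at_cvg (i := i) hY yI; rewrite -cvg_shiftS /= in c1.
have c2 : \sum_j A i j * (\sum_(m < N) pr (Pr j) (first_visit Y I m y)) @[N --> \oo] -->
    \sum_j A i j * pr (Pr j) (hits_at Y I y).
  apply: cvg_bigsum => j _; apply: cvgM; [exact: cvg_cst|exact: (hits_at_cvg hY yI)].
rewrite -(cvg_lim _ c1)// -(cvg_lim _ c2)//; congr (limn _); apply/funext => N.
rewrite big_ord_recl (first_visit0 _ _ _ hY).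
rewrite (_ : (y == i) = false) ?add0r; last by apply/eqP => yi; rewrite -yi yI in iI.
under eq_bigr do rewrite (first_visit_step _ _ hY iI).
by rewrite exchange_big/=; apply: eq_bigr => j _; rewrite mulr_sumr.
Qed.

Lemma hits_at_boundary (R : realType) n (A : 'M[R]_n)
    d (T : measurableType d)
    (Pr : 'I_n -> probability T R) (Y : nat -> T -> 'I_n) (I : {set 'I_n}) i y :
  discrete_chain A Pr Y -> y \in I -> i \in I ->
  pr (Pr i) (hits_at Y I y) = (y == i)%:R.
Proof.
move=> hY yI iI.
have c1 := hits_at_cvg (i := i) hY yI; rewrite -cvg_shiftS /= in c1.
rewrite -(cvg_lim _ c1)//.
rewrite (_ : (fun _ => _) = fun=> (y == i)%:R) ?lim_cst//; apply/funext => N.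
rewrite big_ord_recl (first_visit0 _ _ _ hY) big1 ?addr0// => m _.
by rewrite (first_visit_start _ _ hY iI).
Qed.

(** * Hitting times in continuous time and their approximation by skeletons *)

Lemma hitting_time_exists (R : realType) n (T : Type)
    (X : R -> T -> 'I_n) (I : {set 'I_n}) (w : T) :
  (forall t, 0 <= t -> \forall s \near t^'+, X s w = X t w) ->
  (exists2 s, 0 <= s & X s w \in I) -> exists t, is_hitting_time X I w t.
Proof.
move=> rc [s0 s00 s0I].
pose S := [set s | 0 <= s /\ X s w \in I].
have S0 : S !=set0 by exists s0.
have lbS : has_lbound S by exists 0 => s [].
have iS : has_inf S by split.
have t0 : 0 <= inf S by apply: lb_le_inf => // s [].
exists (inf S); split=> //; last first.
  move=> s s0' sS; apply/negP => sI; move: sS; rewrite ltNge => /negP; apply.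
  by apply: ge_inf.
(* The path is constant just to the right of the infimum, and some time in [S] falls there, so the
   infimum is attained. *)
have [e /= e0 he] := rc _ t0.
have [s [s0' sI] se] := inf_adherent e0 iS.
have : inf S <= s by apply: ge_inf => //; split.
rewrite le_eqVlt => /predU1P[->//|ts]; rewrite -(he s)//=.
by rewrite ltr_distlC; apply/andP; split; lra.
Qed.

Lemma hitting_time_unique (R : realType) n (T : Type)
    (X : R -> T -> 'I_n) (I : {set 'I_n}) (w : T) (s t : R) :
  is_hitting_time X I w s -> is_hitting_time X I w t -> s = t.
Proof.
move=> [s0 sI sm] [t0 tI tm]; have [st|ts|//] := ltgtP s t.
  by have := tm s s0 st; rewrite sI.
by have := sm t t0 ts; rewrite tI.
Qed.

Definition skeleton (R : realType) n (T : Type)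
    (X : R -> T -> 'I_n) (e : R) (l : nat) (w : T) : 'I_n := X (l%:R * e) w.

Lemma skeleton_chain (R : realType) n (Q : 'M[R]_n)
    d (T : measurableType d)
    (Pr : 'I_n -> probability T R) (X : R -> T -> 'I_n) (e : R) :
  is_ctmc Q Pr X -> 0 <= e -> discrete_chain (expmx (e *: Q)) Pr (skeleton X e).
Proof.
move=> hX e0.
have mY l a : measurable [set w | skeleton X e l w = a].
  by apply: (ctmc_measurable hX); rewrite mulr_ge0.
split=> // [i|i k x].
  have := ctmc_initial hX i; rewrite /pr /skeleton.
  under [X in _ -> fine (_ X) = _]eq_set do rewrite mul0r.
  by move=> ->.
have CE m : cylinder (skeleton X e) (fun l => pred1 (x l)) m =
    [set w | forall l, (l <= m)%N -> X (l%:R * e) w = x l].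
  by apply/seteqP; split => w h l lm; apply/eqP; [exact: h|rewrite /= -(h l lm)].
apply: EFin_inj; rewrite EFinM !prK; try exact: cylinder_measurable.
rewrite !CE (@ctmc_markov _ _ _ _ _ _ _ hX i k (fun l => l%:R * e) x).
- by rewrite -mulrBl -natrB// subSnn mul1r.
- by rewrite mul0r.
- by move=> l; rewrite ler_wpM2r// ler_nat.
Qed.

(** After the hitting time t the path keeps its value on some [t, t + e[, so a grid of mesh below e
    has a point there, and its first point from t on sees the hitting state. Earlier grid points
    precede t and avoid [I]. The threshold [M] depends on the path. *)
Lemma skeleton_hits (R : realType) n (T : Type)
    (X : R -> T -> 'I_n) (I : {set 'I_n}) (w : T) (y : 'I_n) :
  (forall t, 0 <= t -> \forall s \near t^'+, X s w = X t w) -> y \in I ->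
  exists M, forall m, (M <= m)%N ->
    (hits_at (skeleton X m.+1%:R^-1) I y w <->
     exists2 t, is_hitting_time X I w t & X t w = y).
Proof.
move=> rc yI.
have [hit|nohit] := pselect (exists2 s, 0 <= s & X s w \in I); last first.
  exists 0%N => m _; split.
    move=> [j _ /first_visitP[_ jy]]; case: nohit.
    by exists (j%:R * m.+1%:R^-1); [rewrite mulr_ge0|move: yI; rewrite -jy].
  by move=> [t [t0 tI _] _]; case: nohit; exists t.
have [t tH] := hitting_time_exists rc hit.
have [t0 tI tm] := tH.
have [e /= e0 he] := rc _ t0.
have [M Me] : exists M : nat, M.+1%:R^-1 < e.
  by exists (Num.truncn e^-1); rewrite invf_plt ?posrE// truncnS_gt.
exists M => m Mm; set q : R := m.+1%:R^-1.
have q0 : 0 < q by rewrite invr_gt0.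
have qe : q < e by apply: le_lt_trans Me; rewrite lef_pV2 ?posrE// ler_nat.
have ex : exists j, t <= j%:R * q.
  exists (Num.truncn (t * m.+1%:R)).+1.
  by rewrite ler_pdivlMr// ltW// truncnS_gt.
pose j := ex_minn ex.
have [tj jmin] : t <= j%:R * q /\ forall l, (l < j)%N -> l%:R * q < t.
  rewrite /j; case: ex_minnP => j' tj' mj'; split=> // l lj.
  by rewrite ltNge; apply/negP => /mj'; rewrite leqNgt lj.
have jE : X (j%:R * q) w = X t w.
  move: tj; rewrite le_eqVlt => /predU1P[<-//|tj]; apply: he => //=.
  rewrite ltr_distlC; apply/andP; split; first by lra.
  case: (j) jmin tj => [|j'] jmin tj; first by rewrite mul0r in tj *; lra.
  by have := jmin j' (ltnSn _); rewrite -[j'.+1]addn1 natrD mulrDl mul1r; lra.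
have nI l : (l < j)%N -> X (l%:R * q) w \notin I.
  by move=> /jmin lt; apply: tm => //; apply: mulr_ge0 => //; exact: ltW.
split.
  move=> [k _ /first_visitP[kI ky]]; exists t => //; rewrite -jE.
  have [kj|jk|<-//] := ltngtP k j.
    by have := nI k kj; rewrite -/(skeleton X q k w) ky yI.
  by have := kI j jk; rewrite /skeleton jE tI.
move=> [t' tH' <-]; rewrite (hitting_time_unique tH' tH).
by exists j => //; apply/first_visitP; split.
Qed.

Lemma cvg_harmonic_dnbhs (R : realType) :
  (m.+1%:R^-1 : R) @[m --> \oo] --> (0 : R)^'.
Proof.
move=> A /= A0; suff : \forall m \near \oo, A (m.+1%:R^-1 : R) by [].
have : \forall m \near \oo, (m.+1%:R^-1 : R) != 0 -> A (m.+1%:R^-1 : R).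
  exact: (@cvg_harmonic R) _ A0.
by apply: filterS => m; apply; rewrite invr_eq0.
Qed.

Lemma expR_slope_cvg (R : realType) (d : R) :
  (m.+1%:R^-1)^-1 * (expR (m.+1%:R^-1 * d) - 1) @[m --> \oo] --> d.
Proof.
have D : is_derive (0 : R) 1 (fun v : R => expR (0 + d * v)) d.
  by apply: (der_eq (der_exp_affine d 0 0)); rewrite mulr0 addr0 expR0 mulr1.
have E := @derive_val _ _ _ _ _ _ _ D.
have c : h^-1 *: (expR (0 + d * (h *: 1 + 0)) - expR (0 + d * 0)) @[h --> 0^'] --> d.
  by rewrite -[X in _ --> X]E; exact: (@ex_derive _ _ _ _ _ _ _ D).
have := cvg_comp _ _ (@cvg_harmonic_dnbhs R) c; apply: cvg_trans.
apply: near_eq_cvg; near=> m.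
by rewrite /= addr0 mulr0 !add0r expR0 [_ *: 1]mulr1 [d * _]mulrC.
Unshelve. all: by end_near. Qed.

Lemma rate_diag (R : realType) n (Q : 'M[R]_n) (p : 'cV[R]_n) :
  reversible_rate_matrix Q p ->
  exists (S Si : 'M[R]_n) (d : 'rV[R]_n), Si *m S = 1%:M /\ Q = S *m diag_mx d *m Si.
Proof.
move=> hQ; have [U [d [UU LE]]] := symmetric_spectral (laplacian_sym hQ).
have hn i : sqrtv p i 0 != 0 by rewrite gt_eqF// sqrtv_gt0// (stat_gt0 hQ).
have [Hu _] := diagc_inv hn; move: LE; rewrite /laplacian.
move: (diagc _) Hu => H Hu LE.
exists (invmx H *m U), (U^T *m H), (- d); split.
  by rewrite mulmxA -(mulmxA U^T) mulmxV// mulmx1.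
rewrite linearN /= mulmxN mulNmx -!mulmxA (mulmxA U) (mulmxA _ U^T) -LE.
by rewrite mulNmx mulmxN opprK mulmxKV// mulKmx.
Qed.

Lemma rate_slope_cvg (R : realType) n (Q : 'M[R]_n) (p : 'cV[R]_n) i j :
  reversible_rate_matrix Q p ->
  (m.+1%:R^-1)^-1 * (expmx (m.+1%:R^-1 *: Q) i j - (i == j)%:R) @[m --> \oo] --> Q i j.
Proof.
move=> hQ; have [S [Si [d [SS QE]]]] := rate_diag hQ.
have SS' := mulmx1C SS.
have tri (v : 'rV[R]_n) : (S *m diag_mx v *m Si) i j = \sum_k v 0 k * (S i k * Si k j).
  by rewrite mxE; apply: eq_bigr => k _; rewrite mul_mx_diag mxE mulrCA mulrA.
have E m : (m.+1%:R^-1)^-1 * (expmx (m.+1%:R^-1 *: Q) i j - (i == j)%:R) =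
    \sum_k ((m.+1%:R^-1)^-1 * (expR (m.+1%:R^-1 * d 0 k) - 1)) * (S i k * Si k j).
  have -> : (i == j)%:R = \sum_k S i k * Si k j.
    by have := congr1 (fun M : 'M[R]_n => M i j) SS'; rewrite !mxE => ->.
  rewrite {1}QE scalemxAl scalemxAr.
  have -> : m.+1%:R^-1 *: diag_mx d = diag_mx (m.+1%:R^-1 *: d) by rewrite linearZ.
  rewrite diag_conj_exp// tri -sumrB mulr_sumr; apply: eq_bigr => k _.
  by rewrite !mxE -mulrA mulrBl mul1r.
under eq_fun do rewrite E.
rewrite QE tri; apply: cvg_bigsum => k _; apply: cvgM; last exact: cvg_cst.
exact: expR_slope_cvg.
Qed.

Lemma committor_prE (R : realType) n
    d (T : measurableType d)
    (Pr : 'I_n -> probability T R) (X : R -> T -> 'I_n) (I : {set 'I_n}) i k :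
  committor Pr X I i k =
  pr (Pr i) [set w | exists2 t, is_hitting_time X I w t & X t w = enum_val k].
Proof. by rewrite mxE. Qed.

Lemma skeleton_hits_cvg (R : realType) n (Q : 'M[R]_n)
    d (T : measurableType d)
    (Pr : 'I_n -> probability T R) (X : R -> T -> 'I_n) (I : {set 'I_n}) i k :
  is_ctmc Q Pr X ->
  pr (Pr i) (hits_at (skeleton X m.+1%:R^-1) I (enum_val k)) @[m --> \oo] -->
  committor Pr X I i k.
Proof.
move=> hX; rewrite committor_prE.
have mE m : measurable (hits_at (skeleton X m.+1%:R^-1) I (enum_val k)).
  by apply: hits_at_measurable (skeleton_chain hX _).
have EA w := skeleton_hits (ctmc_right_continuous hX w) (enum_valP k).
have [_] := pr_cvg R mE EA; exact.
Qed.

Lemma committor_boundary (R : realType) n (Q : 'M[R]_n)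
    d (T : measurableType d)
    (Pr : 'I_n -> probability T R) (X : R -> T -> 'I_n) (I : {set 'I_n}) k l :
  is_ctmc Q Pr X -> committor Pr X I (enum_val k) l = (k == l)%:R.
Proof.
move=> hX; have c := skeleton_hits_cvg (i := enum_val k) (k := l) hX.
rewrite -(cvg_lim _ c)// (_ : (fun _ => _) = fun=> (k == l)%:R) ?lim_cst//.
apply/funext => m.
have hY : discrete_chain (expmx (m.+1%:R^-1 *: Q)) Pr (skeleton X m.+1%:R^-1).
  exact: skeleton_chain.
by rewrite (hits_at_boundary hY) ?enum_valP// (inj_eq enum_val_inj) eq_sym.
Qed.

(** At [i] the difference quotient (e^(eQ) - 1) / e annihilates the hitting probabilities of the
    skeleton of mesh e exactly, so the sequence converging to Q times the committor is constantly
    zero. *)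
Lemma committor_harmonic (R : realType) n (Q : 'M[R]_n) (p : 'cV[R]_n)
    d (T : measurableType d)
    (Pr : 'I_n -> probability T R) (X : R -> T -> 'I_n) (I : {set 'I_n}) i k :
  reversible_rate_matrix Q p -> is_ctmc Q Pr X -> i \notin I ->
  (Q *m committor Pr X I) i k = 0.
Proof.
move=> hQ hX iI.
pose e m : R := m.+1%:R^-1.
pose v m j := pr (Pr j) (hits_at (skeleton X (e m)) I (enum_val k)).
have c : \sum_j ((e m)^-1 * (expmx (e m *: Q) i j - (i == j)%:R)) * v m j
    @[m --> \oo] --> (Q *m committor Pr X I) i k.
  rewrite mxE; apply: cvg_bigsum => j _; apply: cvgM; first exact: rate_slope_cvg hQ.
  exact: skeleton_hits_cvg hX.
rewrite -(cvg_lim _ c)// (_ : (fun _ => _) = fun=> 0) ?lim_cst//.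
apply/funext => m.
have hY : discrete_chain (expmx (e m *: Q)) Pr (skeleton X (e m)).
  by apply: skeleton_chain => //; rewrite /e invr_ge0.
under eq_bigr do rewrite -mulrA mulrBl.
rewrite -mulr_sumr sumrB -(hits_at_harmonic hY (enum_valP k) iI).
rewrite (bigD1 i)//= eqxx mul1r big1 ?addr0 ?subrr ?mulr0// => j /negbTE.
by rewrite eq_sym => ->; rewrite mul0r.
Qed.

Lemma committor_extension (R : realType) n (Q : 'M[R]_n) (p : 'cV[R]_n)
    d (T : measurableType d)
    (Pr : 'I_n -> probability T R) (X : R -> T -> 'I_n) (I : {set 'I_n}) :
  reversible_rate_matrix Q p -> is_ctmc Q Pr X -> I != finset.set0 ->
  committor Pr X I = unsymmetrize p (extension I (laplacian Q p)).
Proof.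
move=> hQ hX I0; have p0 := stat_gt0 hQ.
have h0 i := sqrtv_gt0 (p0 i).
pose B := \matrix_(i < n, k < #|I|)
  (sqrtv p i 0 * committor Pr X I i k / sqrtv p (enum_val k) 0).
have BE i k : B i k = sqrtv p i 0 * committor Pr X I i k / sqrtv p (enum_val k) 0.
  by rewrite mxE.
rewrite -(extension_unique (dirichlet_laplacian_unit hQ I0) (B := B)).
- apply/matrixP => i k; rewrite unsymmetrizeE// BE.
  by have := h0 i; have := h0 (enum_val k) => ? ?; field; rewrite !gt_eqF.
- move=> k l; rewrite BE (committor_boundary _ _ hX).
  have [->|_] := eqVneq k l; last by rewrite mulr0 mul0r.
  by rewrite mulr1 mulfV// gt_eqF.
- move=> i k iI; have := committor_harmonic k hQ hX iI; rewrite !mxE => E.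
  rewrite -[RHS](mulr0 (- (sqrtv p i 0 / sqrtv p (enum_val k) 0))) -[X in _ = _ * X]E mulr_sumr.
  apply: eq_bigr => j _; rewrite BE laplacianE//.
  by have := h0 j; have := h0 (enum_val k) => ? ?; field; rewrite !gt_eqF.
Qed.

(** * Passage to the limit *)

Lemma dual_ball0 (b : norm_index) (R : realType) m n :
  dual_ball b (0 : 'M[R]_(m, n)).
Proof.
case: b => /= [|x]; last by rewrite mul0mx dotv0 dotv_ge0.
by exists 0, 0; rewrite mul0mx !dotv0 ler01.
Qed.

Lemma dual_ballN (b : norm_index) (R : realType) m n (W : 'M[R]_(m, n)) :
  dual_ball b W -> dual_ball b (- W).
Proof.
case: b => /= [[x [y [x1 y1 ->]]]|cW x]; last by rewrite mulNmx dotvNr dotvNl opprK.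
exists (- x), y; rewrite mulNmx; split=> //.
by rewrite dotvNr dotvNl opprK.
Qed.

Lemma expmx_sym (R : realType) n (A : 'M[R]_n) (t : R) : A^T = A ->
  (expmx (- (t *: A)))^T = expmx (- (t *: A)).
Proof.
move=> sA; have [U [d [UU ->]]] := symmetric_spectral sA.
by rewrite diag_conj_expN// !trmx_mul trmxK tr_diag_mx mulmxA.
Qed.

Lemma sp_compression_sym (R : realType) n m (L : 'M[R]_n) (C : 'M[R]_(n, m))
    (t : R) : L^T = L -> (sp_compression L C t)^T = sp_compression L C t.
Proof.
move=> sL; rewrite /sp_compression !trmx_mul trmxK expmx_sym ?mulmxA//.
by rewrite !trmx_mul trmxK sL mulmxA.
Qed.

(** [W] stays fixed while gamma -> 0, so on the left only traces have to converge; norms have to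
    converge on the right alone. *)
Lemma compression_bounds (b : norm_index) (R : realType) n (Q : 'M[R]_n)
    (p : 'cV[R]_n) (I : {set 'I_n}) (W : 'M[R]_n) (t : R) :
  reversible_rate_matrix Q p -> I != finset.set0 -> 0 < t -> dual_ball b W ->
  \tr (W^T *m (sp_compression (laplacian Q p)
                 (symmetrize p (unsymmetrize p (extension I (laplacian Q p)))) t
               - proj_compression (laplacian Q p) I t)) <=
    47 / 80 * (obliqueness_norm b (laplacian Q p) p I / t) /\
  \tr (W^T *m (expmx (- (t *: laplacian Q p)) - proj_compression (laplacian Q p) I t)) <=
    35 / 48 * (nystrom_error b (laplacian Q p) I / t).
Proof.
move=> hQ I0 t0 bW.
have cP := proj_compression_cvg hQ I0 t0.
have tr_cvg (A : R -> 'M[R]_n) A0 : mxcvg (0^'+) A A0 ->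
    \tr (W^T *m (A g - proj_compression_at (laplacian Q p) I t g)) @[g --> 0^'+] -->
    \tr (W^T *m (A0 - proj_compression (laplacian Q p) I t)).
  move=> cA; apply: mxcvg_tr; apply: mxcvgM; first exact: mxcvg_cst.
  exact: mxcvgB.
split.
- have c1 := tr_cvg _ _ (sp_compression_cvg hQ I0 t0).
  have c2 : 47 / 20 * (4^-1 * mxnorm b (obliqueness_at (laplacian Q p) p I g)) / t
      @[g --> 0^'+] --> 47 / 20 * (4^-1 * obliqueness_norm b (laplacian Q p) p I) / t.
    apply: cvgM; last exact: cvg_cst.
    apply: cvgM; first exact: cvg_cst.
    by apply: cvgM; [exact: cvg_cst|exact: obliqueness_norm_cvg hQ I0].
  rewrite (_ : 47 / 80 * _ = 47 / 20 * (4^-1 * obliqueness_norm b (laplacian Q p) p I) / t).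
    apply: (ler_cvg_to c1 c2); near=> g.
    have g0 : 0 < g by near: g; exact: nbhs_right_gt.
    exact: (killed_bounds hQ I0 t0 g0 bW).1.
  by field; rewrite gt_eqF.
- have c1 : \tr (W^T *m (expmx (- (t *: killed (laplacian Q p) g))
        - proj_compression_at (laplacian Q p) I t g)) @[g --> 0^'+] -->
      \tr (W^T *m (expmx (- (t *: laplacian Q p)) - proj_compression (laplacian Q p) I t)).
    apply: tr_cvg; apply: expmx_cvg => //; last exact: killed_cvg.
    near=> g; have g0 : 0 < g by near: g; exact: nbhs_right_gt.
    exact: (killed_pd hQ g0).1.
  have c2 : 35 / 48 * (t^-1 * mxnorm b (nystrom_residual I (killed_inv (laplacian Q p) g)))
      @[g --> 0^'+] --> 35 / 48 * (t^-1 * nystrom_error b (laplacian Q p) I).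
    apply: cvgM; first exact: cvg_cst.
    by apply: cvgM; [exact: cvg_cst|exact: nystrom_error_cvg hQ I0].
  rewrite (mulrC (nystrom_error _ _ _)); apply: (ler_cvg_to c1 c2); near=> g.
  have g0 : 0 < g by near: g; exact: nbhs_right_gt.
  exact: (killed_bounds hQ I0 t0 g0 bW).2.
Unshelve. all: by end_near. Qed.

Lemma sqrt3_pi (R : realType) : 35 / 48 <= 3 * Num.sqrt 3 / (2 * pi) :> R.
Proof.
have p0 := pi_gt0 R; have p34 := pi_le_34 R.
have s3 : 173 / 100 <= Num.sqrt 3 :> R.
  by rewrite -(ler_pXn2r (ltn0Sn 1)) ?nnegrE ?sqrtr_ge0 ?sqr_sqrtr//; lra.
by rewrite ler_pdivlMr ?mulr_gt0//; lra.
Qed.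

Lemma two_div_pi (R : realType) : 47 / 80 <= 2 / pi :> R.
Proof.
have p0 := pi_gt0 R; have p34 := pi_le_34 R.
by rewrite ler_pdivlMr//; lra.
Qed.

Lemma mxnorm_bounds_of_dual (b : norm_index) (R : realType) n
    (S P0 P : 'M[R]_n) (psi eps t : R) :
  S^T = S -> P0^T = P0 -> P^T = P ->
  (forall W, dual_ball b W -> \tr (W^T *m (S - P0)) <= 47 / 80 * (psi / t) /\
                              \tr (W^T *m (P - P0)) <= 35 / 48 * (eps / t)) ->
  mxnorm b (S - P0) <= 2 / pi * (psi / t) /\
  mxnorm b (S - P) <= t^-1 * (3 * Num.sqrt 3 / (2 * pi) * eps + 2 / pi * psi).
Proof.
move=> sS sP0 sP bounds.
(* Testing with W = 0 yields the signs needed to enlarge the constants. *)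
have [psi0 eps0] : 0 <= psi / t /\ 0 <= eps / t.
  have := bounds 0 (dual_ball0 _ _ _ _); rewrite trmx0 !mul0mx !linear0.
  move=> [h1 h2]; split.
    by move: h1; rewrite pmulr_rge0// divr_gt0.
  by move: h2; rewrite pmulr_rge0// divr_gt0.
have ball1 W : dual_ball b W -> \tr (W^T *m (S - P0)) <= 2 / pi * (psi / t).
  move=> bW; apply: le_trans (bounds W bW).1 _.
  exact: ler_wpM2r psi0 _ _ (two_div_pi R).
have ball2 W : dual_ball b W ->
    \tr (W^T *m (P - P0)) <= 3 * Num.sqrt 3 / (2 * pi) * (eps / t).
  move=> bW; apply: le_trans (bounds W bW).2 _.
  exact: ler_wpM2r eps0 _ _ (sqrt3_pi R).
split; apply: mxnorm_le; [by rewrite linearB /= sS sP0|exact: ball1| |].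
  by rewrite linearB /= sS sP.
(* The triangle inequality at the level of traces: the dual ball is symmetric, so the second
   difference is tested against -W. *)
move=> W bW; have -> : S - P = (S - P0) - (P - P0) by rewrite opprB addrA subrK.
rewrite mulmxBr linearB /=.
have := ball1 W bW; have := ball2 _ (dual_ballN bW).
rewrite linearN /= mulNmx linearN /= => h2 h1.
apply: le_trans (lerD h1 h2) _.
move: (3 * _ / _) (2 / pi) => A B.
by rewrite mulrDr addrC (mulrC eps) (mulrC psi) !(mulrCA t^-1).
Qed.

Theorem mainTheorem6 (R : realType) (n : nat) (Q : 'M[R]_n) (p : 'cV[R]_n)
    (hQ : reversible_rate_matrix Q p)
    (d : measure_display) (T : measurableType d)
    (Pr : 'I_n -> probability T R) (X : R -> T -> 'I_n)
    (hX : is_ctmc Q Pr X)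
    (I : {set 'I_n}) (hI : I != finset.set0) (t : R) (ht : 0 < t) :
  let L := laplacian Q p in
  let C := symmetrize p (committor Pr X I) in
  let P := expmx (- (t *: L)) in
  let PI := proj_compression L I t in
  let Psp := sp_compression L C t in
  forall b : norm_index,
    let eps := nystrom_error b L I in
    let psi := obliqueness_norm b L p I in
    mxnorm b (Psp - PI) <= 2 / pi * (psi / t) /\
    mxnorm b (Psp - P) <=
      t^-1 * (3 * Num.sqrt 3 / (2 * pi) * eps + 2 / pi * psi).
Proof.
move=> L C P PI Psp b eps psi.
have CE : Psp = sp_compression L (symmetrize p (unsymmetrize p (extension I L))) t.
  by rewrite /Psp /C (committor_extension hQ hX hI).
have sL : L^T = L := laplacian_sym hQ.
have sPI : PI^T = PI := proj_compression_sym hQ hI ht.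
have sPsp : Psp^T = Psp by exact: sp_compression_sym.
have sP : P^T = P by exact: expmx_sym.
apply: (mxnorm_bounds_of_dual sPsp sPI sP) => W bW.
by rewrite CE; exact: (compression_bounds hQ hI ht bW).
Qed.
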